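(* Let $f:N\to N$ be a local $C^\infty$ diffeomorphism of a sub-Riemannian manifold $N$ preserving the horizontal distribution $E$. Assume that $E$ is generic (of order $r$) at a point $p\in N$ where $f(p)=p$, and that the graded automorphism $f_*:TC_pN\to TC_pN$ induced from $f$ is a homothety. Then there exists a $\lambda>1$ such that, for each $i=0,\dots,r$, $D_pf|_{E^i_p}$ has Lyapunov exponents $\log\lambda,2\log\lambda,\dots,(i+1)\log\lambda$ with corresponding multiplicities $\dim\mathfrak n^0,\dots,\dim\mathfrak n^i$, where $\mathfrak n=\bigoplus_{i=0}^r\mathfrak n^i$ is the graded Lie algebra of $TC_pN$.
   Context: A sub-Riemannian manifold is a smooth manifold $N$ with a smooth distribution $E\subset TN$ (the horizontal distribution) satisfying Hörmander's condition (vector fields tangent to $E$ together with their iterated brackets generate $TN$), and a smooth Riemannian inner product on $E$. The Carnot-Carathéodory distance $d_C(x,y)$ is the infimum of lengths of curves tangent to $E$ joining $x$ to $y$. ''$f$ preserves $E$'' means $Df(E)=E$. For $i\ge 0$, $E^i_x\subset T_xN$ is the span at $x$ of all iterated brackets, with at most $i$ bracket operations, of vector fields tangent to $E$. $E$ is generic (of order $r$) at $p$ if on a neighborhood $U$ of $p$ the $E^i_x$ form a strictly increasing sequence of smooth subbundles $E=E^0\subset E^1\subset\dots\subset E^r=TU$. At a generic point $p$, the tangent cone $TC_pN$, i.e. the pointed Gromov-Hausdorff limit of $(N,p,t\,d_C)$ as $t\to\infty$, exists, is unique, and is a Carnot nilpotent Lie group with Lie algebra $\mathfrak n=\bigoplus_{i=0}^r\mathfrak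 n^i$, $\mathfrak n^{i+1}=[\mathfrak n^i,\mathfrak n^0]$, carrying an invariant Carnot-Carathéodory metric induced by the inner product on $\mathfrak n^0\cong E(p)$. The map $f_*$ (the Carnot derivative) is the limit, uniform on compact sets as $t\to\infty$, of the maps $f_t:(N,p,t\,d_C)\to(N,f(p),t\,d_C)$ given by $f$; it is a graded automorphism of $TC_pN$. A surjective map $h$ of metric spaces is a homothety if $d(h(x),h(y))=C\,d(x,y)$ for some constant $C>0$ and all $x,y$. At a fixed point $p$, the Lyapunov exponents of $D_pf$ (or of its restriction to an invariant subspace) are the logarithms of the absolute values of its eigenvalues.
   Formalization: The formal theorem gives λ > 0 for every homothety, and λ > 1 only when the homothety constant C exceeds 1; as stated, λ > 1 fails for f = id (C = 1, all exponents 0) and for contractions. *)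

(* Defs.v *)
From HB Require Import structures.
From mathcomp Require Import all_boot all_order all_algebra.
From mathcomp Require Import all_classical all_reals all_analysis.
From mathcomp.real_closed Require Import complex.

Set Implicit Arguments.
Unset Strict Implicit.
Unset Printing Implicit Defensive.

Import Order.TTheory GRing.Theory Num.Theory.
Import numFieldNormedType.Exports.

Local Open Scope classical_set_scope.
Local Open Scope ring_scope.

(** * Linear algebra *)

Section LinearAlgebra.
Context {R : realType}.

Definition vspan {V : vectType R} (A : set V) : {vspace V} :=
  xget 0%VS [set W : {vspace V} | (forall v, A v -> v \in W) /\
    (forall W' : {vspace V}, (forall v, A v -> v \in W') -> (W <= W')%VS)].

Lemma vspanP {V : vectType R} (A : set V) :
  (forall v, A v -> v \in vspan A) /\
  (forall W : {vspace V}, (forall v, A v -> v \in W) -> (vspan A <= W)%VS).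
Proof.
rewrite /vspan; case: xgetP => [W _ //|noW].
pose P d := `[< exists s : seq V, (forall v, v \in s -> A v) /\ \dim (span s) = d >].
have P0 : exists d, P d by exists 0%N; apply/asboolP; exists [::]; rewrite span_nil dimv0.
have Pb d : P d -> (d <= \dim {:V})%N.
  by move=> /asboolP[s [_ <-]]; rewrite dimvS// subvf.
case: (ex_maxnP P0 Pb) => d /asboolP[s [sA sd]] maxd.
case: (noW (span s)); split => [v Av|W' AW'].
  have : (\dim (span (v :: s)) <= \dim (span s))%N.
    rewrite sd; apply: maxd; apply/asboolP; exists (v :: s); split=> // w.
    by rewrite inE => /orP[/eqP->//|/sA].
  have ss : (span s <= span (v :: s))%VS by rewrite span_cons addvSr.
  rewrite (geq_leqif (dimv_leqif_sup ss)) => /subvP; apply.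
  by rewrite memv_span// mem_head.
by apply/span_subvP => v /sA/AW'.
Qed.

(* Matrix of the restriction of [A] to an invariant subspace [W]. *)
Definition restr_mx {V : vectType R} (A : 'End(V)) (W : {vspace V}) : 'M[R]_(\dim W) :=
  \matrix_(i, j) coord (vbasis W) j (A (vbasis W)`_i).

(* [s] lists the numbers ln |z|, where z runs over the complex roots of the
   characteristic polynomial of [A] on [W], repeated according to multiplicity. *)
Definition lyapunov_exponents_on {V : vectType R} (A : 'End(V)) (W : {vspace V})
    (s : seq R) : Prop :=
  (A @: W <= W)%VS /\
  exists zs : seq R[i],
    map_poly (real_complex R) (char_poly (restr_mx A W)) = \prod_(z <- zs) ('X - z%:P) /\
    perm_eq [seq ln (Normc.normc z) | z <- zs] s.

End LinearAlgebra.

(** * Smooth maps between open subsets of normed spaces *)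

Section Smooth.
Context {R : realType}.

(* For finite-dimensional [V] this is the usual notion of class C^k on an open
   set [U]: continuity of all the maps x |-> 'd f x v is continuity of 'd f. *)
Fixpoint Ck {V W : normedModType R} (k : nat) (U : set V) (f : V -> W) : Prop :=
  match k with
  | 0 => forall x, U x -> {for x, continuous f}
  | k'.+1 => (forall x, U x -> differentiable f x) /\
             (forall v, Ck k' U (fun x => 'd f x v))
  end.

Definition Cinf {V W : normedModType R} (U : set V) (f : V -> W) : Prop :=
  forall k, Ck k U f.

End Smooth.

(** * Manifolds *)

Record chart (R : realType) (n : nat) (T : Type) := Chart {
  cdom : set T;
  cmap :> T -> 'rV[R]_n;
  cinv : 'rV[R]_n -> T }.

Record is_chart {R : realType} {n : nat} {T : topologicalType} (c : chart R n T) : Prop := {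
  chart_open_dom : open (cdom c);
  chart_open_cod : open (c @` cdom c);
  chart_cancel : forall x, cdom c x -> cinv c (c x) = x;
  chart_cont : forall x, cdom c x -> {for x, continuous (cmap c)};
  chart_inv_cont : forall u, (c @` cdom c) u -> {for u, continuous (cinv c)} }.

(* Every point carries a preferred chart [chart_at x], through which the tangent
   space T_xM is identified with 'rV[R]_n.  Tangent vectors, vector fields,
   distributions and metrics below are all written using this identification. *)
Record manifold (R : realType) (n : nat) := Manifold {
  mcarrier :> topologicalType;
  hausdorff_manifold : hausdorff_space mcarrier;
  second_countable_manifold : @second_countable mcarrier;
  atlas : set (chart R n mcarrier);
  atlas_chart : forall c, atlas c -> is_chart c;
  atlas_compat : forall c c', atlas c -> atlas c' ->
    Cinf (c @` (cdom c `&` cdom c')) (c' \o cinv c);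
  chart_at : mcarrier -> chart R n mcarrier;
  chart_at_atlas : forall x, atlas (chart_at x);
  chart_at_dom : forall x, cdom (chart_at x) x }.

Section ManifoldTheory.
Context {R : realType} {n : nat}.
Implicit Types (M : manifold R n).

Definition smooth_on {m : nat} {M} {M' : manifold R m} (U : set M) (f : M -> M') : Prop :=
  (forall x, U x -> {for x, continuous f}) /\
  forall c c', atlas c -> atlas c' ->
    Cinf (c @` (cdom c `&` U `&` f @^-1` cdom c')) (c' \o f \o cinv c).

Definition smooth_fun_on {M} (U : set M) (h : M -> R) : Prop :=
  forall c, atlas c -> Cinf (c @` (cdom c `&` U)) (h \o cinv c : 'rV[R]_n -> R^o).

Definition tangent_map {m : nat} {M} {M' : manifold R m} (f : M -> M') (x : M) :
    'Hom('rV[R]_n, 'rV[R]_m) :=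
  linfun ('d (chart_at (f x) \o f \o cinv (chart_at x)) (chart_at x x)).

Definition local_diffeo {M} (f : M -> M) : Prop :=
  forall x, exists U : set M, open_nbhs x U /\ open (f @` U) /\ smooth_on U f /\
    exists g : M -> M, smooth_on (f @` U) g /\ forall y, U y -> g (f y) = y.

(* The vector field [X] read in the chart [c]. *)
Definition field_in_chart {M} (c : chart R n M) (X : M -> 'rV[R]_n) (u : 'rV[R]_n) :
    'rV[R]_n :=
  let x := cinv c u in 'd (c \o cinv (chart_at x)) (chart_at x x) (X x).

Definition smooth_field_on {M} (U : set M) (X : M -> 'rV[R]_n) : Prop :=
  forall c, atlas c -> Cinf (c @` (cdom c `&` U)) (field_in_chart c X).

Definition lie_bracket {M} (X Y : M -> 'rV[R]_n) (x : M) : 'rV[R]_n :=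
  let c := chart_at x in
  'd (field_in_chart c Y) (c x) (X x) - 'd (field_in_chart c X) (c x) (Y x).

Definition smooth_subbundle_on {M} (U : set M) (F : M -> {vspace 'rV[R]_n}) : Prop :=
  forall x, U x -> exists V : set M, open_nbhs x V /\
    exists (k : nat) (X : 'I_k -> M -> 'rV[R]_n),
      (forall i, smooth_field_on V (X i)) /\
      forall y, V y -> basis_of (F y) [seq X i y | i <- enum 'I_k].

Definition tangent_to {M} (F : M -> {vspace 'rV[R]_n}) (U : set M) (X : M -> 'rV[R]_n) :
    Prop :=
  smooth_field_on U X /\ forall y, U y -> X y \in F y.

(* [iter_bracket E U j X]: [X] is obtained from vector fields on [U] tangent to
   [E] with exactly [j] bracket operations. *)
Inductive iter_bracket {M} (E : M -> {vspace 'rV[R]_n}) (U : set M) :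
    nat -> (M -> 'rV[R]_n) -> Prop :=
| iter_bracket0 X : tangent_to E U X -> iter_bracket E U 0 X
| iter_bracketS i j X Y : iter_bracket E U i X -> iter_bracket E U j Y ->
    iter_bracket E U (i + j).+1 (lie_bracket X Y).

Definition flag {M} (E : M -> {vspace 'rV[R]_n}) (i : nat) (x : M) :
    {vspace 'rV[R]_n} :=
  vspan [set v | exists (U : set M) (j : nat) (X : M -> 'rV[R]_n),
    [/\ open_nbhs x U, (j <= i)%N, iter_bracket E U j X & X x = v]].

Definition hormander {M} (E : M -> {vspace 'rV[R]_n}) : Prop :=
  forall x, exists i, flag E i x = fullv.

Definition generic_at {M} (E : M -> {vspace 'rV[R]_n}) (r : nat) (p : M) : Prop :=
  exists U : set M, open_nbhs p U /\
    (forall i, (i <= r)%N -> smooth_subbundle_on U (flag E i)) /\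
    forall x, U x -> flag E r x = fullv /\
      forall i, (i < r)%N -> (flag E i x <= flag E i.+1 x)%VS /\ flag E i x <> flag E i.+1 x.

(* C^1 at every point of the closed interval [0, 1], i.e. C^1 on an open interval
   containing it. *)
Definition C1_arc {M} (g : R -> M) : Prop :=
  forall s, 0 <= s <= 1 -> {for s, continuous g} /\
    forall c, atlas c -> cdom c (g s) ->
      (\forall u \near s, derivable (c \o g) u 1) /\ {for s, continuous (derive1 (c \o g))}.

Definition velocity {M} (g : R -> M) (s : R) : 'rV[R]_n :=
  derive1 (chart_at (g s) \o g) s.

End ManifoldTheory.

(** * Sub-Riemannian manifolds *)

(* The inner product [sr_metric x] is only constrained on [hor x]. *)
Record subRiemannian (R : realType) (n : nat) := SubRiemannian {
  sr_manifold :> manifold R n;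
  hor : sr_manifold -> {vspace 'rV[R]_n};
  hor_smooth : smooth_subbundle_on setT hor;
  hor_hormander : hormander hor;
  sr_metric : sr_manifold -> 'rV[R]_n -> 'rV[R]_n -> R;
  sr_metric_lin : forall x a u v w, u \in hor x -> v \in hor x -> w \in hor x ->
    sr_metric x (a *: u + v) w = a * sr_metric x u w + sr_metric x v w;
  sr_metric_sym : forall x u v, u \in hor x -> v \in hor x ->
    sr_metric x u v = sr_metric x v u;
  sr_metric_pos : forall x u, u \in hor x -> u != 0 -> 0 < sr_metric x u u;
  sr_metric_smooth : forall U X Y, open U -> tangent_to hor U X -> tangent_to hor U Y ->
    smooth_fun_on U (fun x => sr_metric x (X x) (Y x)) }.

Section SubRiemannianTheory.
Context {R : realType} {n : nat}.
Implicit Types (N : subRiemannian R n).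

Definition preserves_hor {N} (f : N -> N) : Prop :=
  forall x, (tangent_map f x @: hor x)%VS = hor (f x).

Definition horizontal {N} (g : R -> N) : Prop :=
  C1_arc g /\ forall s, 0 <= s <= 1 -> velocity g s \in hor (g s).

Definition arc_length {N} (g : R -> N) : \bar R :=
  (\int[lebesgue_measure]_(s in `[0%R, 1%R])
     (Num.sqrt (sr_metric (g s) (velocity g s) (velocity g s)))%:E)%E.

(* [joined x y l]: [x] and [y] are joined by a piecewise C^1 horizontal curve, a
   concatenation of finitely many C^1 horizontal arcs, of total length [l]. *)
Inductive joined {N} (x : N) : N -> \bar R -> Prop :=
| joined_refl : joined x x 0%E
| joined_arc y l (g : R -> N) : joined x y l -> horizontal g -> g 0 = y ->
    joined x (g 1) (l + arc_length g)%E.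

(* Carnot-Caratheodory distance; +oo between points not joined by a horizontal curve. *)
Definition cc_dist {N} (x y : N) : \bar R := ereal_inf [set l | joined x y l].

Definition homothety {N N' : subRiemannian R n} (C : R) (h : N -> N') : Prop :=
  0 < C /\ (forall y, exists x, h x = y) /\
  forall x y, cc_dist (h x) (h y) = (C%:E * cc_dist x y)%E.

End SubRiemannianTheory.

(** * Carnot groups and tangent cones *)

Definition simply_connected (R : realType) (T : topologicalType) : Prop :=
  (forall x y : T, exists g : R -> T, continuous g /\ g 0 = x /\ g 1 = y) /\
  (forall g : R -> T, continuous g -> g 0 = g 1 ->
    exists H : R * R -> T, continuous H /\
      forall s, 0 <= s <= 1 ->
        [/\ H (s, 0) = g s, H (s, 1) = g 0, H (0, s) = g 0 & H (1, s) = g 0]).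

Definition left_field {R : realType} {n : nat} {G : manifold R n} (mul : G -> G -> G)
    (e : G) (u : 'rV[R]_n) (x : G) : 'rV[R]_n := tangent_map (mul x) e u.

(* The Lie algebra is the tangent space at [gone] with the bracket of left-invariant
   vector fields. *)
Record carnot_group (R : realType) (n r : nat) := CarnotGroup {
  cg_sr :> subRiemannian R n;
  gmul : cg_sr -> cg_sr -> cg_sr;
  ginv : cg_sr -> cg_sr;
  gone : cg_sr;
  gmulA : associative gmul;
  gmul1 : left_id gone gmul;
  gmulV : left_inverse gone ginv gmul;
  gmul_cont : continuous (fun z : cg_sr * cg_sr => gmul z.1 z.2);
  gmul_smooth : forall c1 c2 c3, atlas c1 -> atlas c2 -> atlas c3 ->
    Cinf [set w : 'rV[R]_n * 'rV[R]_n |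
            exists x y, [/\ cdom c1 x, cdom c2 y, cdom c3 (gmul x y) & w = (c1 x, c2 y)]]
         (fun w => c3 (gmul (cinv c1 w.1) (cinv c2 w.2)));
  ginv_smooth : smooth_on setT ginv;
  cg_simply_connected : simply_connected R cg_sr;
  hor_left_inv : forall x y : cg_sr,
    (tangent_map (gmul x) y @: hor y)%VS = hor (gmul x y);
  sr_metric_left_inv : forall (x y : cg_sr) u v, u \in hor y -> v \in hor y ->
    sr_metric (gmul x y) (tangent_map (gmul x) y u) (tangent_map (gmul x) y v) =
    sr_metric y u v;
  lie : 'rV[R]_n -> 'rV[R]_n -> 'rV[R]_n :=
    fun u v => lie_bracket (left_field gmul gone u) (left_field gmul gone v) gone;
  grad : nat -> {vspace 'rV[R]_n};
  grad_direct : directv (\sum_(i < r.+1) grad i)%VS;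
  grad_full : (\sum_(i < r.+1) grad i)%VS = fullv;
  grad_gt : forall i, (r < i)%N -> grad i = 0%VS;
  grad_lie : forall i j u v, u \in grad i -> v \in grad j -> lie u v \in grad (i + j).+1;
  grad_gen : forall i,
    grad i.+1 = vspan [set w | exists u v, [/\ u \in grad i, v \in grad 0 & w = lie u v]];
  hor_one : hor gone = grad 0 }.

Definition graded_automorphism {R : realType} {n r : nat} {G : carnot_group R n r}
    (h : G -> G) : Prop :=
  [/\ {morph h : x y / gmul x y}, bijective h, smooth_on setT h &
      forall i, (tangent_map h (gone G) @: grad G i)%VS = grad G i].

(* The tangent cone of [N] at [p]: a Carnot group together with
   - [tc_approx t], approximations realizing it as the pointed Gromov-Hausdorff limit
     of (N, p, t d_C) as t tends to +oo;
   - [tc_symbol i], which induces the identification of E^i_p / E^{i-1}_p with the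
     i-th layer of the Lie algebra: brackets in the latter come from brackets of vector
     fields on [N], and the inner product on the first layer comes from that of E_p. *)
Record tangent_cone (R : realType) (n r : nat) (N : subRiemannian R n) (p : N) :=
  TangentCone {
  tc_group :> carnot_group R n r;
  tc_approx : R -> tc_group -> N;
  tc_approx_one : forall t, tc_approx t (gone tc_group) = p;
  tc_approx_isom : forall rho eps : R, 0 < rho -> 0 < eps ->
    exists t0 : R, forall t, t0 <= t -> forall x y : tc_group,
      (cc_dist (gone tc_group) x < rho%:E)%E -> (cc_dist (gone tc_group) y < rho%:E)%E ->
      (t%:E * cc_dist (tc_approx t x) (tc_approx t y) <= cc_dist x y + eps%:E)%E /\
      (cc_dist x y <= t%:E * cc_dist (tc_approx t x) (tc_approx t y) + eps%:E)%E;
  tc_approx_onto : forall rho eps : R, 0 < eps -> eps < rho ->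
    exists t0 : R, forall t, t0 <= t -> forall z : N,
      (t%:E * cc_dist p z < (rho - eps)%:E)%E ->
      exists x : tc_group, (cc_dist (gone tc_group) x < rho%:E)%E /\
        (t%:E * cc_dist (tc_approx t x) z < eps%:E)%E;
  tc_symbol : nat -> 'End('rV[R]_n);
  tc_symbol_image : forall i, (tc_symbol i @: flag (@hor _ _ N) i p)%VS = grad tc_group i;
  tc_symbol_ker : forall i v, v \in flag (@hor _ _ N) i p ->
    (tc_symbol i v == 0) = (if i is i'.+1 then v \in flag (@hor _ _ N) i' p else v == 0);
  tc_symbol_lie : forall i j (U : set N) (X Y : N -> 'rV[R]_n), open_nbhs p U ->
    tangent_to (flag (@hor _ _ N) i) U X -> tangent_to (flag (@hor _ _ N) j) U Y ->
    tc_symbol (i + j).+1 (lie_bracket X Y p) =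
    lie tc_group (tc_symbol i (X p)) (tc_symbol j (Y p));
  tc_symbol_isom : forall u v, u \in hor p -> v \in hor p ->
    sr_metric (gone tc_group) (tc_symbol 0 u) (tc_symbol 0 v) = sr_metric p u v }.

(* [fs] is the limit, uniform on compact sets, of f : (N, p, t d_C) -> (N, p, t d_C)
   as t tends to +oo. *)
Definition carnot_derivative {R : realType} {n r : nat} {N : subRiemannian R n} {p : N}
    (TC : tangent_cone r p) (f : N -> N) (fs : TC -> TC) : Prop :=
  forall K : set TC, compact K -> forall eps : R, 0 < eps ->
    exists t0 : R, forall t, t0 <= t -> forall x : TC, K x ->
      (t%:E * cc_dist (f (tc_approx t x)) (tc_approx t (fs x)) <= eps%:E)%E.

(* Main.v *)
(* Write L for the differential of f at p and |u| for the sub-Riemannian norm on E_p.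

   Metric part: |Lu| = C |u| on E_p, where C is the ratio of the homothety f_*.  Follow a
   horizontal curve issued from p with velocity u for time 1/t: it ends at a point z with
   d(p, z) <= (|u| + o(1))/t.  Choosing x in the cone with approximation a close to z, the
   point b approximating f_*(x) lies within o(1/t) of f(a) and d(p, b) is C d(p, a) up to
   o(1/t).  In a chart t(b - p) tends to Lu, and a linear functional that is smaller than
   k > 1 times the norm on E_p bounds t(b - p) by k t d(p, b); hence |Lu| <= C |u|.  The
   reverse inequality comes in the same way from a curve with velocity Lu and a preimage
   under f_*.

   Algebraic part: f preserves iterated brackets, so L preserves the flag and induces on
   the graded algebra of TC_pN a map compatible with brackets.  Since the layers are
   generated by the first one, on which L multiplies the norm by C, the powers of L grow
   at most like C^((i+1)k) on the i-th layer, and those of L^-1 like C^(-(i+1)k).  Hence all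
   eigenvalues on the i-th layer have modulus C^(i+1). *)
Require Import Defs.
From HB Require Import structures.
From mathcomp Require Import all_boot all_order all_algebra.
From mathcomp Require Import all_classical all_reals all_analysis.
From mathcomp Require Import unstable.
From mathcomp Require Import ring lra.
From mathcomp.real_closed Require Import complex.

Set Implicit Arguments.
Unset Strict Implicit.
Unset Printing Implicit Defensive.

Import Order.TTheory GRing.Theory Num.Theory.
Import numFieldNormedType.Exports.

Local Open Scope classical_set_scope.
Local Open Scope ring_scope.

(** * Functions of class C^k *)

Section Calculus.
Context {R : realType}.
Implicit Types V W : normedModType R.

(** The convergence towards f_* is mere uniform convergence, so it says nothing directly about the
    linear map L. Moreover the distance to p is not comparable with the coordinate distance: at
    coordinate distance h it may be of order h^(1/(r+1)), so positions cannot be converted into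
    distances. Two one-sided facts replace such a comparison. Coordinates move at most K times as
    fast as length, which allows a point to be replaced by another one within o(1/t). A functional
    dominated by the norm on E_p grows at most k times as fast as length, so that a displacement
    close to w / t forces a distance of at least about |w| / t. The approximations and the symbols
    of a tangent cone are separate data. This is why the ratio C reaches L through distances on N
    near p, and not through the derivative of f_* at the unit. On the algebraic side L may a priori
    have Jordan blocks and complex eigenvalues, so growth is only estimated up to constants. The
    quotients E^i_p / E^(i-1)_p are never formed: vectors of E^i_p stand for their classes and are
    compared through [tc_symbol i]. *)

Lemma nbhs_closed_ball V (x : V) (Q : set V) : nbhs x Q ->
  exists2 r : R, 0 < r & forall y, `|y - x| <= r -> Q y.
Proof.
move/nbhs_normP => [e /= e0 He]; exists (e / 2); first by rewrite divr_gt0.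
move=> y hy; apply: He; rewrite /= distrC; apply: le_lt_trans hy _.
by rewrite ltr_pdivrMr// mulr2n mulrDr mulr1 ltrDl.
Qed.

(** ['d] is selected by [get] among the maps satisfying the first-order expansion, and maps that
    agree near [x] have the same candidates; so equality holds even where [f] is not
    differentiable. *)
Lemma near_eq_diffE V W (f g : V -> W) (x : V) :
  (\forall y \near x, f y = g y) -> 'd f x = 'd g x.
Proof.
move=> fg.
have fgx : f x = g x by exact: (nbhs_singleton fg).
have E (h h' : V -> W) (d : V -> W) : (\forall y \near x, h y = h' y) -> h x = h' x ->
    (forall y, h y = h (lim (nbhs x)) + d (y - lim (nbhs x))
                    +o_(y \near x) (y - lim (nbhs x))) ->
    (forall y, h' y = h' (lim (nbhs x)) + d (y - lim (nbhs x))
                    +o_(y \near x) (y - lim (nbhs x))).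
  move=> hh hx H.
  have {}H : h = cst (h (lim (nbhs x))) + d \o center (lim (nbhs x))
      +o_x (center (lim (nbhs x))) by rewrite funeqE.
  suff : h' = cst (h' (lim (nbhs x))) + d \o center (lim (nbhs x))
      +o_x (center (lim (nbhs x))) by rewrite {1}funeqE.
  apply/eqaddoP => _/posnumP[e]; move/eqaddoP/(_ e%:num (gt0 e)) : H.
  rewrite lim_id// => H.
  by apply: filterS2 hh H => y; rewrite !fctE hx => ->.
rewrite /diff; congr (get _); apply/funext => d; apply/propext.
split=> -[cd H]; split=> //; [apply: (E f) => //|apply: (E g) => //].
by apply: filterS fg => y ->.
Qed.

Lemma near_eq_diffv V W (f g : V -> W) (x v : V) :
  (\forall y \near x, f y = g y) -> 'd f x v = 'd g x v.
Proof. by move=> /near_eq_diffE ->. Qed.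

Lemma near_eq_differentiable V W (f g : V -> W) (x : V) :
  (\forall y \near x, f y = g y) -> differentiable f x -> differentiable g x.
Proof.
move=> fg /diff_locallyP[dc df]; apply/diff_locallyP.
rewrite -(near_eq_diffE fg); split=> //; apply/eqaddoP => _/posnumP[e].
move/eqaddoP/(_ e%:num (gt0 e)) : df.
have fgx : f x = g x by exact: (nbhs_singleton fg).
have fg0 : \forall h \near 0, f (h + x) = g (h + x).
  by move: fg; rewrite (near_shift 0) /= subr0.
apply: filterS2 fg0 => h E.
by rewrite !fctE /= E fgx.
Qed.

Lemma diff_eps V W (f : V -> W) (x : V) (e : R) : differentiable f x -> 0 < e ->
  \forall y \near x, `|f y - f x - 'd f x (y - x)| <= e * `|y - x|.
Proof.
move=> /diff_locally/eqaddoP H e0; rewrite (near_shift 0) /= subr0.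
apply: filterS (H e e0) => h; rewrite /= !fctE /= addrK.
by rewrite opprD addrA.
Qed.

Lemma diff_sumE V W (f : V -> W) (x : V) (n : nat) (a : 'I_n -> R) (v : 'I_n -> V) :
  'd f x (\sum_i a i *: v i) = \sum_i a i *: 'd f x (v i).
Proof. by rewrite linear_sum; apply: eq_bigr => i _; rewrite linearZ. Qed.

Lemma row_delta n (v : 'rV[R]_n) : v = \sum_j v 0 j *: delta_mx 0 j.
Proof. exact: row_sum_delta. Qed.

Lemma differentiable_rowP V n (f : V -> 'rV[R]_n) (x : V) :
  differentiable f x <-> forall i, differentiable (fun y => f y 0 i) x.
Proof.
split=> [df i|df].
  apply: (@differentiable_comp _ _ _ _ f (fun M : 'rV[R]_n => M 0 i)) => //.
  exact: differentiable_coord.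
have -> : f = \sum_i (fun y => f y 0 i *: (delta_mx 0 i : 'rV[R]_n)).
  by apply/funext => y; rewrite fct_sumE -row_delta.
by apply: differentiable_sum => i; apply: differentiableZl.
Qed.

Lemma diff_row V n (f : V -> 'rV[R]_n) (x : V) v i : differentiable f x ->
  'd (fun y => f y 0 i) x v = 'd f x v 0 i.
Proof.
move=> df.
have dc := @differentiable_coord R 1 n.
have -> : (fun y => f y 0 i) = (fun M : 'rV[R]_n => M 0 i) \o f by [].
rewrite diff_comp //=.
pose c := fun M : 'rV[R]_n => M 0 i.
have lc : linear c by move=> a u w; rewrite /c !mxE.
pose C : {linear 'rV[R]_n -> R} := HB.pack c (GRing.isLinear.Build _ _ _ _ _ lc).
have CC : continuous C by exact: coord_continuous.
by rewrite (diff_lin (f:=C)).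
Qed.

Section Ck_closure.
Implicit Types (k : nat).

(** [Ck] is a condition at each point of [U], continuity and differentiability being taken in the
    whole space. Passing to subsets is then immediate. *)
Lemma Ck_pt V W k (U : set V) (f : V -> W) :
  Ck k U f <-> forall x, U x -> Ck k [set x] f.
Proof.
elim: k W f => [|k IH] W f /=.
  by split=> [H x /H fx y ->|H x /H]//; apply.
split=> [[df H] x Ux|H].
  split=> [y ->|v]; first exact: df.
  by have /IH := H v; apply.
split=> [x /H[+ _]|v]; first by apply.
by apply/IH => x /H[].
Qed.

Lemma Ck_sub V W k (U U' : set V) (f : V -> W) : U' `<=` U -> Ck k U f -> Ck k U' f.
Proof. by move=> s /Ck_pt H; apply/Ck_pt => x /s/H. Qed.

Lemma Ck_near_eq V W k (U : set V) (f g : V -> W) :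
  (forall x, U x -> \forall y \near x, f y = g y) -> Ck k U f -> Ck k U g.
Proof.
elim: k W f g => [|k IH] W f g fg /=.
  move=> H x Ux; have := H x Ux; have fgx := nbhs_singleton (fg x Ux).
  rewrite /prop_for /continuous_at fgx => /(_ _ _) H2.
  apply: cvg_trans H2; apply: near_eq_cvg; exact: fg.
move=> [df Hf]; split=> [x Ux|v].
  exact: near_eq_differentiable (fg x Ux) (df x Ux).
apply: IH (Hf v) => x /fg/near_join; apply: filterS => y /near_eq_diffE ->//.
Qed.

Lemma Ck_open_eq V W k (U : set V) (f g : V -> W) : open U ->
  (forall x, U x -> f x = g x) -> Ck k U f -> Ck k U g.
Proof.
by move=> oU fg; apply: Ck_near_eq => x Ux; apply: filterS (open_nbhs_nbhs (conj oU Ux)).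
Qed.

Lemma Ck_cont V W k (U : set V) (f : V -> W) x : Ck k U f -> U x -> {for x, continuous f}.
Proof.
by case: k => [|k] /= => [|[df _] Ux]; [apply|apply: differentiable_continuous; apply: df].
Qed.

Lemma CkW V W k (U : set V) (f : V -> W) : Ck k.+1 U f -> Ck k U f.
Proof.
elim: k f => [|k IH] f H; first by move=> x; apply: Ck_cont H.
by case: H => df H; split=> // v; apply: IH.
Qed.

Lemma Ck_cst V W k (U : set V) (a : W) : Ck k U (fun=> a : W).
Proof.
elim: k a => [|k IH] a /=; first by move=> x _; exact: cvg_cst.
split=> [x _|v]; first exact: differentiable_cst.
have -> : (fun x => 'd (fun=> a) x v) = (fun=> 0) :> (V -> W).
  by apply/funext => x; rewrite diff_cst.
exact: IH.
Qed.

Lemma CkD V W k (U : set V) (f g : V -> W) : open U ->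
  Ck k U f -> Ck k U g -> Ck k U (fun x => f x + g x).
Proof.
move=> oU; elim: k f g => [|k IH] f g /=.
  by move=> cf cg x Ux; apply: continuousD; [apply: cf|apply: cg].
move=> [df Hf] [dg Hg]; split=> [x Ux|v].
  by apply: differentiableD; [apply: df|apply: dg].
apply: Ck_open_eq (IH _ _ (Hf v) (Hg v)) => // x Ux.
exact: (esym (congr1 (@^~ v) (diffD (df x Ux) (dg x Ux)))).
Qed.

Lemma CkZ V W k (U : set V) (a : R) (f : V -> W) : open U ->
  Ck k U f -> Ck k U (fun x => a *: f x).
Proof.
move=> oU; elim: k f => [|k IH] f /=.
  by move=> cf x Ux; apply: continuousZl_tmp; apply: cf.
move=> [df Hf]; split=> [x Ux|v].
  by apply: differentiableZ; apply: df.
apply: Ck_open_eq (IH _ (Hf v)) => // x Ux.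
exact: (esym (congr1 (@^~ v) (diffZ a (df x Ux)))).
Qed.

Lemma Ck_sum V W k (U : set V) n (f : 'I_n -> V -> W) : open U ->
  (forall i, Ck k U (f i)) -> Ck k U (fun x => \sum_i f i x).
Proof.
move=> oU; elim: n f => [|n IH] f H.
  have -> : (fun x => \sum_(i < 0) f i x) = (fun=> 0) by apply/funext => x; rewrite big_ord0.
  exact: Ck_cst.
have -> : (fun x => \sum_(i < n.+1) f i x) =
    (fun x => (\sum_(i < n) f (widen_ord (leqnSn n) i) x) + f ord_max x).
  by apply/funext => x; rewrite big_ord_recr.
by apply: CkD => //; apply: IH.
Qed.

Lemma CkM V k (U : set V) (f g : V -> R) : open U ->
  Ck k U f -> Ck k U g -> Ck k U (fun x => f x * g x).
Proof.
move=> oU; elim: k f g => [|k IH] f g.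
  by move=> cf cg x Ux; apply: continuousM; [apply: cf|apply: cg].
move=> Cf Cg; have [df Hf] := Cf; have [dg Hg] := Cg; split=> [x Ux|v].
  by apply: differentiableM; [apply: df|apply: dg].
apply: Ck_open_eq (CkD oU (IH _ _ (CkW Cf) (Hg v)) (IH _ _ (Hf v) (CkW Cg))) => // x Ux.
rewrite [X in _ + X]mulrC; exact: (esym (congr1 (@^~ v) (diffM (df x Ux) (dg x Ux)))).
Qed.

Lemma Ck_rowP V n k (U : set V) (f : V -> 'rV[R]_n) : open U ->
  Ck k U f <-> forall i, Ck k U (fun x => f x 0 i : R).
Proof.
move=> oU; elim: k f => [|k IH] f /=.
  split=> [cf i x Ux|cf x Ux].
    apply: (@continuous_comp _ _ _ f (fun M : 'rV[R]_n => M 0 i)); first exact: cf.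
    exact: coord_continuous.
  have -> : f = (fun y => \sum_i f y 0 i *: (delta_mx 0 i : 'rV[R]_n)).
    by apply/funext => y; rewrite -row_delta.
  have C i : Ck 0 [set x] (fun y => f y 0 i *: (delta_mx 0 i : 'rV[R]_n)).
    by move=> y ->; apply: continuousZr_tmp; exact: cf.
  rewrite /prop_for /continuous_at; apply: cvg_big => [|i _]; [exact: add_continuous|exact: C].
split=> [[df H] i|H].
  split=> [x Ux|v]; first by move: i; apply/differentiable_rowP/df.
  have := (IH _).1 (H v) i; apply: Ck_open_eq => // x Ux.
  by rewrite diff_row //; exact: df.
have df x : U x -> differentiable f x.
  by move=> Ux; apply/differentiable_rowP => i; have [+ _] := H i; apply.
split=> // v; apply/IH => i; have [_ /(_ v)] := H i; apply: Ck_open_eq => // x Ux.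
by rewrite diff_row //; exact: df.
Qed.

(** The derivative of [g \o f] along [v] is a sum of coordinates of ['d f x v] times partial
    derivatives of [g] composed with [f], to which induction applies. Closure under products is a
    hypothesis because [W] is arbitrary; [Ck_compE] discharges it. *)
Lemma Ck_comp V W n k (U : set V) (U' : set 'rV[R]_n) (f : V -> 'rV[R]_n)
    (g : 'rV[R]_n -> W) : open U -> (forall x, U x -> U' (f x)) ->
  (forall (a : V -> R) (h : V -> W) j, Ck j U a -> Ck j U h -> Ck j U (fun x => a x *: h x)) ->
  Ck k U f -> Ck k U' g -> Ck k U (g \o f).
Proof.
move=> oU UU' CS; elim: k g => [|k IH] g.
  by move=> cf cg x Ux; apply: continuous_comp; [exact: cf|apply: cg; exact: UU'].
move=> Cf Cg; have [df Hf] := Cf; have [dg Hg] := Cg; split=> [x Ux|v].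
  by apply: differentiable_comp; [exact: df|apply: dg; exact: UU'].
have H j : Ck k U (fun x => ('d f x v) 0 j *: ('d g (f x) (delta_mx 0 j))).
  apply: CS; first by move: j; apply/(Ck_rowP _ _ oU); exact: Hf.
  exact: IH (CkW Cf) (Hg _).
apply: Ck_open_eq (Ck_sum oU H) => // x Ux.
rewrite (diff_comp (df x Ux) (dg _ (UU' _ Ux))) /=.
by rewrite [in RHS](row_delta ('d f x v)) diff_sumE.
Qed.

End Ck_closure.

Section Ck_euclidean.
Variable n : nat.

Lemma CkZr V k m (U : set V) (a : V -> R) (f : V -> 'rV[R]_m) : open U ->
  Ck k U a -> Ck k U f -> Ck k U (fun x => a x *: f x).
Proof.
move=> oU Ca Cf; apply/Ck_rowP => // i.
have -> : (fun x => (a x *: f x) 0 i) = (fun x => a x * f x 0 i).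
  by apply/funext => x; rewrite mxE.
by apply: CkM => //; move: i; exact/Ck_rowP.
Qed.

Lemma Ck_compE V m k (U : set V) (U' : set 'rV[R]_n) (f : V -> 'rV[R]_n)
    (g : 'rV[R]_n -> 'rV[R]_m) : open U -> (forall x, U x -> U' (f x)) ->
  Ck k U f -> Ck k U' g -> Ck k U (g \o f).
Proof. by move=> oU UU'; apply: Ck_comp => // a h j; exact: CkZr. Qed.

(** One derivative of [g] is spent. Regularity of a field pushed by a map, or differentiated along
    another field, is obtained in this form. *)
Lemma Ck_apply_diff V m k (U : set V) (U' : set 'rV[R]_n) (f : V -> 'rV[R]_n)
    (g : 'rV[R]_n -> 'rV[R]_m) (v : V -> 'rV[R]_n) :
  open U -> (forall x, U x -> U' (f x)) ->
  Ck k U f -> Ck k.+1 U' g -> Ck k U v -> Ck k U (fun x => 'd g (f x) (v x)).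
Proof.
move=> oU UU' Cf [_ Cg] Cv.
have -> : (fun x => 'd g (f x) (v x)) =
    (fun x => \sum_j v x 0 j *: ((fun y => 'd g y (delta_mx 0 j)) \o f) x).
  apply/funext => x; apply: etrans (congr1 ('d g (f x)) (row_delta (v x))) _.
  exact: diff_sumE.
apply: Ck_sum => // j; apply: CkZr => //; first by move: j; exact/Ck_rowP.
exact: Ck_compE UU' Cf (Cg _).
Qed.

End Ck_euclidean.

End Calculus.

(** * Symmetry of second derivatives *)

Section SecondDerivatives.
Context {R : realType}.
Implicit Types V W : normedModType R.

Lemma is_derive_line V W (f : V -> W) (v c : V) (t : R) :
  differentiable f (t *: v + c) ->
  is_derive t (1 : R) (fun t => f (t *: v + c)) ('d f (t *: v + c) v).
Proof.
move=> df; pose h (t : R) := t *: v + c.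
have dh : is_diff t h ( *:%R^~ v).
  have -> : h = (fun t => t *: v) + cst c by [].
  by apply: is_diff_eq; rewrite addr0.
have dfh : differentiable (f \o h) t by apply: differentiable_comp.
split; first exact/derivable1_diffP.
rewrite -derive1E (derive1E' dfh).
by rewrite (diff_comp (@ex_diff _ _ _ _ _ _ _ dh) df) /= diff_val scale1r.
Qed.

(** The mean value theorem in the direction [v] turns the second difference into [s] times an
    increment of ['d f _ v] in the direction [w], which differentiability of that function at [x]
    controls. *)
Lemma second_difference V (f : V -> R) (x v w : V) (e : R) : 0 < e ->
  (\forall y \near x, differentiable f y) ->
  differentiable (fun y => 'd f y v) x ->
  \forall s \near 0^'+, `|f (x + s *: v + s *: w) - f (x + s *: v) - f (x + s *: w) + f x
     - s ^+ 2 * 'd (fun y => 'd f y v) x w| <= e * s ^+ 2.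
Proof.
move=> e0 df dg; set g := fun y => 'd f y v.
pose M := `|v| + `|w| + 1.
have M0 : 0 < M by rewrite /M ltr_wpDl// addr_ge0.
(* Displacements are at most [s * M]; two linearization errors of size [e' * (s * M)] get multiplied
   by [s]. *)
pose e' := e / (2 * M).
have e'0 : 0 < e' by rewrite divr_gt0// mulr_gt0.
have /nbhs_normP[r /= r0 Hr] : nbhs x (fun y => differentiable f y /\
   `|g y - g x - 'd g x (y - x)| <= e' * `|y - x|).
  by apply: filterI => //; exact: diff_eps.
have add3 (y z : V) : x + y + z - x = y + z by rewrite -[x + y + z]addrA [x + (y + z)]addrC addrK.
near=> s.
have s0 : 0 < s by [].
have sM : s * M < r by rewrite -ltr_pdivlMr//; near: s; apply: nbhs_right_lt; rewrite divr_gt0.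
have inr (a b : R) : 0 <= a <= s -> 0 <= b <= s ->
    `|x + a *: v + b *: w - x| < r /\ `|x + a *: v + b *: w - x| <= s * M.
  move=> /andP[a0 as_] /andP[b0 bs].
  suff H : `|x + a *: v + b *: w - x| <= s * M by split=> //; apply: le_lt_trans sM.
  rewrite add3 (le_trans (ler_normD _ _))// !normrZ !ger0_norm//.
  by rewrite /M !mulrDr mulr1 ler_wpDr ?(ltW s0)// lerD// ler_wpM2r.
have inr' a b : 0 <= a <= s -> 0 <= b <= s -> differentiable f (x + a *: v + b *: w) /\
   `|g (x + a *: v + b *: w) - g x - 'd g x (a *: v + b *: w)| <= e' * (s * M).
  move=> ha hb; have [h1 h2] := inr _ _ ha hb.
  have [|h3 h4] := Hr (x + a *: v + b *: w); first by rewrite /= distrC.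
  split=> //; move: h2 h4; rewrite add3 => h2 h4; apply: le_trans h4 _.
  by rewrite ler_pM2l.
have s0s : 0 <= s <= s by rewrite (ltW s0) lexx.
have s00 : 0 <= (0 : R) <= s by rewrite (ltW s0) lexx.
pose phi t := f (t *: v + (x + s *: w)) - f (t *: v + x).
have dphi t : 0 <= t <= s -> is_derive t (1 : R) phi (g (t *: v + (x + s *: w)) - g (t *: v + x)).
  move=> ht; have [h1 _] := inr' _ _ ht s0s; have [h2 _] := inr' _ _ ht s00.
  apply: is_deriveB; apply: is_derive_line.
    by rewrite addrA (addrC _ x).
  by move: h2; rewrite scale0r addr0 (addrC x).
have [||c cs] := @MVT R phi (fun t => g (t *: v + (x + s *: w)) - g (t *: v + x)) 0 s s0.
- by move=> t; rewrite in_itv/= => /andP[t0 ts]; apply: dphi; rewrite !ltW.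
- apply: derivable_within_continuous => t; rewrite in_itv/= => ht.
  by have [] := dphi t ht.
rewrite subr0 /phi scale0r !add0r => E.
have -> : f (x + s *: v + s *: w) - f (x + s *: v) - f (x + s *: w) + f x =
   (g (c *: v + (x + s *: w)) - g (c *: v + x)) * s.
  by rewrite -E addrA (addrC (s *: v) x); lra.
have cs' : 0 <= c <= s by move: cs; rewrite in_itv/= => /andP[? ?]; rewrite !ltW.
have [_ h1] := inr' _ _ cs' s0s; have [_ h2] := inr' _ _ cs' s00.
have L a b : 'd g x (a *: v + b *: w) = a * 'd g x v + b * 'd g x w.
  by rewrite linearD !linearZ.
move: h1 h2; rewrite !L mul0r scale0r !addr0 -/g.
rewrite addrA (addrC (c *: v)).
set G1 := g _; set G2 := g (x + c *: v); set A := 'd g x v; set B := 'd g x w; set G0 := g x.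
clearbody G1 G2 A B G0; move=> h1 h2.
have -> : (G1 - G2) * s - s ^+ 2 * B = s * ((G1 - G0 - (c * A + s * B)) - (G2 - G0 - c * A)).
  by ring.
rewrite normrM (ger0_norm (ltW s0)).
have -> : e * s ^+ 2 = s * (e' * (s * M) + e' * (s * M)).
  by rewrite /e'; field; rewrite gt_eqF.
by rewrite ler_pM2l// (le_trans (ler_normB _ _))// lerD.
Unshelve. all: by end_near. Qed.

(** The second difference is symmetric in [v] and [w], and divided by [s ^+ 2] it tends to both
    mixed derivatives. *)
Lemma diff_schwarz V (f : V -> R) (x v w : V) :
  (\forall y \near x, differentiable f y) ->
  differentiable (fun y => 'd f y v) x -> differentiable (fun y => 'd f y w) x ->
  'd (fun y => 'd f y v) x w = 'd (fun y => 'd f y w) x v.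
Proof.
move=> df dv dw; apply/eqP; rewrite -subr_eq0 -normr_le0; apply/ler_addgt0Pl => e e0.
rewrite addr0; have e20 : 0 < e / 2 by rewrite divr_gt0.
set A := 'd _ x w; set B := 'd _ x v.
have /filter_ex[s [[s0 h1] h2]] : \forall s \near (0 : R)^'+, (0 < s /\
  `|f (x + s *: v + s *: w) - f (x + s *: v) - f (x + s *: w) + f x - s ^+ 2 * A| <= e / 2 * s ^+ 2) /\
  `|f (x + s *: w + s *: v) - f (x + s *: w) - f (x + s *: v) + f x - s ^+ 2 * B| <= e / 2 * s ^+ 2.
  apply: filterI; [apply: filterI|].
  - exact: nbhs_right_gt.
  - exact: second_difference.
  - exact: second_difference.
have s20 : 0 < s ^+ 2 by rewrite exprn_gt0.
rewrite -(ler_pM2l s20) -(ger0_norm (ltW s20)) -normrM (ger0_norm (ltW s20)).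
move: h1 h2; rewrite [x + s *: w + s *: v]addrAC.
set F1 := f _; set F2 := f (x + s *: v); set F3 := f (x + s *: w) => h1 h2.
have -> : s ^+ 2 * (A - B) = (F1 - F3 - F2 + f x - s ^+ 2 * B) - (F1 - F2 - F3 + f x - s ^+ 2 * A).
  by ring.
by rewrite (le_trans (ler_normB _ _))// (le_trans (lerD h2 h1))//; lra.
Qed.

End SecondDerivatives.

(** * Naturality of the bracket in coordinates *)

Section Bracket.
Context {R : realType}.

Lemma diff_sum (V W : normedModType R) n (f : 'I_n -> V -> W) (x v : V) :
  (forall i, differentiable (f i) x) ->
  'd (fun y => \sum_i f i y) x v = \sum_i 'd (f i) x v.
Proof.
elim: n f => [|n IH] f df.
  have -> : (fun y => \sum_(i < 0) f i y) = cst 0 by apply/funext => y; rewrite big_ord0.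
  by rewrite diff_cst big_ord0.
have -> : (fun y => \sum_(i < n.+1) f i y) =
    (fun y => (\sum_(i < n) f (widen_ord (leqnSn n) i) y)) + f ord_max.
  by apply/funext => y; rewrite big_ord_recr.
have dS : differentiable (fun y => (\sum_(i < n) f (widen_ord (leqnSn n) i) y)) x.
  have := differentiable_sum (fun i => df (widen_ord (leqnSn n) i)).
  by apply: near_eq_differentiable; near=> y; rewrite fct_sumE.
apply: etrans (congr1 (@^~ v) (diffD dS (df ord_max))) _.
rewrite big_ord_recr; congr (_ + _).
by apply: IH => i; apply: df.
Unshelve. all: by end_near. Qed.

Lemma Ck2_differentiable_diff (V W : normedModType R) (U : set V) (f : V -> W) (x v : V) :
  Ck 2 U f -> U x -> differentiable (fun y => 'd f y v) x.
Proof. by move=> [_ /(_ v)[H _]]; apply: H. Qed.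

(** Product rule: the first term differentiates [f] twice, with [X] frozen at [u]. *)
Lemma diff_apply_field n (f : 'rV[R]_n -> R) (U : set 'rV[R]_n) (X : 'rV[R]_n -> 'rV[R]_n)
    (u h : 'rV[R]_n) :
  Ck 2 U f -> U u -> differentiable X u ->
  'd (fun w => 'd f w (X w)) u h = 'd (fun w => 'd f w (X u)) u h + 'd f u ('d X u h).
Proof.
move=> Cf Uu dX.
have df v := Ck2_differentiable_diff v Cf Uu.
have dXj j : differentiable (fun w => X w 0 j) u by move: j; apply/differentiable_rowP.
pose A j := (fun w => X w 0 j) * (fun w => 'd f w (delta_mx 0 j)).
pose B j := X u 0 j *: (fun w => 'd f w (delta_mx 0 j)).
have -> : (fun w => 'd f w (X w)) = (fun w => \sum_j A j w).
  apply/funext => w; apply: etrans (congr1 ('d f w) (row_delta (X w))) _.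
  exact: diff_sumE.
have -> : (fun w => 'd f w (X u)) = (fun w => \sum_j B j w).
  apply/funext => w; apply: etrans (congr1 ('d f w) (row_delta (X u))) _.
  exact: diff_sumE.
have dA j : differentiable (A j) u by apply: differentiableM; [exact: dXj|exact: df].
have dB j : differentiable (B j) u by apply: differentiableZ; exact: df.
apply: etrans (diff_sum h dA) _; apply: etrans _ (congr1 (+%R^~ _) (esym (diff_sum h dB))).
have -> : 'd f u ('d X u h) = \sum_j 'd X u h 0 j * 'd f u (delta_mx 0 j).
  apply: etrans (congr1 ('d f u) (row_delta ('d X u h))) _.
  exact: diff_sumE.
rewrite -big_split /=; apply: eq_bigr => j _.
apply: etrans (congr1 (@^~ h) (diffM (dXj j) (df _))) _.
congr (_ + _); last by rewrite [LHS]mulrC -(diff_row _ _ dX).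
exact: (esym (congr1 (@^~ h) (diffZ (X u 0 j) (df _)))).
Qed.

(** Differentiating the relation between the fields yields, besides the wanted term, a second
    derivative of [phi]. The two such terms are equal by symmetry and cancel in the bracket. *)
Lemma bracket_related n m (phi : 'rV[R]_n -> 'rV[R]_m) (U : set 'rV[R]_n)
    (X Y : 'rV[R]_n -> 'rV[R]_n) (X' Y' : 'rV[R]_m -> 'rV[R]_m) (u : 'rV[R]_n) :
  open U -> Ck 2 U phi -> U u -> differentiable X u -> differentiable Y u ->
  differentiable X' (phi u) -> differentiable Y' (phi u) ->
  (forall w, U w -> X' (phi w) = 'd phi w (X w)) ->
  (forall w, U w -> Y' (phi w) = 'd phi w (Y w)) ->
  'd Y' (phi u) (X' (phi u)) - 'd X' (phi u) (Y' (phi u)) =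
    'd phi u ('d Y u (X u) - 'd X u (Y u)).
Proof.
move=> oU Cphi Uu dX dY dX' dY' relX relY.
have [dphi _] := Cphi.
have Cphii i : Ck 2 U (fun w => phi w 0 i : R) by move: i; apply/Ck_rowP.
have nU : \forall w \near u, U w by apply: open_nbhs_nbhs.
have E (Z : 'rV[R]_n -> 'rV[R]_n) (Z' : 'rV[R]_m -> 'rV[R]_m) h i : differentiable Z u ->
    differentiable Z' (phi u) -> (forall w, U w -> Z' (phi w) = 'd phi w (Z w)) ->
    'd Z' (phi u) ('d phi u h) 0 i = 'd (fun w => 'd (fun w => phi w 0 i) w (Z u)) u h +
       'd phi u ('d Z u h) 0 i.
  move=> dZ dZ' relZ.
  have <- : 'd (Z' \o phi) u h = 'd Z' (phi u) ('d phi u h).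
    exact: (congr1 (@^~ h) (diff_comp (dphi _ Uu) dZ')).
  rewrite -diff_row; last by apply: differentiable_comp => //; exact: dphi.
  rewrite (@near_eq_diffE _ _ _ _ (fun w => 'd (fun w => phi w 0 i) w (Z w))).
    apply: etrans (diff_apply_field h (Cphii i) Uu dZ) _; congr (_ + _).
    exact: diff_row (dphi _ Uu).
  by apply: filterS nU => w Uw /=; rewrite (relZ _ Uw); apply: esym; exact: diff_row (dphi _ Uw).
rewrite (relX _ Uu) (relY _ Uu); apply/rowP => i.
have EX := E _ _ (Y u) i dX dX' relX.
have EY := E _ _ (X u) i dY dY' relY.
have S : 'd (fun w => 'd (fun w => phi w 0 i) w (X u)) u (Y u) =
         'd (fun w => 'd (fun w => phi w 0 i) w (Y u)) u (X u).
  apply: diff_schwarz.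
  - by apply: filterS nU => w Uw; have [+ _] := Cphii i; apply.
  - exact: Ck2_differentiable_diff (Cphii i) Uu.
  - exact: Ck2_differentiable_diff (Cphii i) Uu.
have L : 'd phi u ('d Y u (X u) - 'd X u (Y u)) 0 i =
   'd phi u ('d Y u (X u)) 0 i - 'd phi u ('d X u (Y u)) 0 i.
  by rewrite linearB !mxE.
apply: etrans _ (esym L); rewrite mxE [X in _ + X]mxE.
have F (a b c d s t : R) : a = s + c -> b = t + d -> s = t -> a - b = c - d.
  by move=> -> -> ->; ring.
exact: F EY EX (esym S).
Qed.

End Bracket.

(** * Tangent vectors and Lie brackets in charts *)

Section Charts.
Context {R : realType} {n : nat} {M : manifold R n}.
Implicit Types (c : chart R n M) (x y : M) (U V : set M).

(* [tvec c x v] is the tangent vector [v] at [x] read in the chart [c]. *)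
Definition tvec c x := 'd (c \o cinv (chart_at x)) (chart_at x x).

Lemma chartK c x : atlas c -> cdom c x -> cinv c (c x) = x.
Proof. by move=> /atlas_chart[_ _ H _ _]; exact: H. Qed.

Lemma near_chart c U x : atlas c -> open U -> U x -> cdom c x ->
  \forall u \near c x, [/\ cdom c (cinv c u), U (cinv c u) & c (cinv c u) = u].
Proof.
move=> ac oU Ux cx; have [od oc cK ct ci] := atlas_chart ac.
have cxd : (c @` cdom c) (c x) by exists x.
have H1 : nbhs (c x) (c @` cdom c) by exact: open_nbhs_nbhs.
have H2 : nbhs (c x) (cinv c @^-1` U).
  by apply: (ci _ cxd); rewrite cK//; exact: open_nbhs_nbhs.
by apply: filterS2 H1 H2 => u [y cy <-] /=; rewrite cK.
Qed.

Lemma open_chart_image c U : atlas c -> open U -> open (c @` (cdom c `&` U)).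
Proof.
move=> ac oU; rewrite openE => _ [x [cx Ux] <-].
have := near_chart ac oU Ux cx; apply: filterS => u [H1 H2 H3].
by exists (cinv c u).
Qed.

Lemma chart_preim c U u : atlas c -> (c @` (cdom c `&` U)) u ->
  [/\ cdom c (cinv c u), U (cinv c u) & c (cinv c u) = u].
Proof. by move=> ac [x [cx Ux] <-]; rewrite (chartK ac cx). Qed.

Lemma open_cdom c : atlas c -> open (cdom c).
Proof. by move=> /atlas_chart[]. Qed.

Lemma Ck_transition k c c' : atlas c -> atlas c' ->
  Ck k (c @` (cdom c `&` cdom c')) (c' \o cinv c).
Proof. by move=> ac ac'; apply: atlas_compat. Qed.

Lemma differentiable_transition c c' x : atlas c -> atlas c' -> cdom c x -> cdom c' x ->
  differentiable (c' \o cinv c) (c x).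
Proof.
move=> ac ac' cx cx'; have [+ _] := Ck_transition 1 ac ac'; apply.
by exists x.
Qed.

Lemma tvec_transition c c' x v : atlas c -> atlas c' -> cdom c x -> cdom c' x ->
  tvec c' x v = 'd (c' \o cinv c) (c x) (tvec c x v).
Proof.
move=> ac ac' cx cx'; have aa := chart_at_atlas x; have ax := chart_at_dom x.
have E : (c \o cinv (chart_at x)) (chart_at x x) = c x by rewrite /= chartK.
have d1 := differentiable_transition aa ac ax cx.
have d2 := differentiable_transition ac ac' cx cx'; rewrite -E in d2.
have D := congr1 (@^~ v) (diff_comp d1 d2).
rewrite E in D; apply: etrans _ D.
apply: near_eq_diffv.
apply: filterS (near_chart aa (open_cdom ac) cx ax) => u [H1 H2 H3] /=.
by rewrite chartK.
Qed.

Lemma diff_id_near (V : normedModType R) (f : V -> V) (x v : V) :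
  (\forall y \near x, f y = y) -> 'd f x v = v.
Proof.
move=> H; apply: etrans (near_eq_diffv (g := @idfun V) v H) _.
exact: (congr1 (@^~ v) (@diff_val _ _ _ _ _ _ _ (is_diff_id x))).
Qed.

Lemma tvec_chart_at x v : tvec (chart_at x) x v = v.
Proof.
apply: diff_id_near.
have := near_chart (chart_at_atlas x) (open_cdom (chart_at_atlas x)) (chart_at_dom x) (chart_at_dom x).
by apply: filterS => u [].
Qed.

Lemma field_in_chartE c X x : atlas c -> cdom c x -> field_in_chart c X (c x) = tvec c x (X x).
Proof. by move=> ac cx; rewrite /field_in_chart chartK. Qed.

Lemma field_in_chart_at X x : field_in_chart (chart_at x) X (chart_at x x) = X x.
Proof. by rewrite field_in_chartE ?tvec_chart_at//; [exact: chart_at_atlas|exact: chart_at_dom]. Qed.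

Lemma tvec_inv c x v : atlas c -> cdom c x ->
  'd (chart_at x \o cinv c) (c x) (tvec c x v) = v.
Proof.
by move=> ac cx; rewrite -tvec_transition ?tvec_chart_at//; [exact: chart_at_atlas|exact: chart_at_dom].
Qed.

Lemma smooth_field_sub U V X : V `<=` U -> smooth_field_on U X -> smooth_field_on V (X : M -> 'rV[R]_n).
Proof.
move=> VU sX c ac k; apply: Ck_sub (sX c ac k) => _ [x [cx Vx] <-].
by exists x; split=> //; exact: VU.
Qed.

Lemma smooth_field_differentiable U X c x : smooth_field_on U X -> atlas c ->
  cdom c x -> U x -> differentiable (field_in_chart c X) (c x).
Proof. by move=> sX ac cx Ux; have [+ _] := sX c ac 1; apply; exists x. Qed.

End Charts.

(** * Vector fields related by a smooth map *)

Section SmoothMaps.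
Context {R : realType} {n : nat} {M : manifold R n}.
Variables (f : M -> M) (U : set M).
Hypotheses (oU : open U) (sf : smooth_on U f).
Implicit Types (c : chart R n M) (x y : M).

Lemma open_smooth_preimage (V : set M) : open V -> open (U `&` f @^-1` V).
Proof.
move=> oV; rewrite openE => x [Ux Vfx].
apply: filterI; first exact: open_nbhs_nbhs.
by apply: (sf.1 x Ux); exact: open_nbhs_nbhs.
Qed.

Lemma tvec_tangent_map c c' x v : atlas c -> atlas c' -> U x -> cdom c x -> cdom c' (f x) ->
  tvec c' (f x) (tangent_map f x v) = 'd (c' \o f \o cinv c) (c x) (tvec c x v).
Proof.
move=> ac ac' Ux cx cfx.
have aa := chart_at_atlas x; have ax := chart_at_dom x.
have ab := chart_at_atlas (f x); have bx := chart_at_dom (f x).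
have dsf c1 c2 : atlas c1 -> atlas c2 -> cdom c1 x -> cdom c2 (f x) ->
    differentiable (c2 \o f \o cinv c1) (c1 x).
  move=> a1 a2 H1 H2; have [+ _] := sf.2 _ _ a1 a2 1; apply.
  by exists x.
rewrite /tangent_map lfunE /=.
have d1 := dsf _ _ aa ab ax bx.
have E1 : (chart_at (f x) \o f \o cinv (chart_at x)) (chart_at x x) = chart_at (f x) (f x).
  by rewrite /= chartK.
have d2 := differentiable_transition ab ac' bx cfx; rewrite -E1 in d2.
have D := congr1 (@^~ v) (diff_comp d1 d2).
have E2 : (c \o cinv (chart_at x)) (chart_at x x) = c x by rewrite /= chartK.
have d3 := differentiable_transition aa ac ax cx.
have d4 := dsf _ _ ac ac' cx cfx; rewrite -E2 in d4.
have D2 := congr1 (@^~ v) (diff_comp d3 d4).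
rewrite E1 in D; rewrite E2 in D2; apply: etrans (esym D) _; apply: etrans _ D2.
apply: near_eq_diffv.
have oV := openI (open_smooth_preimage (open_cdom ab)) (open_cdom ac).
have H := near_chart aa oV (conj (conj Ux bx) cx) ax.
apply: filterS H => u [H1 [[H2 H3] H4] H5] /=.
by rewrite chartK// chartK.
Qed.

Lemma lie_bracket_related (V : set M) (X Y X' Y' : M -> 'rV[R]_n) x : open V -> U x -> V (f x) ->
  smooth_field_on U X -> smooth_field_on U Y -> smooth_field_on V X' -> smooth_field_on V Y' ->
  (forall y, U y -> X' (f y) = tangent_map f y (X y)) ->
  (forall y, U y -> Y' (f y) = tangent_map f y (Y y)) ->
  lie_bracket X' Y' (f x) = tangent_map f x (lie_bracket X Y x).
Proof.
move=> oV Ux Vfx sX sY sX' sY' rX rY.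
have aa := chart_at_atlas x; have ax := chart_at_dom x.
have ab := chart_at_atlas (f x); have bx := chart_at_dom (f x).
set c := chart_at x in aa ax *; set c' := chart_at (f x) in ab bx *.
have oW := open_smooth_preimage (open_cdom ab).
rewrite /tangent_map lfunE /= /lie_bracket -/c -/c'.
have E : (c' \o f \o cinv c) (c x) = c' (f x) by rewrite /= chartK.
pose W := c @` (cdom c `&` U `&` f @^-1` cdom c').
have WE : W = c @` (cdom c `&` (U `&` f @^-1` cdom c')) by rewrite /W setIA.
have oWW : open W by rewrite WE; exact: open_chart_image.
have Wx : W (c x) by exists x.
have Cphi : Ck 2 W (c' \o f \o cinv c) by exact: sf.2.
have rel (Z Z' : M -> 'rV[R]_n) : (forall y, U y -> Z' (f y) = tangent_map f y (Z y)) ->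
    forall w, W w -> field_in_chart c' Z' ((c' \o f \o cinv c) w) =
        'd (c' \o f \o cinv c) w (field_in_chart c Z w).
  move=> rZ _ [y [[cy Uy] cfy] <-].
  rewrite (_ : (c' \o f \o cinv c) (c y) = c' (f y)); last by rewrite /= chartK.
  rewrite (field_in_chartE _ ab cfy) (field_in_chartE _ aa cy) rZ//.
  exact: tvec_tangent_map.
have H := @bracket_related _ _ _ (c' \o f \o cinv c) W (field_in_chart c X) (field_in_chart c Y)
  (field_in_chart c' X') (field_in_chart c' Y') (c x) oWW Cphi Wx
  (smooth_field_differentiable sX aa ax Ux) (smooth_field_differentiable sY aa ax Ux).
rewrite E in H.
have {}H := H (smooth_field_differentiable sX' ab bx Vfx)
   (smooth_field_differentiable sY' ab bx Vfx) (rel _ _ rX) (rel _ _ rY).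
rewrite (field_in_chart_at X x) (field_in_chart_at Y x) in H.
rewrite (field_in_chart_at X' (f x)) (field_in_chart_at Y' (f x)) in H.
exact: H.
Qed.

(** On the image the field is [y |-> Df (X (g y))], so its smoothness rests on that of the local
    inverse [g]. *)
Lemma smooth_pushforward (g : M -> M) (X X' : M -> 'rV[R]_n) :
  open (f @` U) -> smooth_on (f @` U) g -> (forall y, U y -> g (f y) = y) ->
  smooth_field_on U X -> (forall y, U y -> X' (f y) = tangent_map f y (X y)) ->
  smooth_field_on (f @` U) X'.
Proof.
move=> oV sg gf sX rX c' ac' k; apply/Ck_pt => _ [y [cfx [x Ux xy]] <-]; subst y.
have ac := chart_at_atlas x; have cx := chart_at_dom x.
set c := chart_at x in ac cx.
pose V := f @` U.
pose O := cdom c' `&` V `&` g @^-1` cdom c.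
have oO : open (c' @` O).
  rewrite /O -setIA; apply: open_chart_image => //.
  rewrite openE => y [Vy cy]; apply: filterI; first exact: open_nbhs_nbhs.
  by apply: (sg.1 y Vy); apply: open_nbhs_nbhs; split=> //; exact: open_cdom.
pose W := c @` (cdom c `&` U `&` f @^-1` cdom c').
have phiO : forall u, (c' @` O) u -> W ((c \o g \o cinv c') u).
  move=> _ [z [[cy [y Uy yz]] cgy] <-]; subst z.
  by rewrite /= chartK// gf//; exists y => //; split=> //; split=> //; move: cgy; rewrite /= gf.
have Cg j : Ck j (c' @` O) (c \o g \o cinv c') by exact: sg.2.
have CX j : Ck j W (field_in_chart c X).
  by apply: Ck_sub (sX c ac j) => _ [y [[? ?] _] <-]; exists y.
have Cf j : Ck j W (c' \o f \o cinv c) by exact: sf.2.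
have H := Ck_apply_diff oO phiO (Cg k) (Cf k.+1) (Ck_compE oO phiO (Cg k) (CX k)).
have OO : [set c' (f x)] `<=` c' @` O.
  move=> _ ->; exists (f x) => //; split; first by split=> //; exists x.
  by rewrite /= gf.
apply: (Ck_sub OO); apply: Ck_open_eq H => // _ [z [[cy [y Uy yz]] cgy] <-]; subst z.
move: cgy; rewrite /= gf// => cy'.
rewrite chartK// gf// (field_in_chartE _ ac' cy) (field_in_chartE _ ac cy') rX//.
by apply: esym; exact: tvec_tangent_map.
Qed.

End SmoothMaps.

(** * Smoothness and linearity of the bracket *)

Section LieSmooth.
Context {R : realType} {n : nat} {M : manifold R n}.
Implicit Types (c : chart R n M) (X Y : M -> 'rV[R]_n) (U : set M).

(** [lie_bracket] is computed at each point in the chart preferred there, and that chart may jump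
    from point to point. Every fixed chart gives the same vector, which makes smoothness of the
    bracket accessible. *)
Lemma lie_bracket_in_chart c U X Y x : atlas c -> cdom c x -> open U -> U x ->
  smooth_field_on U X -> smooth_field_on U Y ->
  tvec c x (lie_bracket X Y x) = 'd (field_in_chart c Y) (c x) (field_in_chart c X (c x)) -
     'd (field_in_chart c X) (c x) (field_in_chart c Y (c x)).
Proof.
move=> ac cx oU Ux sX sY.
have aa := chart_at_atlas x; have ax := chart_at_dom x.
set a := chart_at x in aa ax *.
have E : (c \o cinv a) (a x) = c x by rewrite /= chartK.
pose W := a @` (cdom a `&` (cdom c `&` U)).
have oW : open W by apply: open_chart_image => //; apply: openI => //; exact: open_cdom.
have CW : Ck 2 W (c \o cinv a).
  by apply: Ck_sub (Ck_transition 2 aa ac) => _ [y [? [? _]] <-]; exists y.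
have Wx : W (a x) by exists x.
have H := @bracket_related _ _ _ (c \o cinv a) W (field_in_chart a X) (field_in_chart a Y)
  (field_in_chart c X) (field_in_chart c Y) (a x) oW CW Wx
  (smooth_field_differentiable sX aa ax Ux) (smooth_field_differentiable sY aa ax Ux).
rewrite E in H.
have rel Z w : W w -> field_in_chart c Z ((c \o cinv a) w) =
        'd (c \o cinv a) w (field_in_chart a Z w).
  move=> [y [ay [cy Uy]] <-].
  rewrite (_ : (c \o cinv a) (a y) = c y); last by rewrite /= chartK.
  by rewrite (field_in_chartE _ ac cy) (field_in_chartE _ aa ay); exact: tvec_transition.
have {}H := H (smooth_field_differentiable sX ac cx Ux)
   (smooth_field_differentiable sY ac cx Ux) (rel X) (rel Y).
rewrite (field_in_chart_at X x) (field_in_chart_at Y x) in H.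
by apply: esym; apply: etrans H _.
Qed.

Lemma Ck_id (V : normedModType R) k (U : set V) : Ck k U (fun x => x : V).
Proof.
case: k => [|k] /=; first by move=> x _; exact: cvg_id.
split=> [x _|v]; first exact: (@ex_diff _ _ _ _ _ _ _ (is_diff_id x)).
have -> : (fun x => 'd (fun x => x) x v) = (fun=> v) :> (V -> V).
  by apply/funext => x; rewrite diff_id_near //; near=> y.
exact: Ck_cst.
Unshelve. all: by end_near. Qed.

Lemma smooth_lie_bracket U X Y : open U ->
  smooth_field_on U X -> smooth_field_on U Y -> smooth_field_on U (lie_bracket X Y).
Proof.
move=> oU sX sY c ac k.
have oW : open (c @` (cdom c `&` U)) by exact: open_chart_image.
have WW u : (c @` (cdom c `&` U)) u -> (c @` (cdom c `&` U)) u by [].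
have H1 := Ck_apply_diff oW WW (Ck_id k _) (sY c ac k.+1) (sX c ac k).
have H2 := Ck_apply_diff oW WW (Ck_id k _) (sX c ac k.+1) (sY c ac k).
have H := CkD oW H1 (CkZ (-1) oW H2).
apply: Ck_open_eq H => // _ [x [cx Ux] <-].
rewrite scaleN1r; apply: esym.
have E2 := lie_bracket_in_chart ac cx oU Ux sX sY.
by rewrite (field_in_chartE _ ac cx); apply: etrans E2 _.
Qed.

Lemma smooth_fieldZD U a X Y : open U -> smooth_field_on U X -> smooth_field_on U Y ->
  smooth_field_on U (fun x => a *: X x + Y x).
Proof.
move=> oU sX sY c ac k.
have oW : open (c @` (cdom c `&` U)) by exact: open_chart_image.
apply: Ck_open_eq (CkD oW (CkZ a oW (sX c ac k)) (sY c ac k)) => // _ [x [cx Ux] <-].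
rewrite !(field_in_chartE _ ac cx); apply: esym; exact: linearP.
Qed.

Lemma smooth_field0 U : smooth_field_on U (fun _ : M => 0 : 'rV[R]_n).
Proof.
move=> c ac k; have -> : field_in_chart c (fun _ : M => 0) = (fun=> 0).
  by apply/funext => u; rewrite /field_in_chart linear0.
exact: Ck_cst.
Qed.

Lemma lie_bracketZD U a X X' Y x : open U -> U x -> smooth_field_on U X ->
  smooth_field_on U X' -> lie_bracket (fun x => a *: X x + X' x) Y x =
  a *: lie_bracket X Y x + lie_bracket X' Y x.
Proof.
move=> oU Ux sX sX'; rewrite /lie_bracket.
have aa := chart_at_atlas x; have ax := chart_at_dom x.
set c := chart_at x in aa ax *.
have -> : field_in_chart c (fun x => a *: X x + X' x) =
    a *: field_in_chart c X + field_in_chart c X'.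
  by apply/funext => u; exact: linearP.
have dX := smooth_field_differentiable sX aa ax Ux.
have dX' := smooth_field_differentiable sX' aa ax Ux.
have E1 : 'd (field_in_chart c Y) (c x) (a *: X x + X' x) =
    a *: 'd (field_in_chart c Y) (c x) (X x) + 'd (field_in_chart c Y) (c x) (X' x).
  exact: linearP.
have E2 : 'd (a *: field_in_chart c X + field_in_chart c X') (c x) (Y x) =
    a *: 'd (field_in_chart c X) (c x) (Y x) + 'd (field_in_chart c X') (c x) (Y x).
  apply: etrans (congr1 (@^~ (Y x)) (diffD (differentiableZ a dX) dX')) _.
  exact: (congr1 (+%R^~ _) (congr1 (@^~ (Y x)) (diffZ a dX))).
have F (p q p' q' s t : 'rV[R]_n) : s = a *: p + p' -> t = a *: q + q' ->
    s - t = a *: (p - q) + (p' - q').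
  by move=> -> ->; rewrite scalerBr opprD addrACA.
exact: F E1 E2.
Qed.

Lemma lie_bracketC X Y x : lie_bracket X Y x = - lie_bracket Y X x.
Proof. by rewrite /lie_bracket opprB. Qed.

End LieSmooth.

(** * The flag of a distribution *)

Section VSpan.
Context {R : realType} {V : vectType R}.

(** A finite family from [A] whose span has maximal dimension absorbs every vector of [A]. *)
Lemma vspan_seq (A : set V) : exists s : seq V, (forall v, v \in s -> A v) /\ vspan A = span s.
Proof.
have [AW Wmin] := vspanP A; set W := vspan A in AW Wmin *.
pose P d := `[< exists s : seq V, (forall v, v \in s -> A v) /\ \dim (span s) = d >].
have P0 : exists d, P d by exists 0%N; apply/asboolP; exists [::]; rewrite span_nil dimv0.
have Pb d : P d -> (d <= \dim {:V})%N.
  by move=> /asboolP[s [_ <-]]; rewrite dimvS// subvf.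
case: (ex_maxnP P0 Pb) => d /asboolP[s [sA sd]] maxd; exists s; split=> //.
apply/eqP; rewrite eqEsubv; apply/andP; split; last by apply/span_subvP => v /sA/AW.
apply: Wmin => v Av.
have : (\dim (span (v :: s)) <= \dim (span s))%N.
  rewrite sd; apply: maxd; apply/asboolP; exists (v :: s); split=> // w.
  by rewrite inE => /orP[/eqP->//|/sA].
have ss : (span s <= span (v :: s))%VS by rewrite span_cons addvSr.
rewrite (geq_leqif (dimv_leqif_sup ss)) => /subvP; apply.
by rewrite memv_span// mem_head.
Qed.

Lemma vspan_ind (A P : set V) : P 0 -> (forall (a : R) u v, A u -> P v -> P (a *: u + v)) ->
  forall v, v \in vspan A -> P v.
Proof.
move=> P0 PD v; have [s [sA ->]] := vspan_seq A.
elim: s sA v => [|w s IH] sA v; first by rewrite span_nil memv0 => /eqP ->.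
rewrite span_cons => /memv_addP[w' /vlineP[a ->] [u us ->]].
apply: PD; first by apply: sA; rewrite mem_head.
by apply: IH us => z zs; apply: sA; rewrite inE zs orbT.
Qed.

End VSpan.

Section Flags.
Context {R : realType} {n : nat} {M : manifold R n}.
Variable E : M -> {vspace 'rV[R]_n}.
Implicit Types (X Y : M -> 'rV[R]_n) (U V : set M).

(* Every vector of E^i_x is the value at [x] of a single field in [bracket_span U i], for
   some neighbourhood [U]; this is how identities between brackets of fields are turned into
   identities on the flag. *)
Inductive bracket_span U (i : nat) : (M -> 'rV[R]_n) -> Prop :=
| bracket_span0 : bracket_span U i (fun=> 0)
| bracket_spanZD a j X Z : (j <= i)%N -> iter_bracket E U j X -> bracket_span U i Z ->
    bracket_span U i (fun x => a *: X x + Z x).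

Lemma tangent_to_sub (F : M -> {vspace 'rV[R]_n}) U V X : V `<=` U -> tangent_to F U X -> tangent_to F V X.
Proof.
by move=> VU [sX tX]; split; [exact: smooth_field_sub sX|move=> y /VU/tX].
Qed.

Lemma iter_bracket_sub U V j X : V `<=` U -> iter_bracket E U j X -> iter_bracket E V j X.
Proof.
move=> VU; elim=> [Y tY|i k Y Z _ IY _ IZ]; first by apply: iter_bracket0; exact: tangent_to_sub tY.
exact: iter_bracketS.
Qed.

Lemma iter_bracket_smooth U j X : open U -> iter_bracket E U j X -> smooth_field_on U X.
Proof.
by move=> oU; elim=> [Y []//|i k Y Z _ sY _ sZ]; exact: smooth_lie_bracket.
Qed.

Lemma bracket_span_sub U V j X : V `<=` U -> bracket_span U j X -> bracket_span V j X.
Proof.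
move=> VU; elim=> [|a i Y Z ij bY _ sZ]; first exact: bracket_span0.
by apply: bracket_spanZD ij _ sZ; exact: iter_bracket_sub bY.
Qed.

Lemma bracket_span_smooth U i X : open U -> bracket_span U i X -> smooth_field_on U X.
Proof.
move=> oU; elim=> [|a j Y Z _ /(iter_bracket_smooth oU) sY _ sZ]; first exact: smooth_field0.
exact: smooth_fieldZD.
Qed.

Lemma mem_flag U i j X x : open U -> U x -> (j <= i)%N -> iter_bracket E U j X ->
  X x \in flag E i x.
Proof. by move=> oU Ux ji bX; apply: (vspanP _).1; exists U, j, X. Qed.

Lemma bracket_span_tangent U i X : open U -> bracket_span U i X -> tangent_to (flag E i) U X.
Proof.
move=> oU bX; split; first exact: bracket_span_smooth bX.
elim: bX => [|a j Y Z ji bY _ tZ] y Uy; first by rewrite mem0v.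
by rewrite memvD ?tZ// memvZ// (mem_flag _ _ ji bY).
Qed.

Lemma bracket_spanD U i a X Z : bracket_span U i X -> bracket_span U i Z ->
  bracket_span U i (fun x => a *: X x + Z x).
Proof.
elim=> [|b j Y Y' ji bY _ IH] bZ.
  by under eq_fun do rewrite scaler0 add0r; exact: bZ.
under eq_fun do rewrite scalerDr scalerA -addrA.
by apply: bracket_spanZD ji bY _; exact: IH.
Qed.

Lemma flag_bracket_span i x v : v \in flag E i x ->
  exists U X, [/\ open U, U x, bracket_span U i X & X x = v].
Proof.
move: v; apply: vspan_ind => [|a u v].
  by exists setT, (fun=> 0); split=> //; [exact: openT|exact: bracket_span0].
move=> [U [j [X [[oU Ux] ji bX <-]]]] [V [Y [oV Vx bY <-]]].
exists (U `&` V), (fun x => a *: X x + Y x); split=> //; first exact: openI.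
apply: bracket_spanZD ji _ _; first by apply: iter_bracket_sub bX => y [].
by apply: bracket_span_sub bY => y [].
Qed.

Lemma flag_mono i x : (flag E i x <= flag E i.+1 x)%VS.
Proof.
apply: (vspanP _).2 => v [U [j [X [UU ji bX Xv]]]].
by apply: (vspanP _).1; exists U, j, X; split=> //; exact: leq_trans ji _.
Qed.

Lemma flag0_sub x : (flag E 0 x <= E x)%VS.
Proof.
apply: (vspanP _).2 => v [U [j [X [[oU Ux] j0 bX <-]]]].
case: bX j0 => // Y [_ tY] _; exact: tY.
Qed.

Lemma lie_bracket0l Y x : lie_bracket (fun=> 0) Y x = 0.
Proof.
have := @lie_bracketZD _ _ M setT 1 (fun=> 0) (fun=> 0) Y x openT I (@smooth_field0 _ _ _ _) (@smooth_field0 _ _ _ _).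
have -> : (fun x : M => 1 *: 0 + 0) = (fun=> 0 : 'rV[R]_n).
  by apply/funext => y; rewrite scaler0 addr0.
by rewrite scale1r -{1}[lie_bracket _ _ _]addr0 => /addrI.
Qed.

Lemma lie_bracket_flag U i X Y x : open U -> U x -> bracket_span U i X ->
  tangent_to E U Y -> lie_bracket X Y x \in flag E i.+1 x.
Proof.
move=> oU Ux bX tY; elim: bX => [|a j Z Z' ji bZ bZ' IH].
  by rewrite lie_bracket0l mem0v.
rewrite (lie_bracketZD _ _ oU Ux); last 2 first.
- exact: iter_bracket_smooth bZ.
- exact: bracket_span_smooth bZ'.
apply: memvD => //; apply: memvZ.
apply: (@mem_flag U _ (j + 0).+1 _ _ oU Ux); first by rewrite addn0 ltnS.
by apply: iter_bracketS bZ _; exact: iter_bracket0.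
Qed.

End Flags.

(** * Pushing the flag forward by a local diffeomorphism *)

Section PushForward.
Context {R : realType} {n : nat} {M : manifold R n}.
Variables (E : M -> {vspace 'rV[R]_n}) (f g : M -> M) (U : set M).
Hypotheses (oU : open U) (sf : smooth_on U f) (ofU : open (f @` U))
  (sg : smooth_on (f @` U) g) (gf : forall y, U y -> g (f y) = y)
  (fE : forall y, (tangent_map f y @: E y)%VS = E (f y)).
Implicit Types (X Y : M -> 'rV[R]_n) (V : set M).

Lemma smooth_on_sub (h : M -> M) (V W : set M) : W `<=` V -> smooth_on V h -> smooth_on W h.
Proof.
move=> WV [ch sh]; split=> [x /WV/ch//|c c' ac ac' k].
by apply: Ck_sub (sh c c' ac ac' k) => _ [x [[? ?] ?] <-]; exists x => //; do ?split=> //; exact: WV.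
Qed.

Lemma open_image_sub V : V `<=` U -> open V -> open (f @` V).
Proof.
move=> VU oV; have -> : f @` V = (f @` U) `&` g @^-1` V.
  apply/seteqP; split=> [_ [y Vy <-]|_ [[y Uy <-] Vgy]].
    by split; [exists y => //; exact: VU|rewrite /= gf//; exact: VU].
  by exists y => //; move: Vgy; rewrite /= gf.
exact: open_smooth_preimage.
Qed.

Definition related V X X' := forall y, V y -> X' (f y) = tangent_map f y (X y).

(** A horizontal field is transported as [y |-> Df (Y (g y))], horizontal again because [f]
    preserves [E]; brackets follow by naturality. *)
Lemma iter_bracket_push V j X : V `<=` U -> open V -> iter_bracket E V j X ->
  exists2 X', iter_bracket E (f @` V) j X' & related V X X'.
Proof.
move=> VU oV; have oV' := open_image_sub VU oV.
have sfV := smooth_on_sub VU sf.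
have sgV : smooth_on (f @` V) g by apply: smooth_on_sub sg => _ [y Vy <-]; exists y => //; exact: VU.
elim=> [Y [sY tY]|i k Y Z bY [Y' bY' rY] bZ [Z' bZ' rZ]].
  pose Y' y := tangent_map f (g y) (Y (g y)).
  have rY : related V Y Y' by move=> y Vy; rewrite /Y' gf//; exact: VU.
  exists Y' => //; apply: iter_bracket0; split.
    apply: (smooth_pushforward (g := g) oV sfV oV' sgV) rY => // y /VU; exact: gf.
  by move=> _ [y Vy <-]; rewrite rY// -fE memv_img// tY.
exists (lie_bracket Y' Z'); first exact: iter_bracketS.
move=> x Vx; apply: (lie_bracket_related oV sfV oV' Vx) rY rZ.
- by exists x.
- exact: iter_bracket_smooth bY.
- exact: iter_bracket_smooth bZ.
- exact: iter_bracket_smooth bY'.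
- exact: iter_bracket_smooth bZ'.
Qed.

Lemma bracket_span_push V i X : V `<=` U -> open V -> bracket_span E V i X ->
  exists2 X', bracket_span E (f @` V) i X' & related V X X'.
Proof.
move=> VU oV; elim=> [|a j Y Z ji bY bZ [Z' bZ' rZ]].
  by exists (fun=> 0); [exact: bracket_span0|move=> y Vy; rewrite linear0].
have [Y' bY' rY] := iter_bracket_push VU oV bY.
exists (fun x => a *: Y' x + Z' x); first exact: bracket_spanZD bY' bZ'.
by move=> y Vy; rewrite rY// rZ// linearP.
Qed.

Lemma tangent_map_flag i x : U x -> (tangent_map f x @: flag E i x <= flag E i (f x))%VS.
Proof.
move=> Ux; apply/subvP => _ /memv_imgP[v vF ->].
have [V [X [oV Vx bX <-]]] := flag_bracket_span vF.
pose W := V `&` U.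
have oW : open W by exact: openI.
have WU : W `<=` U by move=> y [].
have bW : bracket_span E W i X by apply: bracket_span_sub bX => y [].
have [X' bX' rX] := bracket_span_push WU oW bW.
rewrite -rX//; have oW' : open (f @` W) by apply: open_image_sub => // y [].
by have [_] := bracket_span_tangent oW' bX'; apply; exists x.
Qed.

(** Chain rule for [g \o f], which is the identity near [x]. *)
Lemma tangent_map_inj x : U x -> lker (tangent_map f x) = 0%VS.
Proof.
move=> Ux; apply/eqP; rewrite -subv0; apply/subvP => v; rewrite memv_ker memv0 => /eqP Lv.
have aa := chart_at_atlas x; have ax := chart_at_dom x.
have ab := chart_at_atlas (f x); have bx := chart_at_dom (f x).
have fUx : (f @` U) (f x) by exists x.
have agx : cdom (chart_at x) (g (f x)) by rewrite gf.
have E1 := tvec_tangent_map oU sf v aa ab Ux ax bx.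
have Z : tvec (chart_at (f x)) (f x) (tangent_map f x v) = 0 by rewrite Lv; exact: linear0.
have {}E1 := etrans (esym E1) Z.
pose h := chart_at (f x) \o f \o cinv (chart_at x).
have {}E1 : 'd h (chart_at x x) v = 0.
  exact: etrans (congr1 ('d h (chart_at x x)) (esym (tvec_chart_at x v))) E1.
pose k := chart_at x \o g \o cinv (chart_at (f x)).
have d1 : differentiable h (chart_at x x).
  by have [+ _] := sf.2 _ _ aa ab 1; apply; exists x.
have hx : h (chart_at x x) = chart_at (f x) (f x) by rewrite /h /= chartK.
have d2 : differentiable k (h (chart_at x x)).
  by rewrite hx; have [+ _] := sg.2 _ _ ab aa 1; apply; exists (f x).
have D := congr1 (@^~ v) (diff_comp d1 d2).
have D2 : 'd (k \o h) (chart_at x x) v = 0.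
  by apply: etrans D _; exact: etrans (congr1 ('d k _) E1) (linear0 _).
apply/eqP; apply: etrans _ D2; apply: esym; apply: diff_id_near.
have oV := open_smooth_preimage oU sf (open_cdom ab).
apply: filterS (near_chart aa oV (conj Ux bx) ax) => u [H1 [H2 H3] H4].
by rewrite /k /h /= chartK// gf.
Qed.

End PushForward.

(** * Spectrum of a map compatible with a graded bracket *)

Section CharPoly.
Context {K : fieldType}.

Lemma char_poly_conj n (P Q A : 'M[K]_n) : P *m Q = 1%:M ->
  char_poly (P *m A *m Q) = char_poly A.
Proof.
move=> PQ; rewrite /char_poly.
have -> : char_poly_mx (P *m A *m Q) =
    map_mx polyC P *m char_poly_mx A *m map_mx polyC Q.
  rewrite /char_poly_mx mulmxBr mulmxBl !map_mxM; congr (_ - _).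
  by rewrite scalar_mxC -mulmxA -map_mxM PQ map_mx1 mulmx1.
rewrite !det_mulmx mulrAC -det_mulmx -map_mxM PQ map_mx1 det1.
by rewrite mul1r.
Qed.

Context {V : vectType K}.
Implicit Types (L : 'End(V)) (W : {vspace V}).

Lemma char_poly_basis L W d d2 (e : d.-tuple V) (e' : d2.-tuple V) (A : 'M[K]_d) (A' : 'M[K]_d2) :
  basis_of W e -> basis_of W e' ->
  (forall i : 'I_d, L e`_i = \sum_j A i j *: e`_j) ->
  (forall i : 'I_d2, L e'`_i = \sum_j A' i j *: e'`_j) -> char_poly A = char_poly A'.
Proof.
move=> be be'.
have Ed : d = d2 by rewrite -(size_basis be) (size_basis be').
subst d2; move=> LA LA'.
have fe := basis_free be; have fe' := basis_free be'.
pose P := \matrix_(i < d, j < d) coord e' j e`_i; pose Q := \matrix_(i < d, j < d) coord e j e'`_i.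
have me (i : 'I_d) : e`_i \in W by apply: (basis_mem be); rewrite mem_nth// size_tuple.
have me' (i : 'I_d) : e'`_i \in W by apply: (basis_mem be'); rewrite mem_nth// size_tuple.
have eP (i : 'I_d) : e`_i = \sum_j P i j *: e'`_j.
  rewrite {1}(coord_basis be' (me i)).
  by apply: eq_bigr => j _; rewrite mxE.
have eQ (i : 'I_d) : e'`_i = \sum_j Q i j *: e`_j.
  rewrite {1}(coord_basis be (me' i)).
  by apply: eq_bigr => j _; rewrite mxE.
have subst_sum (c : 'I_d -> K) (B : 'M[K]_d) (v w : 'I_d -> V) :
    (forall i, v i = \sum_j B i j *: w j) ->
    \sum_i c i *: v i = \sum_j (\sum_i c i * B i j) *: w j.
  move=> vw; under eq_bigr do rewrite vw scaler_sumr.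
  rewrite exchange_big; apply: eq_bigr => j _; rewrite scaler_suml.
  by apply: eq_bigr => i _; rewrite scalerA.
have PQ : P *m Q = 1%:M.
  apply/matrixP => i k.
  have E : e`_i = \sum_k (\sum_j P i j * Q j k) *: e`_k.
    by rewrite [LHS]eP; exact: (subst_sum (P i) Q (fun j => e'`_j) (fun j => e`_j)).
  rewrite [LHS]mxE -(coord_sum_free (fun k => \sum_j P i j * Q j k) k fe) -E coord_free//.
  by rewrite mxE eq_sym.
have -> : A = P *m A' *m Q; last exact: char_poly_conj.
have : A *m P = P *m A'.
  apply/matrixP => i k.
  have E1 : L e`_i = \sum_k (\sum_j A i j * P j k) *: e'`_k.
    by rewrite LA; exact: (subst_sum (A i) P (fun j => e`_j) (fun j => e'`_j)).
  have E2 : L e`_i = \sum_k (\sum_j P i j * A' j k) *: e'`_k.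
    rewrite eP linear_sum; under eq_bigr do rewrite linearZ.
    exact: (subst_sum (P i) A' (fun j => L e'`_j) (fun j => e'`_j)).
  rewrite !mxE -(coord_sum_free (fun k => \sum_j A i j * P j k) k fe') -E1 E2.
  by rewrite coord_sum_free.
by move=> <-; rewrite -mulmxA PQ mulmx1.
Qed.

(** The classes of the [b i] form a basis of W'/W and [Q] is the matrix of the induced map. In a
    basis of [W] completed by one of a complement, [L] is block triangular. *)
Lemma char_poly_quotient L W W' (restr : forall U : {vspace V}, 'M[K]_(\dim U)) :
  (forall (U : {vspace V}) (i : 'I_(\dim U)), (L @: U <= U)%VS -> L (vbasis U)`_i = \sum_j restr U i j *: (vbasis U)`_j) ->
  (L @: W <= W)%VS -> (L @: W' <= W')%VS -> (W <= W')%VS ->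
  exists d (b : 'I_d -> V) (Q : 'M[K]_d),
    [/\ (d + \dim W = \dim W')%N, forall i, b i \in W',
     forall c : 'I_d -> K, \sum_i c i *: b i \in W -> forall i, c i = 0,
     forall i, L (b i) - \sum_j Q i j *: b j \in W &
     char_poly (restr W') = char_poly (restr W) * char_poly Q].
Proof.
move=> restrP LW LW' WW'; set D := (W' :\: W)%VS.
have DW : (W :&: D = 0)%VS by rewrite capvC capv_diff.
have WD : (W + D = W')%VS.
  by have := addv_diff_cap W' W; rewrite (capv_idPr WW') addvC.
have dir : directv (W + D) by apply/directv_addP.
pose e := cat_tuple (vbasis W) (vbasis D).
have be : basis_of W' e by rewrite -WD; apply: cat_basis => //; exact: vbasisP.
pose Q := \matrix_(i < \dim D, j < \dim D) coord e (rshift _ j) (L (vbasis D)`_i).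
pose S := \matrix_(i < \dim D, j < \dim W) coord e (lshift _ j) (L (vbasis D)`_i).
have el (j : 'I_(\dim W)) : e`_(lshift (\dim D) j) = (vbasis W)`_j.
  by rewrite nth_cat size_tuple /= ltn_ord.
have er (j : 'I_(\dim D)) : e`_(rshift (\dim W) j) = (vbasis D)`_j.
  by rewrite nth_cat size_tuple /= ltnNge leq_addr addKn.
have DW' : (D <= W')%VS by exact: diffvSl.
have LD (i : 'I_(\dim D)) : L (vbasis D)`_i = \sum_j S i j *: (vbasis W)`_j + \sum_j Q i j *: (vbasis D)`_j.
  have H : L (vbasis D)`_i \in W'.
    by apply: (subvP LW'); apply: memv_img; apply: (subvP DW'); rewrite vbasis_mem// mem_nth// size_tuple.
  rewrite {1}(coord_basis be H) big_split_ord /=; congr (_ + _).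
    by apply: eq_bigr => j _; rewrite el mxE.
  by apply: eq_bigr => j _; rewrite er mxE.
have memW (j : 'I_(\dim W)) : (vbasis W)`_j \in W by rewrite vbasis_mem// mem_nth// size_tuple.
have memD (j : 'I_(\dim D)) : (vbasis D)`_j \in D by rewrite vbasis_mem// mem_nth// size_tuple.
exists (\dim D), (fun i => (vbasis D)`_i), Q; split.
- by rewrite addnC -(directvP dir) /= WD.
- by move=> i; apply: (subvP DW'); exact: memD.
- move=> c cW.
  have : \sum_i c i *: (vbasis D)`_i \in (W :&: D)%VS.
    by rewrite memv_cap cW memv_suml// => j _; exact/memvZ/memD.
  rewrite DW memv0 => /eqP c0 i.
  by have := coord_sum_free c i (basis_free (vbasisP D)); rewrite c0 linear0.
- by move=> i; rewrite LD addrK memv_suml// => j _; exact/memvZ/memW.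
have T : char_poly (block_mx (restr W) 0 S Q) = char_poly (restr W) * char_poly Q.
  rewrite /char_poly /char_poly_mx map_block_mx scalar_mx_block opp_block_mx add_block_mx.
  by rewrite map_mx0 oppr0 addr0 det_lblock.
rewrite -T; apply: (char_poly_basis (vbasisP W') be) => [i|]; first exact: restrP.
move=> i; case: (split_ordP i) => k ->.
  rewrite el (restrP _ _ LW) big_split_ord /= [X in _ = _ + X]big1 ?addr0.
    by apply: eq_bigr => j _; rewrite el block_mxEul.
  by move=> j _; rewrite block_mxEur mxE scale0r.
rewrite er LD big_split_ord /=; congr (_ + _); apply: eq_bigr => j _.
  by rewrite el block_mxEdl.
by rewrite er block_mxEdr.
Qed.

End CharPoly.

(** * Positive definite quadratic forms *)

Section QuadraticForms.
Context {R : realType}.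

Lemma coord_le_norm n (x : 'rV[R]_n) j : `|x 0 j| <= `|x|.
Proof. by rewrite [leRHS]/Num.norm /= mx_normrE; exact: (le_bigmax _ _ (0, j)). Qed.

Lemma norm_le_coord n (x : 'rV[R]_n) (K : R) : 0 <= K -> (forall j, `|x 0 j| <= K) -> `|x| <= K.
Proof.
move=> K0 H; rewrite [leLHS]/Num.norm /= mx_normrE; apply: bigmax_le => // -[i j] _ /=.
by rewrite (ord1 i).
Qed.

Lemma linear_bound n (W : normedModType R) (f : {linear 'rV[R]_n -> W}) :
  exists2 K, 0 <= K & forall x, `|f x| <= K * `|x|.
Proof.
exists (\sum_j `|f (delta_mx 0 j)|); first exact: sumr_ge0.
move=> x; rewrite {1}(row_delta x) linear_sum (le_trans (ler_norm_sum _ _ _))// mulr_suml.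
by apply: ler_sum => j _; rewrite linearZ /= normrZ mulrC ler_wpM2l// coord_le_norm.
Qed.

Lemma linear_rV_continuous n (W : normedModType R) (f : {linear 'rV[R]_n -> W}) : continuous f.
Proof.
have -> : f = (fun w => \sum_j w 0 j *: f (delta_mx 0 j)) :> (_ -> _).
  apply/funext => w; rewrite {1}(row_delta w) linear_sum.
  by apply: eq_bigr => j _; exact: linearZ.
apply: continuous_big => [|j _]; first exact: add_continuous.
by move=> w; apply: continuousZr_tmp; exact: coord_continuous.
Qed.

Definition quadf k (P : 'M[R]_k) (a : 'rV[R]_k) : R := \sum_i \sum_j a 0 i * a 0 j * P i j.

Lemma quadf_bound k (P : 'M[R]_k) a : `|quadf P a| <= (\sum_i \sum_j `|P i j|) * `|a| ^+ 2.
Proof.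
rewrite /quadf (le_trans (ler_norm_sum _ _ _))// mulr_suml; apply: ler_sum => i _.
rewrite (le_trans (ler_norm_sum _ _ _))// mulr_suml; apply: ler_sum => j _.
rewrite !normrM mulrC ler_wpM2l// expr2.
by apply: ler_pM => //; exact: coord_le_norm.
Qed.

Lemma quadfZ k (P : 'M[R]_k) c a : quadf P (c *: a) = c ^+ 2 * quadf P a.
Proof.
rewrite /quadf mulr_sumr; apply: eq_bigr => i _; rewrite mulr_sumr; apply: eq_bigr => j _.
by rewrite !mxE; ring.
Qed.

Lemma quadf0 k (P : 'M[R]_k) : quadf P 0 = 0.
Proof. by rewrite /quadf big1 // => i _; rewrite big1 // => j _; rewrite !mxE !mul0r. Qed.

Lemma quadfB k (P Q : 'M[R]_k) a : quadf (P - Q) a = quadf P a - quadf Q a.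
Proof.
rewrite /quadf -sumrB; apply: eq_bigr => i _; rewrite -sumrB; apply: eq_bigr => j _.
by rewrite !mxE; ring.
Qed.

Lemma continuous_quadf k (P : 'M[R]_k) : continuous (quadf P).
Proof.
apply: continuous_big => [|i _]; first exact: add_continuous.
apply: continuous_big => [|j _]; first exact: add_continuous.
have c l : continuous (fun a : 'rV[R]_k => a 0 l) by exact: coord_continuous.
move=> a; apply: (@continuousM _ _ (fun a : 'rV[R]_k => a 0 i * a 0 j) (fun=> P i j)).
  by apply: (@continuousM _ _ (fun a : 'rV[R]_k => a 0 i) (fun a => a 0 j)); exact: c.
exact: cst_continuous.
Qed.

(** The constant is the minimum on the compact unit sphere; homogeneity does the rest. *)
Lemma posdef_bound k (P : 'M[R]_k) : (forall a, a != 0 -> 0 < quadf P a) ->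
  exists2 m, 0 < m & forall a, m * `|a| ^+ 2 <= quadf P a.
Proof.
move=> Ppos; pose A := [set a : 'rV[R]_k | `|a| = 1].
(* The sphere is empty only when [k] is 0; every vector is then 0 and any constant will do. *)
have [A0|/set0P/negP/negPn/eqP A0] := pselect (A !=set0); last first.
  exists 1 => // a; have [->|a0] := eqVneq a 0.
    by rewrite quadf0 normr0 expr0n mulr0.
  have : A (`|a|^-1 *: a) by rewrite /A /= normrZ normfV normr_id mulVf// normr_eq0.
  by rewrite A0.
have cA : compact A.
  apply: bounded_closed_compact.
    by exists 1; split=> // M M1 a /= ->; exact: ltW.
  rewrite /A (_ : [set a | _] = Num.norm @^-1` [set 1]) //.
  by apply: preimage_closed => [a _|]; [exact: norm_continuous|exact: closed_eq].
have cq : {within A, continuous (quadf P)} by apply: continuous_subspaceT; exact: continuous_quadf.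
have [a0 Aa0 Ha0] := EVT_min_rV A0 cA cq.
have a00 : a0 != 0.
  by apply/eqP => a00; move: Aa0; rewrite inE /A /= a00 normr0 => /esym/eqP; rewrite oner_eq0.
exists (quadf P a0); first exact: Ppos.
move=> a; have [->|an0] := eqVneq a 0.
  by rewrite quadf0 normr0 expr0n mulr0.
have na : `|a| != 0 by rewrite normr_eq0.
have : (`|a|^-1 *: a) \in A by rewrite inE /A /= normrZ normfV normr_id mulVf.
move=> /Ha0; rewrite quadfZ exprVn mulrC ler_pdivlMr ?exprn_gt0 ?normr_gt0//.
Qed.

(** The entries may move by a total of [m / 2] before half of the lower bound is lost, so one
    constant serves for all nearby matrices. *)
Lemma posdef_near k (T : Type) (F : set_system T) (FF : Filter F) (P : T -> 'M[R]_k) (P0 : 'M[R]_k) :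
  (forall a, a != 0 -> 0 < quadf P0 a) ->
  (forall i j, P x i j @[x --> F] --> P0 i j) ->
  exists2 m, 0 < m & \forall x \near F, forall a, m * `|a| ^+ 2 <= quadf (P x) a.
Proof.
move=> /posdef_bound[m m0 Hm] cP; exists (m / 2); first by rewrite divr_gt0.
have c0 : (\sum_i \sum_j `|P x i j - P0 i j|) @[x --> F] --> (0 : R).
  rewrite -[X in _ --> X](_ : \sum_(i < k) \sum_(j < k) 0 = 0); last first.
    by rewrite big1 // => i _; rewrite big1.
  apply: cvg_big => [|i _]; first exact: add_continuous.
  apply: cvg_big => [|j _]; first exact: add_continuous.
  rewrite -(normr0 R); apply: cvg_norm; rewrite -(subrr (P0 i j)).
  by apply: cvgB => //; exact: cvg_cst.
have m20 : 0 < m / 2 by rewrite divr_gt0.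
move/cvgrPdist_le : c0 => /(_ _ m20); apply: filterS => x /=.
rewrite sub0r normrN ger0_norm; last by apply: sumr_ge0 => i _; exact: sumr_ge0.
move=> Hx a; have := Hm a; have := quadf_bound (P x - P0) a.
rewrite quadfB => h1 h2.
have : `|quadf (P x) a - quadf P0 a| <= m / 2 * `|a| ^+ 2.
  apply: le_trans h1 _; rewrite ler_wpM2r// ?exprn_ge0//.
  by under eq_bigr do under eq_bigr do rewrite !mxE.
rewrite ler_norml => /andP[h3 _].
have : m / 2 * `|a| ^+ 2 = m * `|a| ^+ 2 - m / 2 * `|a| ^+ 2 by field.
by move=> ->; move: h2 h3; lra.
Qed.

Lemma bilinear_quadf n (W : {vspace 'rV[R]_n}) (B : 'rV[R]_n -> 'rV[R]_n -> R) k
    (e : 'I_k -> 'rV[R]_n) (a : 'rV[R]_k) :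
  (forall a u v w, u \in W -> v \in W -> w \in W -> B (a *: u + v) w = a * B u w + B v w) ->
  (forall u v, u \in W -> v \in W -> B u v = B v u) -> (forall i, e i \in W) ->
  B (\sum_i a 0 i *: e i) (\sum_i a 0 i *: e i) = quadf (\matrix_(i, j) B (e i) (e j)) a.
Proof.
move=> Blin Bsym eW.
have B0 w : w \in W -> B 0 w = 0.
  move=> wW; have := Blin 1 0 0 w (mem0v _) (mem0v _) wW.
  by rewrite scaler0 addr0 mul1r -{1}[B 0 w]addr0 => /addrI.
have Bsum m (c : 'I_m -> R) (f : 'I_m -> 'rV[R]_n) w : (forall i, f i \in W) -> w \in W ->
    B (\sum_i c i *: f i) w = \sum_i c i * B (f i) w.
  move=> fW wW; elim: m c f fW => [|m IH] c f fW; first by rewrite !big_ord0 B0.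
  by rewrite !big_ord_recl /= Blin ?IH// memv_suml// => i _; exact: memvZ.
have SW : \sum_i a 0 i *: e i \in W by apply: memv_suml => i _; exact/memvZ.
rewrite Bsum// /quadf; apply: eq_bigr => i _.
rewrite Bsym// Bsum// mulr_sumr; apply: eq_bigr => j _.
by rewrite mxE (Bsym (e j)) // mulrA.
Qed.

End QuadraticForms.

(** * Exponential growth rates *)

Section Growth.
Context {R : realType} {n : nat}.
Local Notation V := 'rV[R]_n.

Definition exp_bounded (c : R) (x : nat -> V) := exists K, forall k, `|x k| <= K * c ^+ k.

Lemma exp_boundedZD c a (x y : nat -> V) : exp_bounded c x -> exp_bounded c y ->
  exp_bounded c (fun k => a *: x k + y k).
Proof.
move=> [K HK] [K' HK']; exists (`|a| * K + K') => k.
rewrite (le_trans (ler_normD _ _))// normrZ mulrDl lerD// -mulrA ler_wpM2l//.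
Qed.

Lemma exp_bounded0 c : exp_bounded c (fun=> 0).
Proof. by exists 0 => k; rewrite normr0 mul0r. Qed.

(** Bilinearity is asked on [G] and [H] only, to suit a bracket that is controlled layer by layer;
    coordinates in bases of the two subspaces give the bound. *)
Lemma bilinear_bound (G H : {vspace V}) (b : V -> V -> V) :
  (forall a u u' w, u \in G -> u' \in G -> w \in H -> b (a *: u + u') w = a *: b u w + b u' w) ->
  (forall a u w w', u \in G -> w \in H -> w' \in H -> b u (a *: w + w') = a *: b u w + b u w') ->
  exists2 K, 0 <= K & forall u w, u \in G -> w \in H -> `|b u w| <= K * `|u| * `|w|.
Proof.
move=> bl br.
have b0l w : w \in H -> b 0 w = 0.
  by move=> wH; have := bl 1 0 0 w (mem0v _) (mem0v _) wH; rewrite scaler0 addr0 scale1r -{1}[b 0 w]addr0 => /addrI.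
have b0r u : u \in G -> b u 0 = 0.
  by move=> uG; have := br 1 u 0 0 uG (mem0v _) (mem0v _); rewrite scaler0 addr0 scale1r -{1}[b u 0]addr0 => /addrI.
have suml m (c : 'I_m -> R) (e : 'I_m -> V) w : (forall i, e i \in G) -> w \in H ->
    b (\sum_i c i *: e i) w = \sum_i c i *: b (e i) w.
  move=> eG wH; elim: m c e eG => [|m IH] c e eG; first by rewrite !big_ord0 b0l.
  by rewrite !big_ord_recl /= bl ?IH// memv_suml// => i _; exact: memvZ.
have sumr m (c : 'I_m -> R) (e : 'I_m -> V) u : (forall i, e i \in H) -> u \in G ->
    b u (\sum_i c i *: e i) = \sum_i c i *: b u (e i).
  move=> eH uG; elim: m c e eH => [|m IH] c e eH; first by rewrite !big_ord0 b0r.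
  by rewrite !big_ord_recl /= br ?IH// memv_suml// => i _; exact: memvZ.
have mG (i : 'I_(\dim G)) : (vbasis G)`_i \in G by rewrite vbasis_mem// mem_nth// size_tuple.
have mH (i : 'I_(\dim H)) : (vbasis H)`_i \in H by rewrite vbasis_mem// mem_nth// size_tuple.
have cb (W : {vspace V}) (i : 'I_(\dim W)) : exists2 K, 0 <= K &
   forall x : V, `|coord (vbasis W) i x : R^o| <= K * `|x|.
  exact: (linear_bound (coord (vbasis W) i : {linear V -> R^o})).
pose KG i := sval (cid2 (cb G i)); pose KH i := sval (cid2 (cb H i)).
exists (\sum_i KG i * \sum_j KH j * `|b (vbasis G)`_i (vbasis H)`_j|).
  apply: sumr_ge0 => i _; apply: mulr_ge0; first by rewrite /KG; case: cid2.
  by apply: sumr_ge0 => j _; apply: mulr_ge0 => //; rewrite /KH; case: cid2.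
move=> u w uG wH.
rewrite {1}(coord_vbasis uG) suml//.
rewrite (le_trans (ler_norm_sum _ _ _))// !mulr_suml; apply: ler_sum => i _.
have KGi : `|coord (vbasis G) i u : R^o| <= KG i * `|u| by rewrite /KG; case: cid2.
have S : `|b (vbasis G)`_i w| <= (\sum_j KH j * `|b (vbasis G)`_i (vbasis H)`_j|) * `|w|.
  rewrite {1}(coord_vbasis wH) sumr//.
  rewrite (le_trans (ler_norm_sum _ _ _))// mulr_suml; apply: ler_sum => j _.
  rewrite normrZ mulrAC; apply: ler_wpM2r => //.
  by rewrite /KH; case: cid2.
rewrite normrZ; apply: le_trans (ler_pM _ _ KGi S) _ => //.
by rewrite mulrACA mulrA.
Qed.

(** Otherwise [K * (p / q) ^+ k] would tend to 0 while staying above [N]. *)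
Lemma exp_le (q p N K : R) : 0 < N -> 0 < p -> 0 <= q -> (forall k, q ^+ k * N <= K * p ^+ k) -> q <= p.
Proof.
move=> N0 p0 q0 H; rewrite leNgt; apply/negP => pq.
pose x := p / q; have q1 : 0 < q by exact: lt_trans pq.
have x0 : `|x| < 1 by rewrite ger0_norm ?divr_ge0 ?(ltW p0)// ltr_pdivrMr// mul1r.
have := cvg_geometric K x0; rewrite /geometric /= => /cvgrPdist_lt/(_ _ N0) [k _ /(_ k)/=].
rewrite leqnn sub0r normrN => /(_ isT) Hk.
have := H k; rewrite mulrC -ler_pdivlMr ?exprn_gt0// -mulrA -expr_div_n -/x => Hk2.
by have := le_lt_trans (le_trans Hk2 (ler_norm _)) Hk; rewrite ltxx.
Qed.

End Growth.

(** * Growth of iterates and eigenvalues on the layers *)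

Section Spectrum.
Context {R : realType} {n : nat}.
Local Notation V := 'rV[R]_n.
Variables (F G : nat -> {vspace V}) (sigma : nat -> 'End(V)) (lie : V -> V -> V)
  (B : V -> V -> R).
Hypothesis sigma_image : forall i, (sigma i @: F i)%VS = G i.
Hypothesis F_mono : forall i, (F i <= F i.+1)%VS.
Hypothesis sigma_ker : forall i v, v \in F i ->
  (sigma i v == 0) = (if i is i'.+1 then v \in F i' else v == 0).
Hypothesis G_gen : forall i,
  G i.+1 = vspan [set w | exists u v, [/\ u \in G i, v \in G 0%N & w = lie u v]].
Hypothesis lie_l : forall i a u u' w, u \in G i -> u' \in G i -> w \in G 0%N ->
  lie (a *: u + u') w = a *: lie u w + lie u' w.
Hypothesis lie_r : forall i a u w w', u \in G i -> w \in G 0%N -> w' \in G 0%N ->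
  lie u (a *: w + w') = a *: lie u w + lie u w'.
Hypothesis B_lin : forall a u v w, u \in F 0%N -> v \in F 0%N -> w \in F 0%N ->
  B (a *: u + v) w = a * B u w + B v w.
Hypothesis B_sym : forall u v, u \in F 0%N -> v \in F 0%N -> B u v = B v u.
Hypothesis B_pos : forall u, u \in F 0%N -> u != 0 -> 0 < B u u.

(* The second condition says that the map induced by [M] on the graded space respects
   [lie]. *)
Definition flag_compatible (M : 'End(V)) :=
  (forall i, (M @: F i <= F i)%VS) /\
  (forall i u w v, u \in F i -> w \in F 0%N -> v \in F i.+1 ->
    sigma i.+1 v = lie (sigma i u) (sigma 0%N w) ->
    sigma i.+1 (M v) = lie (sigma i (M u)) (sigma 0%N (M w))).

Lemma B_bound : exists K, forall u, u \in F 0%N -> `|u| ^+ 2 <= K * B u u.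
Proof.
pose e := vbasis (F 0%N).
pose P : 'M[R]_(\dim (F 0%N)) := \matrix_(i, j) B e`_i e`_j.
have eF (i : 'I_(\dim (F 0%N))) : e`_i \in F 0%N by rewrite vbasis_mem// mem_nth// size_tuple.
pose E (a : 'rV[R]_(\dim (F 0%N))) : V := \sum_i a 0 i *: e`_i.
have EF a : E a \in F 0%N by apply: memv_suml => i _; exact/memvZ.
have BE a : B (E a) (E a) = quadf P a by exact: bilinear_quadf B_lin B_sym eF.
have [m m0 Hm] : exists2 m, 0 < m & forall a, m * `|a| ^+ 2 <= quadf P a.
  apply: posdef_bound => a a0; rewrite -BE; apply: B_pos => //.
  apply: contra_neq a0 => Ea0; apply/rowP => i; rewrite mxE.
  have := coord_sum_free (fun i => a 0 i) i (basis_free (vbasisP (F 0%N))).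
  by rewrite -/e -/(E a) Ea0 linear0.
pose S := \sum_(i < \dim (F 0%N)) `|e`_i|.
exists (S ^+ 2 / m) => u uF.
pose a : 'rV[R]_(\dim (F 0%N)) := \row_i coord e i u.
have uE : u = E a by rewrite {1}(coord_vbasis uF); apply: eq_bigr => i _; rewrite mxE.
rewrite {2 3}uE BE -mulrA.
have S0 : 0 <= S by exact: sumr_ge0.
apply: (@le_trans _ _ (S ^+ 2 * `|a| ^+ 2)).
  rewrite -exprMn ler_pXn2r ?nnegrE ?mulr_ge0//.
  rewrite uE (le_trans (ler_norm_sum _ _ _))// mulr_suml; apply: ler_sum => i _.
  by rewrite normrZ mulrC ler_wpM2l// coord_le_norm.
rewrite ler_wpM2l ?exprn_ge0// mulrC ler_pdivlMr// mulrC.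
exact: Hm.
Qed.

Section OneMap.
Variables (M : 'End(V)) (c : R).
Hypotheses (c0 : 0 < c) (MF : flag_compatible M)
  (MB : forall u, u \in F 0%N -> B (M u) (M u) = c ^+ 2 * B u u).

Lemma iter_mem i k v : v \in F i -> iter k M v \in F i.
Proof.
by move=> vF; elim: k => //= k IH; apply: (subvP (MF.1 i)); exact: memv_img.
Qed.

Lemma iter_lin k a u v : iter k M (a *: u + v) = a *: iter k M u + iter k M v.
Proof. by elim: k => //= k ->; rewrite linearP. Qed.

(** In other words [M] induces a well-defined map on the classes. *)
Lemma sigma_ker_iter i k v : v \in F i -> sigma i v = 0 -> sigma i (iter k M v) = 0.
Proof.
move=> vF /eqP; rewrite sigma_ker// => vi; apply/eqP; rewrite sigma_ker ?iter_mem//.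
case: i vF vi => [_ /eqP ->|i vF vi]; last exact: iter_mem.
by elim: k => //= k /eqP ->; rewrite linear0.
Qed.

(** Each iteration multiplies [B] by [c ^+ 2], and [B] controls the norm on [F 0]. The pair [M], [c]
    is kept abstract because it stands both for [L], [C] and for their inverses. *)
Lemma sigma_growth0 v : v \in F 0%N ->
  exp_bounded (c ^+ 1) (fun k => sigma 0%N (iter k M v)).
Proof.
move=> vF; have [K HK] := B_bound.
have Bk k : B (iter k M v) (iter k M v) = (c ^+ k) ^+ 2 * B v v.
  elim: k => [|k IHk]; first by rewrite expr0 expr1n mul1r.
  by rewrite /= MB ?iter_mem// IHk [c ^+ k.+1]exprS; ring.
have [K' K'0 HK'] := linear_bound (sigma 0%N : {linear V -> V}).
exists (K' * Num.sqrt (K * B v v)) => k; rewrite expr1 -mulrA.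
apply: le_trans (HK' _) _; apply: ler_wpM2l => //.
have ck : 0 <= c ^+ k by rewrite exprn_ge0 // ltW.
have -> : c ^+ k = Num.sqrt ((c ^+ k) ^+ 2) by rewrite sqrtr_sqr ger0_norm.
have KB : 0 <= K * B v v by apply: le_trans (HK _ vF); rewrite exprn_ge0.
rewrite -sqrtrM//.
have -> : `|iter k M v| = Num.sqrt (`|iter k M v| ^+ 2) by rewrite sqrtr_sqr normr_id.
apply: ler_wsqrtr; apply: le_trans (HK _ (iter_mem k vF)) _.
by rewrite Bk mulrCA mulrC.
Qed.

(* Brackets multiply growth rates and the layers are generated by the first one. *)
Lemma sigma_growth i v : v \in F i ->
  exp_bounded (c ^+ i.+1) (fun k => sigma i (iter k M v)).
Proof.
elim: i v => [|i IH] v vF; first exact: sigma_growth0.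
have [K K0 HK] := bilinear_bound (@lie_l i) (@lie_r i).
(* Induction on the class [w] in the span of brackets, for all its lifts at once: if [v0] lifts the
   bracket that is split off with coefficient [a], then [v] minus [a *: v0] lifts the remainder. *)
have main w : w \in G i.+1 -> forall v, v \in F i.+1 -> sigma i.+1 v = w ->
   exp_bounded (c ^+ i.+2) (fun k => sigma i.+1 (iter k M v)).
  rewrite G_gen; move: w; apply: vspan_ind => [{}v {}vF v0|a w' w].
    under [X in exp_bounded _ X]eq_fun do rewrite (sigma_ker_iter _ vF v0).
    exact: exp_bounded0.
  move=> [a1 [b1 [a1G b1G ->]]] IHw {}v {}vF svE.
  have l1G : lie a1 b1 \in G i.+1.
    by rewrite G_gen; apply: (vspanP _).1; exists a1, b1.
  move: (l1G); rewrite -sigma_image => /memv_imgP[v0 v0F v0E].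
  move: (a1G); rewrite -sigma_image => /memv_imgP[u uF uE].
  move: (b1G); rewrite -sigma_image => /memv_imgP[u' u'F u'E].
  have v'F : (- a) *: v0 + v \in F i.+1 by rewrite memvD// memvZ.
  have sw : sigma i.+1 ((- a) *: v0 + v) = w by rewrite linearP /= svE -v0E scaleNr addKr.
  have Hw := IHw _ v'F sw.
  have -> : (fun k => sigma i.+1 (iter k M v)) =
      (fun k => a *: sigma i.+1 (iter k M v0) + sigma i.+1 (iter k M ((- a) *: v0 + v))).
    apply/funext => k.
    have -> : sigma i.+1 (iter k M ((- a) *: v0 + v)) =
        (- a) *: sigma i.+1 (iter k M v0) + sigma i.+1 (iter k M v).
      by rewrite iter_lin; exact: linearP.
    by rewrite scaleNr addrA subrr add0r.
  apply: exp_boundedZD => //.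
  (* Iterates of a lift of a bracket remain lifts of the bracket of the iterates, so the rates
     [c ^+ i.+1] and [c] multiply. *)
  have E k : sigma i.+1 (iter k M v0) = lie (sigma i (iter k M u)) (sigma 0%N (iter k M u')).
    elim: k => [|k IHk]; first by rewrite /= -v0E uE u'E.
    by apply: MF.2 => //; exact: iter_mem.
  have [K1 HK1] := IH _ uF; have [K2 HK2] := sigma_growth0 u'F.
  exists (K * K1 * K2) => k; rewrite E.
  apply: le_trans (HK _ _ _ _) _; try by rewrite -sigma_image memv_img ?iter_mem.
  have -> : K * K1 * K2 * (c ^+ i.+2) ^+ k =
      K * ((K1 * (c ^+ i.+1) ^+ k) * (K2 * (c ^+ 1) ^+ k)).
    by rewrite -[i.+2]addn1 exprD exprMn; ring.
  by rewrite -[leLHS]mulrA; apply: ler_wpM2l => //; apply: ler_pM.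
by apply: (main (sigma i.+1 v)) => //; rewrite -sigma_image memv_img.
Qed.

(* The classes of [X] and [Y] are the real and imaginary parts of an eigenvector of
   eigenvalue [a + ib]; the sum of their squared norms is multiplied by [a^2 + b^2] at each
   iteration, while it grows at most like [c^(2(i+1)k)]. *)
Lemma sigma_eigen_le i (X Y : V) (a b : R) : X \in F i -> Y \in F i ->
  (sigma i X != 0) || (sigma i Y != 0) ->
  sigma i (M X) = a *: sigma i X - b *: sigma i Y ->
  sigma i (M Y) = b *: sigma i X + a *: sigma i Y ->
  a ^+ 2 + b ^+ 2 <= (c ^+ i.+1) ^+ 2.
Proof.
move=> XF YF nz MX MY.
pose xi k := sigma i (iter k M X); pose eta k := sigma i (iter k M Y).
have rec Z u v : Z \in F i -> sigma i (M Z) = u *: sigma i X + v *: sigma i Y ->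
    forall k, sigma i (iter k.+1 M Z) = u *: xi k + v *: eta k.
  move=> ZF E k; rewrite iterSr.
  have MZ : M Z \in F i by apply: (iter_mem 1).
  (* The relation between classes is encoded in one vector of zero class, which keeps zero class
     under iteration; the relation thus holds at every time. *)
  pose W := (- u) *: X + ((- v) *: Y + M Z).
  have WF : W \in F i by rewrite !memvD ?memvZ.
  have W0 : sigma i W = 0.
    have -> : sigma i W = (- u) *: sigma i X + ((- v) *: sigma i Y + sigma i (M Z)).
      by rewrite /W !linearD !linearZ.
    by rewrite E !scaleNr addrCA addKr addNr.
  have := sigma_ker_iter k WF W0.
  have -> : sigma i (iter k M W) = (- u) *: xi k + ((- v) *: eta k + sigma i (iter k M (M Z))).
    by rewrite /W !iter_lin !linearD !linearZ.
  by rewrite addrA => /eqP; rewrite addrC addr_eq0 opprD !scaleNr !opprK => /eqP.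
have xiS k : xi k.+1 = a *: xi k - b *: eta k.
  by rewrite /xi (rec X a (- b))// ?scaleNr// MX scaleNr.
have etaS k : eta k.+1 = b *: xi k + a *: eta k by rewrite /eta (rec Y b a).
(* Sums of squares, unlike the sup norm of ['rV], are scaled exactly by multiplication by a complex
   number. *)
pose N k := \sum_j ((xi k 0 j) ^+ 2 + (eta k 0 j) ^+ 2).
have NS k : N k = (a ^+ 2 + b ^+ 2) ^+ k * N 0%N.
  elim: k => [|k IHk]; first by rewrite expr0 mul1r.
  rewrite exprS -mulrA -IHk /N mulr_sumr; apply: eq_bigr => j _.
  by rewrite xiS etaS !mxE; ring.
have N0 : 0 < N 0%N.
  rewrite lt0r sumr_ge0 ?andbT; last by move=> j _; rewrite addr_ge0 ?sqr_ge0.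
  apply/negP; rewrite psumr_eq0; last by move=> j _; rewrite addr_ge0 ?sqr_ge0.
  move=> /allP H; move: nz; apply/negP; rewrite negb_or !negbK.
  have {}H j : (xi 0%N 0 j == 0) && (eta 0%N 0 j == 0).
    by have := H j (mem_index_enum _); rewrite paddr_eq0 ?sqr_ge0// !sqrf_eq0.
  by apply/andP; split; apply/eqP/rowP => j; rewrite mxE; apply/eqP; have /andP[] := H j.
have [K1 HK1] := sigma_growth XF; have [K2 HK2] := sigma_growth YF.
apply: (@exp_le _ _ _ (N 0%N) (n%:R * (K1 ^+ 2 + K2 ^+ 2))) => //.
- by rewrite !exprn_gt0.
- by rewrite addr_ge0 ?sqr_ge0.
move=> k; rewrite -NS /N.
have -> : n%:R * (K1 ^+ 2 + K2 ^+ 2) * ((c ^+ i.+1) ^+ 2) ^+ k =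
  \sum_(j < n) ((K1 * (c ^+ i.+1) ^+ k) ^+ 2 + (K2 * (c ^+ i.+1) ^+ k) ^+ 2).
  by rewrite sumr_const card_ord -mulr_natl [((c ^+ i.+1) ^+ 2) ^+ k]exprAC; ring.
apply: ler_sum => j _; apply: lerD.
  rewrite -[leLHS]real_normK ?num_real// ler_pXn2r ?nnegrE//.
  - exact: le_trans (coord_le_norm _ _) (HK1 _).
  - exact: le_trans (HK1 k).
rewrite -[leLHS]real_normK ?num_real// ler_pXn2r ?nnegrE//.
- exact: le_trans (coord_le_norm _ _) (HK2 _).
- exact: le_trans (HK2 k).
Qed.

End OneMap.

Section Invertible.
Variables (L : 'End(V)) (C : R).
Hypotheses (C0 : 0 < C) (LF : flag_compatible L) (Linj : lker L = 0%VS)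
  (LB : forall u, u \in F 0%N -> B (L u) (L u) = C ^+ 2 * B u u).
Let M := (L^-1)%VF.

Let LK u : M (L u) = u.
Proof. exact: (lker0_lfunK (introT eqP Linj)). Qed.

Let KL u : L (M u) = u.
Proof. exact: (lker0_lfunVK (introT eqP Linj)). Qed.

Let inv_mem (W : {vspace V}) v : (L @: W <= W)%VS -> v \in W -> M v \in W.
Proof.
move=> LW vW; have E : (L @: W)%VS = W.
  by apply/eqP; rewrite eqEdim LW limg_dim_eq ?leqnn// Linj capv0.
by move: vW; rewrite -{1}E => /memv_imgP[w wW ->]; rewrite LK.
Qed.

(** Let [v0] lift the bracket of the inverse images. Then [L v0] and [v] have the same class, so
    they differ by an element of [F i]; by dimension [L] maps [F i] onto itself, hence [M] brings
    that difference back into [F i]. *)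
Lemma flag_compatible_inv : flag_compatible M.
Proof.
split=> [i|i u w v uF wF vF E].
  by apply/subvP => _ /memv_imgP[w wF ->]; exact: inv_mem (LF.1 i) wF.
have MuF := inv_mem (LF.1 i) uF; have MwF := inv_mem (LF.1 0%N) wF.
have MvF := inv_mem (LF.1 i.+1) vF.
have : lie (sigma i (M u)) (sigma 0%N (M w)) \in G i.+1.
  rewrite G_gen; apply: (vspanP _).1; exists (sigma i (M u)), (sigma 0%N (M w)).
  by rewrite -!sigma_image !memv_img.
rewrite -sigma_image => /memv_imgP[v0 v0F v0E].
rewrite v0E; have := LF.2 _ _ _ _ MuF MwF v0F (esym v0E).
rewrite !KL -E => E2.
have Lv0 : L v0 \in F i.+1 by apply: (subvP (LF.1 i.+1)); exact: memv_img.
have : sigma i.+1 (L v0 - v) == 0 by rewrite linearB /= E2 subrr.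
rewrite sigma_ker; last exact: memvB.
move=> /(inv_mem (LF.1 i)); rewrite linearB /= LK => H.
have dF : v0 - M v \in F i.+1 by exact: memvB.
have : sigma i.+1 (v0 - M v) == 0 by rewrite sigma_ker.
by rewrite linearB subr_eq0 => /eqP.
Qed.

(** The inverse has the inverse eigenvalue on the same pair of classes, and its growth ratio is
    [C^-1]; the two upper bounds are opposite inequalities. *)
Lemma sigma_eigen i (X Y : V) (a b : R) : X \in F i -> Y \in F i ->
  (sigma i X != 0) || (sigma i Y != 0) ->
  sigma i (L X) = a *: sigma i X - b *: sigma i Y ->
  sigma i (L Y) = b *: sigma i X + a *: sigma i Y ->
  a ^+ 2 + b ^+ 2 = (C ^+ i.+1) ^+ 2.
Proof.
move=> XF YF nz LX LY; set q := a ^+ 2 + b ^+ 2.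
have MB u : u \in F 0%N -> B (M u) (M u) = (C^-1) ^+ 2 * B u u.
  move=> uF; have := LB (inv_mem (LF.1 0%N) uF); rewrite KL => ->.
  by rewrite mulrA -exprMn mulVf ?gt_eqF// expr1n mul1r.
have CV0 : 0 < C^-1 by rewrite invr_gt0.
have LFm Z : Z \in F i -> L Z \in F i by move=> ZF; apply: (subvP (LF.1 i)); exact: memv_img.
have sM Z : Z \in F i -> sigma i Z = 0 -> sigma i (M Z) = 0.
  by move=> ZF /(sigma_ker_iter flag_compatible_inv 1 ZF).
(* With eigenvalue 0, [L X] and [L Y] would have zero class, and the inverse would carry this back
   to [X] and [Y]. *)
have q0 : q != 0.
  apply/negP => /eqP/eqP; rewrite paddr_eq0 ?sqr_ge0// !sqrf_eq0 => /andP[/eqP a0 /eqP b0].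
  move: LX LY; rewrite a0 b0 !scale0r subr0 addr0 => LX LY.
  have := sM _ (LFm _ XF) LX; have := sM _ (LFm _ YF) LY; rewrite !LK => Y0 X0.
  by move: nz; rewrite X0 Y0 eqxx.
have inv Z X' Y' (u v : R) : Z \in F i -> X' \in F i -> Y' \in F i ->
    u *: sigma i (L X') + v *: sigma i (L Y') = sigma i Z ->
    sigma i (M Z) = u *: sigma i X' + v *: sigma i Y'.
  move=> ZF X'F Y'F E; pose W := Z - (u *: L X' + v *: L Y').
  have WF : W \in F i by rewrite memvB// memvD// memvZ// LFm.
  have lin (h : 'End(V)) A D : h (Z - (u *: A + v *: D)) = h Z - (u *: h A + v *: h D).
    rewrite linearB /=; congr (_ - _).
    by rewrite linearD /=; congr (_ + _); exact: linearZ.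
  have W0 : sigma i W = 0 by rewrite /W lin E subrr.
  have := sM _ WF W0; rewrite /W lin !LK linearB /= => /eqP; rewrite subr_eq0 => /eqP ->.
  by rewrite linearD /=; congr (_ + _); exact: linearZ.
have qq : a / q * a + b / q * b = 1 by rewrite /q; field.
(* [a / q] and [- (b / q)] are the real and imaginary parts of the inverse of [a + ib]. *)
have MX : sigma i (M X) = (a / q) *: sigma i X - (- (b / q)) *: sigma i Y.
  rewrite scaleNr opprK; apply: inv => //.
  rewrite LX LY scalerBr scalerDr !scalerA addrACA -scalerDl -scaleNr -scalerDl.
  rewrite qq scale1r (_ : - _ + _ = 0) ?scale0r ?addr0//.
  by rewrite /q; field.
have MY : sigma i (M Y) = (- (b / q)) *: sigma i X + (a / q) *: sigma i Y.
  apply: inv => //.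
  rewrite LX LY scalerBr scalerDr !scalerA addrACA -scalerDl -scaleNr -scalerDl.
  rewrite (_ : - (b / q) * a + _ = 0) ?scale0r ?add0r; last by rewrite /q; field.
  by rewrite (_ : _ + _ = 1) ?scale1r// /q; field.
have h1 := sigma_eigen_le C0 LF LB XF YF nz LX LY.
have h2 := sigma_eigen_le CV0 flag_compatible_inv MB XF YF nz MX MY.
apply/eqP; rewrite eq_le h1 /=.
have q1 : 0 < q by rewrite lt0r q0 addr_ge0 ?sqr_ge0.
have qE : (a / q) ^+ 2 + (- (b / q)) ^+ 2 = q^-1 by rewrite /q; field.
move: h2; rewrite qE -exprM exprVn lef_pV2 ?posrE ?exprn_gt0//.
by rewrite exprM.
Qed.

(** [W] is the kernel of [sigma i] on [F i]: the previous flag term, or 0 when [i] is 0. Leaving it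
    abstract treats both cases together. *)
Lemma layer_spectrum i (W : {vspace V}) : (W <= F i)%VS -> (L @: W <= W)%VS ->
  (forall v, v \in F i -> (sigma i v == 0) = (v \in W)) ->
  exists zs : seq R[i],
    [/\ map_poly (real_complex R) (char_poly (restr_mx L (F i))) =
       map_poly (real_complex R) (char_poly (restr_mx L W)) * \prod_(z <- zs) ('X - z%:P) &
     [seq ln (Normc.normc z) | z <- zs] = nseq (\dim (G i)) (i.+1%:R * ln C)].
Proof.
move=> WF LW kerW.
have restrP (U : {vspace V}) (k : 'I_(\dim U)) : (L @: U <= U)%VS ->
    L (vbasis U)`_k = \sum_j restr_mx L U k j *: (vbasis U)`_j.
  move=> LU; have H : L (vbasis U)`_k \in U.
    by apply: (subvP LU); rewrite memv_img// vbasis_mem// mem_nth// size_tuple.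
  by rewrite {1}(coord_vbasis H); apply: eq_bigr => j _; rewrite mxE.
have [d [b [Q [dE bF bfree LbQ charE]]]] := char_poly_quotient restrP LW (LF.1 i) WF.
have dG : d = \dim (G i).
  have := limg_ker_dim (sigma i) (F i); rewrite sigma_image.
  rewrite (_ : F i :&: lker (sigma i) = W)%VS; last first.
    apply/vspaceP => v; rewrite memv_cap memv_ker; case vF : (v \in F i) => /=.
      by rewrite kerW.
    by apply/esym/negP => /(subvP WF); rewrite vF.
  by rewrite -dE addnC => /addIn.
pose A := map_mx (real_complex R) Q.
have [zs zsE] := closed_field_poly_normal (char_poly A).
have mA : char_poly A = \prod_(z <- zs) ('X - z%:P).
  by rewrite {1}zsE (monicP (char_poly_monic A)) scale1r.
have szs : size zs = d.
  by have := size_char_poly A; rewrite mA size_prod_XsubC => -[].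
exists zs; split; first by rewrite charE rmorphM /=; congr (_ * _); rewrite map_char_poly mA.
have sN : size [seq ln (Normc.normc z) | z <- zs] = \dim (G i) by rewrite size_map szs.
rewrite -sN; apply/all_pred1P/allP => _ /mapP[z zzs ->].
rewrite [pred1 _ _]/= -[_ * ln C]/(_ * ln C) mulr_natl -lnXn//; apply/eqP; congr ln.
have : eigenvalue A z by rewrite eigenvalue_root_char mA root_prod_XsubC.
move=> /eigenvalueP[w wA w0].
have RS (h : 'I_d -> R[i]) : complex.Re (\sum_k h k) = \sum_k complex.Re (h k).
  by apply: (big_morph (@complex.Re R)) => // -[? ?] [? ?].
have IS (h : 'I_d -> R[i]) : complex.Im (\sum_k h k) = \sum_k complex.Im (h k).
  by apply: (big_morph (@complex.Im R)) => // -[? ?] [? ?].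
case: z zzs wA => p q zzs wA.
(* The real and imaginary parts of a complex row eigenvector of the quotient matrix are the
   coefficients on [b] of the two real vectors required by [sigma_eigen]. *)
pose x k := complex.Re (w 0 k); pose y k := complex.Im (w 0 k).
have wjE j : \sum_k w 0 k * (real_complex R (Q k j)) = Complex p q * w 0 j.
  have := congr1 (fun m : 'rV[R[i]]_d => m 0 j) wA; rewrite !mxE => <-.
  by apply: eq_bigr => k _; rewrite mxE.
have xE j : \sum_k x k * Q k j = p * x j - q * y j.
  have := congr1 (@complex.Re R) (wjE j); rewrite RS /x /y.
  case: (w 0 j) => s t /= <-; apply: eq_bigr => k _.
  by case: (w 0 k) => ? ? /=; rewrite mulr0 subr0.
have yE j : \sum_k y k * Q k j = p * y j + q * x j.
  have := congr1 (@complex.Im R) (wjE j); rewrite IS /x /y.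
  case: (w 0 j) => s t /= <-; apply: eq_bigr => k _.
  by case: (w 0 k) => ? ? /=; rewrite mulr0 add0r.
pose X := \sum_k x k *: b k; pose Y := \sum_k y k *: b k.
have XF : X \in F i by apply: memv_suml => k _; exact: memvZ.
have YF : Y \in F i by apply: memv_suml => k _; exact: memvZ.
have LFm Z : Z \in F i -> L Z \in F i by move=> ZF; apply: (subvP (LF.1 i)); exact: memv_img.
have sW v v' : v \in F i -> v' \in F i -> v - v' \in W -> sigma i v = sigma i v'.
  move=> vF v'F; rewrite -kerW; last exact: memvB.
  by rewrite linearB subr_eq0 => /eqP.
have LsumW (c : 'I_d -> R) : L (\sum_k c k *: b k) - \sum_j (\sum_k c k * Q k j) *: b j \in W.
  have -> : \sum_j (\sum_k c k * Q k j) *: b j = \sum_k c k *: (\sum_j Q k j *: b j).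
    under [RHS]eq_bigr do rewrite scaler_sumr.
    rewrite exchange_big; apply: eq_bigr => j _; rewrite scaler_suml.
    by apply: eq_bigr => k _; rewrite scalerA.
  rewrite linear_sum -sumrB; apply: memv_suml => k _.
  by rewrite linearZ /= -scalerBr memvZ.
have sumF (c : 'I_d -> R) : \sum_j c j *: b j \in F i by apply: memv_suml => k _; exact: memvZ.
have LX : sigma i (L X) = p *: sigma i X - q *: sigma i Y.
  rewrite (sW _ _ (LFm _ XF) (sumF _) (LsumW x)).
  under eq_bigr do rewrite xE scalerBl -!scalerA.
  by rewrite sumrB -!scaler_sumr linearB !linearZ.
have LY : sigma i (L Y) = q *: sigma i X + p *: sigma i Y.
  rewrite (sW _ _ (LFm _ YF) (sumF _) (LsumW y)).
  under eq_bigr do rewrite yE scalerDl -!scalerA.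
  by rewrite big_split -!scaler_sumr linearD !linearZ addrC.
have nz : (sigma i X != 0) || (sigma i Y != 0).
  rewrite !kerW// -negb_and; apply/negP => /andP[/bfree x0 /bfree y0].
  move/negP: w0; apply; apply/eqP/rowP => k; rewrite mxE.
  by apply/eqP; rewrite eq_complex; have := x0 k; have := y0 k; rewrite /x /y => -> -> /=; rewrite eqxx.
have H := sigma_eigen XF YF nz LX LY.
by rewrite /= H sqrtr_sqr ger0_norm// exprn_ge0// ltW.
Qed.

(** Characteristic polynomials telescope along the flag, starting from the zero subspace, where the
    polynomial is 1. *)
Lemma flag_spectrum i : lyapunov_exponents_on L (F i)
  (flatten [seq nseq (\dim (G j)) (j.+1%:R * ln C) | j <- iota 0 i.+1]).
Proof.
split; first exact: LF.1.
elim: i => [|i [zs [cE pE]]].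
  have [||zs [cE pE]] := @layer_spectrum 0 0%VS (sub0v _).
  - by rewrite limg0 subvv.
  - by move=> v vF; rewrite sigma_ker// memv0.
  exists zs; split; last by rewrite pE /= cats0.
  have char0 m (Q : 'M[R]_m) : m = 0%N -> char_poly Q = 1.
    by move=> m0; subst m; rewrite /char_poly det_mx00.
  rewrite cE char0 ?dimv0//.
  by rewrite rmorph1 mul1r.
have [|zs' [cE' pE']] := @layer_spectrum i.+1 (F i) (F_mono i) (LF.1 i).
  by move=> v vF; rewrite sigma_ker.
exists (zs ++ zs'); split; first by rewrite cE' cE big_cat.
have -> : iota 0 i.+2 = rcons (iota 0 i.+1) i.+1 by rewrite -[i.+2]addn1 iotaD cats1.
rewrite map_rcons flatten_rcons map_cat pE'; exact: perm_cat.
Qed.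

End Invertible.
End Spectrum.

(** * The differential acting on the tangent cone *)

Section ConeStructure.
Context {R : realType} {n r : nat} {N : subRiemannian R n} {p : N} (TC : tangent_cone r p).
Local Notation E := (@hor R n N).
Local Notation F := (fun i => flag E i p).
Local Notation sigma := (tc_symbol TC).
Local Notation G := (grad TC).

Lemma lie_symbol i (U : set N) (X Y : N -> 'rV[R]_n) : open U -> U p ->
  bracket_span E U i X -> bracket_span E U 0 Y ->
  lie_bracket X Y p \in F i.+1 /\
  sigma i.+1 (lie_bracket X Y p) = lie TC (sigma i (X p)) (sigma 0 (Y p)).
Proof.
move=> oU Up bX bY.
have tX := bracket_span_tangent oU bX; have tY := bracket_span_tangent oU bY.
split; last by have := tc_symbol_lie TC (conj oU Up) tX tY; rewrite addn0.
apply: (lie_bracket_flag oU Up bX); split; first exact: bracket_span_smooth oU bY.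
by move=> y Uy; apply: (subvP (flag0_sub _ _)); exact: tY.2.
Qed.

Lemma flag_common i k u w : u \in F i -> w \in F k ->
  exists U X Y, [/\ open U, U p, bracket_span E U i X /\ X p = u & bracket_span E U k Y /\ Y p = w].
Proof.
move=> /flag_bracket_span[U [X [oU Up bX Xp]]] /flag_bracket_span[V [Y [oV Vp bY Yp]]].
exists (U `&` V), X, Y; split=> //; first exact: openI.
  by split=> //; apply: bracket_span_sub bX => y [].
by split=> //; apply: bracket_span_sub bY => y [].
Qed.

Lemma grad_symbol i a : a \in G i -> exists2 u, u \in F i & a = sigma i u.
Proof. by rewrite -tc_symbol_image => /memv_imgP[u uF ->]; exists u. Qed.

(** The bracket of the cone is defined by left-invariant fields of the group, but on layers
    [tc_symbol_lie] computes it from fields on [N]. Linearity is imported from there, after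
    representing all vectors by fields on a common neighbourhood. *)
Lemma cone_lie_r i a u w w' : u \in G i -> w \in G 0 -> w' \in G 0 ->
  lie TC u (a *: w + w') = a *: lie TC u w + lie TC u w'.
Proof.
move=> /grad_symbol[x xF ->] /grad_symbol[y yF ->] /grad_symbol[y' y'F ->].
have [U [X [Y [oU Up [bX Xp] [bY Yp]]]]] := flag_common xF yF.
have [V [X' [Y' [oV Vp [bX' _] [bY' Y'p]]]]] := flag_common xF y'F.
pose W := U `&` V; have oW : open W by exact: openI.
have WU : W `<=` U by move=> z []. have WV : W `<=` V by move=> z [].
have Wp : W p by [].
have bXW := bracket_span_sub WU bX; have bYW := bracket_span_sub WU bY.
have bYW' := bracket_span_sub WV bY'.
have [_ H1] := lie_symbol oW Wp bXW bYW; have [_ H2] := lie_symbol oW Wp bXW bYW'.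
have [_ H3] := lie_symbol oW Wp bXW (bracket_spanD a bYW bYW').
rewrite Xp Yp in H1; rewrite Xp Y'p in H2; rewrite Xp Yp Y'p in H3.
rewrite -H1 -H2 -linearP -linearP -H3; congr (sigma _ _).
rewrite lie_bracketC (lie_bracketZD _ _ oW Wp); last 2 first.
- exact: bracket_span_smooth oW bYW.
- exact: bracket_span_smooth oW bYW'.
by rewrite opprD -scalerN; congr (_ *: _ + _); apply: esym; exact: lie_bracketC.
Qed.

Lemma cone_lie_l i a u u' w : u \in G i -> u' \in G i -> w \in G 0 ->
  lie TC (a *: u + u') w = a *: lie TC u w + lie TC u' w.
Proof.
move=> /grad_symbol[x xF ->] /grad_symbol[x' x'F ->] /grad_symbol[y yF ->].
have [U [X [Y [oU Up [bX Xp] [bY Yp]]]]] := flag_common xF yF.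
have [V [X' [Y' [oV Vp [bX' X'p] [bY' _]]]]] := flag_common x'F yF.
pose W := U `&` V; have oW : open W by exact: openI.
have WU : W `<=` U by move=> z []. have WV : W `<=` V by move=> z [].
have Wp : W p by [].
have bXW := bracket_span_sub WU bX; have bYW := bracket_span_sub WU bY.
have bXW' := bracket_span_sub WV bX'.
have [_ H1] := lie_symbol oW Wp bXW bYW; have [_ H2] := lie_symbol oW Wp bXW' bYW.
have [_ H3] := lie_symbol oW Wp (bracket_spanD a bXW bXW') bYW.
rewrite Xp Yp in H1; rewrite X'p Yp in H2; rewrite Xp X'p Yp in H3.
rewrite -H1 -H2 -linearP -linearP -H3; congr (sigma _ _).
by apply: (lie_bracketZD _ _ oW Wp); [exact: bracket_span_smooth oW bXW|exact: bracket_span_smooth oW bXW'].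
Qed.

Section Map.
Variable f : N -> N.
Hypotheses (f_diffeo : local_diffeo f) (f_hor : preserves_hor f) (fp : f p = p).
Let L := tangent_map f p.

(** [v] has the same class as the value at [p] of a bracket of representing fields, so the two
    differ by an element of the previous flag term, which [L] preserves. On the bracket itself
    naturality applies, the pushed fields being defined near [f p = p]. *)
Lemma tangent_flag_compatible : flag_compatible F sigma (lie TC) L.
Proof.
have [U [[oU Up] [ofU [sf [g [sg gf]]]]]] := f_diffeo p.
have LF i : (L @: F i <= F i)%VS.
  by have := @tangent_map_flag _ _ _ E f g U oU sf ofU sg gf f_hor i p Up; rewrite fp.
split=> // i u w v uF wF vF svE.
have [U' [X [Y [oU' U'p [bX Xp] [bY Yp]]]]] := flag_common uF wF.
pose W := U' `&` U; have oW : open W by exact: openI.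
have WU' : W `<=` U' by move=> z []. have WU : W `<=` U by move=> z [].
have Wp : W p by [].
have bXW := bracket_span_sub WU' bX; have bYW := bracket_span_sub WU' bY.
have [X' bX' rX] := bracket_span_push sf ofU sg gf f_hor WU oW bXW.
have [Y' bY' rY] := bracket_span_push sf ofU sg gf f_hor WU oW bYW.
have ofW := open_image_sub ofU sg gf WU oW.
have fWp : (f @` W) p by exists p.
have [v0F H1] := lie_symbol oW Wp bXW bYW; have [Lv0F H2] := lie_symbol ofW fWp bX' bY'.
have X'p : X' p = L u by rewrite -Xp -rX// fp.
have Y'p : Y' p = L w by rewrite -Yp -rY// fp.
have Lv0 : lie_bracket X' Y' p = L (lie_bracket X Y p).
  have fWp' : (f @` W) (f p) by exists p.
  have := lie_bracket_related oW (smooth_on_sub WU sf) ofW Wp fWp'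
    (bracket_span_smooth oW bXW) (bracket_span_smooth oW bYW)
    (bracket_span_smooth ofW bX') (bracket_span_smooth ofW bY') rX rY.
  by rewrite fp.
rewrite Xp Yp in H1; rewrite X'p Y'p Lv0 in H2; rewrite -H2; apply/eqP.
have LFm k z : z \in F k -> L z \in F k by move=> zF; apply: (subvP (LF k)); exact: memv_img.
rewrite -subr_eq0 -linearB tc_symbol_ker; last by rewrite memvB// LFm.
rewrite -linearB LFm//.
have dF : v - lie_bracket X Y p \in F i.+1 by exact: memvB.
by rewrite -(tc_symbol_ker TC dF) linearB /= subr_eq0 svE H1.
Qed.

Lemma tangent_lyapunov (C : R) : 0 < C ->
  (forall u, u \in E p -> sr_metric p (L u) (L u) = C ^+ 2 * sr_metric p u u) ->
  forall i, lyapunov_exponents_on L (F i)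
    (flatten [seq nseq (\dim (G j)) (j.+1%:R * ln C) | j <- iota 0 i.+1]).
Proof.
move=> C0 LC i.
have [U [[oU Up] [ofU [sf [g [sg gf]]]]]] := f_diffeo p.
have F0 u : u \in F 0 -> u \in E p by move=> uF; apply: (subvP (flag0_sub _ _)).
apply: (@flag_spectrum _ _ F G sigma (lie TC) (sr_metric p)) => //.
- exact: tc_symbol_image.
- by move=> j; exact: flag_mono.
- by move=> j v; exact: tc_symbol_ker.
- exact: grad_gen.
- exact: cone_lie_l.
- exact: cone_lie_r.
- by move=> a u v w /F0 uE /F0 vE /F0 wE; exact: sr_metric_lin.
- by move=> u v /F0 uE /F0 vE; exact: sr_metric_sym.
- by move=> u /F0 uE; exact: sr_metric_pos.
- exact: tangent_flag_compatible.
- exact: (tangent_map_inj oU sf sg gf Up).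
- by move=> u /F0; exact: LC.
Qed.

End Map.
End ConeStructure.

(** * Horizontal curves and the Carnot-Caratheodory distance *)

Section RealIntegral.
Context {R : realType}.
Notation mu := (@lebesgue_measure R).

(** The integral is over all of [0, 1] although [h] is followed up to [T], since [arc_length]
    measures a whole arc. *)
Lemma deriv_le_integral (h sp : R -> R) (k T : R) : 0 < T <= 1 -> 0 <= k ->
  (forall s, 0 <= s <= T -> derivable h s 1) ->
  {within `[0, T], continuous (derive1 h)} -> {within `[0, 1], continuous sp} ->
  (forall s, 0 <= s <= 1 -> 0 <= sp s) ->
  (forall s, 0 <= s <= T -> derive1 h s <= k * sp s) ->
  ((h T - h 0)%:E <= k%:E * \int[mu]_(s in `[0%R, 1%R]) (sp s)%:E)%E.
Proof.
move=> /andP[T0 T1] k0 dh ch csp sp0 hsp.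
have dhc : derivable_oo_LRcontinuous h 0 T.
  have ct s : 0 <= s <= T -> {for s, continuous h}.
    by move=> /dh /derivable1_diffP; exact: differentiable_continuous.
  split.
  - by move=> s; rewrite in_itv /= => /andP[? ?]; apply: dh; rewrite !ltW.
  - by apply: cvg_at_right_filter; apply: ct; rewrite lexx ltW.
  - by apply: cvg_at_left_filter; apply: ct; rewrite lexx ltW.
have E := continuous_FTC2 T0 ch dhc (fun s _ => erefl).
rewrite EFinB -E.
have sub : [set` `[0, T]] `<=` [set` `[(0:R), 1]].
  by move=> s /=; rewrite !in_itv /= => /andP[-> /le_trans]; apply.
have isp1 : mu.-integrable `[0, 1] (EFin \o sp).
  by apply: continuous_compact_integrable => //; exact: segment_compact.
have ispT : mu.-integrable `[0, T] (EFin \o sp).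
  by apply: integrableS isp1.
have isk : mu.-integrable `[0, T] (fun s => k%:E * (sp s)%:E)%E by exact: integrableZl.
apply: (@le_trans _ _ (\int[mu]_(s in `[0%R, T]) (k%:E * (sp s)%:E))%E).
  apply: le_integral => //.
    by apply: continuous_compact_integrable => //; exact: segment_compact.
  by move=> s; rewrite inE /= in_itv /= => sT; rewrite -EFinM lee_fin; exact: hsp.
rewrite integralZl//; apply: lee_wpmul2l; first by rewrite lee_fin.
apply: ge0_subset_integral => //; first exact: measurable_int isp1.
Qed.

End RealIntegral.

Section Curves.
Context {R : realType} {n : nat} {N : subRiemannian R n}.
Implicit Types (g : R -> N) (c : chart R n N).

Lemma velocity_in_chart g s c : {for s, continuous g} -> atlas c -> cdom c (g s) ->
  derivable (chart_at (g s) \o g) s 1 ->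
  derivable (c \o g) s 1 /\ tvec c (g s) (velocity g s) = derive1 (c \o g) s.
Proof.
move=> cg ac cgs; set a := chart_at (g s) => dag.
have aa := chart_at_atlas (g s); have ags := chart_at_dom (g s).
have /derivable1_diffP d1 := dag.
have d2 : differentiable (c \o cinv a) ((a \o g) s) by exact: differentiable_transition.
have nE : \forall t \near s, ((c \o cinv a) \o (a \o g)) t = (c \o g) t.
  have : nbhs s (g @^-1` cdom a) by apply: cg; apply: open_nbhs_nbhs; split=> //; exact: open_cdom.
  by apply: filterS => t agt; rewrite /= chartK.
have d3 := near_eq_differentiable nE (differentiable_comp d1 d2).
split; first exact/derivable1_diffP.
rewrite (derive1E' d3); apply: etrans _ (near_eq_diffv _ nE).
apply: etrans _ (esym (congr1 (fun h => h (1 : R)) (diff_comp d1 d2))).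
by rewrite /tvec /velocity (derive1E' d1).
Qed.

End Curves.

Section HorizontalMetric.
Context {R : realType} {n : nat} {N : subRiemannian R n}.
Local Notation E := (@hor R n N).

Lemma sr_metric_comb y (a b : R) u v w : u \in E y -> v \in E y -> w \in E y ->
  sr_metric y (a *: u + b *: v) w = a * sr_metric y u w + b * sr_metric y v w.
Proof.
move=> uE vE wE; rewrite sr_metric_lin// ?memvZ//; congr (_ + _).
have := sr_metric_lin b vE (mem0v _) wE; rewrite addr0 => ->.
have := sr_metric_lin 1 (mem0v _) (mem0v _) wE.
by rewrite scaler0 addr0 mul1r -{1}[sr_metric y 0 w]addr0 => /addrI <-; rewrite addr0.
Qed.

Lemma sr_metricZ y a v : v \in E y -> sr_metric y (a *: v) (a *: v) = a ^+ 2 * sr_metric y v v.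
Proof.
have L w z : w \in E y -> z \in E y -> sr_metric y (a *: w) z = a * sr_metric y w z.
  by move=> wE zE; have := sr_metric_comb a 0 wE wE zE; rewrite scale0r addr0 mul0r addr0.
by move=> vE; rewrite L ?memvZ// sr_metric_sym ?memvZ// L// mulrA.
Qed.

Lemma metric_ge0 y v : v \in E y -> 0 <= sr_metric y v v.
Proof.
move=> vE; have [->|v0] := eqVneq v 0; last by apply/ltW; exact: sr_metric_pos.
by have := sr_metricZ 0 (mem0v (E y)); rewrite scaler0 expr0n mul0r => ->.
Qed.

Lemma sr_metric_cauchy y v w : v \in E y -> w \in E y ->
  sr_metric y v w ^+ 2 <= sr_metric y v v * sr_metric y w w.
Proof.
move=> vE wE; have [->|w0] := eqVneq w 0.
  have z x : x \in E y -> sr_metric y x 0 = 0.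
    move=> xE; rewrite sr_metric_sym ?mem0v//.
    by have := sr_metric_comb 0 0 (mem0v _) (mem0v _) xE; rewrite !scale0r addr0 !mul0r addr0.
  by rewrite z// z ?mem0v// mulr0 expr0n.
have W0 := sr_metric_pos wE w0.
set W := sr_metric y w w in W0 *; set b := sr_metric y v w; set A := sr_metric y v v.
(* Positivity at this vector is [W] times the claim, without any division. *)
have zE : W *: v + (- b) *: w \in E y by rewrite memvD ?memvZ.
have := metric_ge0 zE; rewrite sr_metric_comb//.
rewrite (sr_metric_sym vE zE) (sr_metric_sym wE zE) !sr_metric_comb// (sr_metric_sym wE vE).
rewrite -/b -/A -/W => H; rewrite -subr_ge0 -(pmulr_rge0 _ W0).
by apply: le_trans H _; rewrite le_eqVlt; apply/orP; left; apply/eqP; ring.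
Qed.

End HorizontalMetric.

(** * Local frames of the horizontal distribution *)

Section Frames.
Context {R : realType} {n : nat} {N : subRiemannian R n}.
Local Notation E := (@hor R n N).
Implicit Types (c : chart R n N) (y : N) (V : set N).

(** Smoothness of the metric is stated on pairs of horizontal fields; frames convert it into
    continuity of the entries of a Gram matrix. *)
Definition frame_on V k (X : 'I_k -> N -> 'rV[R]_n) :=
  [/\ open V, forall i, smooth_field_on V (X i) &
     forall y, V y -> basis_of (E y) [seq X i y | i <- enum 'I_k]].

Lemma frame_exists y : exists V k (X : 'I_k -> N -> 'rV[R]_n), V y /\ frame_on V X.
Proof.
have [V [[oV Vy] [k [X [sX bX]]]]] := @hor_smooth _ _ N y I.
by exists V, k, X.
Qed.

Section OneFrame.
Variables (V : set N) (k : nat) (X : 'I_k -> N -> 'rV[R]_n).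
Hypothesis fX : frame_on V X.

Let frame_basis y : V y -> basis_of (E y) [tuple X i y | i < k].
Proof. by case: fX => _ _; apply. Qed.

Lemma frame_mem y i : V y -> X i y \in E y.
Proof.
by move=> Vy; apply: (basis_mem (frame_basis Vy)); rewrite -(tnth_mktuple (fun i => X i y) i) mem_tnth.
Qed.

Lemma frame_tangent i : tangent_to E V (X i).
Proof. by split=> [|y]; [case: fX|exact: frame_mem]. Qed.

Definition frame_coord y v : 'rV[R]_k := \row_i coord [tuple X i y | i < k] i v.

Lemma frame_coordE y v : V y -> v \in E y -> v = \sum_i frame_coord y v 0 i *: X i y.
Proof.
move=> Vy vE; rewrite {1}(coord_basis (frame_basis Vy) vE); apply: eq_bigr => i _.
by rewrite mxE -tnth_nth tnth_mktuple.
Qed.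

Lemma frame_free y (a : 'rV[R]_k) : V y -> \sum_i a 0 i *: X i y = 0 -> a = 0.
Proof.
move=> Vy S; apply/rowP => i; rewrite mxE.
have := coord_sum_free (fun i => a 0 i) i (basis_free (frame_basis Vy)).
under eq_bigr do rewrite -tnth_nth tnth_mktuple.
by rewrite S linear0.
Qed.

Lemma smooth_fun_continuous (h : N -> R) y : open V -> V y -> smooth_fun_on V h ->
  {for y, continuous h}.
Proof.
move=> oV Vy sh; have ac := chart_at_atlas y; have cy := chart_at_dom y.
set c := chart_at y in ac cy *.
have H : {for c y, continuous (h \o cinv c)} by apply: (sh c ac 0%N); exists y.
have cc := chart_cont (atlas_chart ac) cy.
have := continuous_comp cc H; rewrite /prop_for /continuous_at /= chartK// => H2.
apply: cvg_trans H2; apply: near_eq_cvg.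
have : nbhs y (cdom c) by apply: open_nbhs_nbhs; split=> //; exact: open_cdom.
by apply: filterS => z cz; rewrite /= chartK.
Qed.

Lemma smooth_field_continuous (Z : N -> 'rV[R]_n) c y : open V -> V y -> smooth_field_on V Z ->
  atlas c -> cdom c y -> (fun z => tvec c z (Z z)) z @[z --> y] --> tvec c y (Z y).
Proof.
move=> oV Vy sZ ac cy.
have H : {for c y, continuous (field_in_chart c Z)} by apply: (sZ c ac 0%N); exists y.
have cc := chart_cont (atlas_chart ac) cy.
have := continuous_comp cc H; rewrite /prop_for /continuous_at /= field_in_chartE// => H2.
apply: cvg_trans H2; apply: near_eq_cvg.
have : nbhs y (cdom c) by apply: open_nbhs_nbhs; split=> //; exact: open_cdom.
by apply: filterS => z cz; rewrite /= field_in_chartE.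
Qed.

Definition frame_gram y : 'M[R]_k := \matrix_(i, j) sr_metric y (X i y) (X j y).

Lemma frame_metric y (a : 'rV[R]_k) : V y ->
  sr_metric y (\sum_i a 0 i *: X i y) (\sum_i a 0 i *: X i y) = quadf (frame_gram y) a.
Proof.
move=> Vy; apply: (@bilinear_quadf _ _ (E y)).
- exact: sr_metric_lin.
- exact: sr_metric_sym.
- by move=> i; exact: frame_mem.
Qed.

Lemma frame_gram_continuous y i j : V y -> frame_gram z i j @[z --> y] --> frame_gram y i j.
Proof.
move=> Vy; have oV : open V by case: fX.
rewrite mxE (_ : (fun z => _) = (fun z => sr_metric z (X i z) (X j z))); last first.
  by apply/funext => z; rewrite mxE.
exact: (smooth_fun_continuous oV Vy (sr_metric_smooth oV (frame_tangent i) (frame_tangent j))).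
Qed.

(** In a frame, [K] times the metric minus the square of [psi] is a quadratic form with continuous
    entries. A strict inequality at [y] means that it is positive definite there, an open
    condition. *)
Lemma metric_compare c y (psi : {linear 'rV[R]_n -> R}) (K : R) : V y -> atlas c -> cdom c y ->
  (forall v, v \in E y -> v != 0 -> (psi (tvec c y v)) ^+ 2 < K * sr_metric y v v) ->
  \forall z \near y, V z /\ forall v, v \in E z -> (psi (tvec c z v)) ^+ 2 <= K * sr_metric z v v.
Proof.
move=> Vy ac cy Hy; have [oV sX _] := fX.
pose t z i := psi (tvec c z (X i z)).
pose P z : 'M[R]_k := \matrix_(i, j) (K * frame_gram z i j - t z i * t z j).
have tE z (a : 'rV[R]_k) : psi (tvec c z (\sum_i a 0 i *: X i z)) = \sum_i a 0 i * t z i.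
  rewrite /tvec linear_sum [LHS]linear_sum; apply: eq_bigr => i _.
  by rewrite linearZ [LHS]linearZ.
have PE z (a : 'rV[R]_k) : V z -> quadf (P z) a =
    K * sr_metric z (\sum_i a 0 i *: X i z) (\sum_i a 0 i *: X i z) -
    (psi (tvec c z (\sum_i a 0 i *: X i z))) ^+ 2.
  move=> Vz; rewrite frame_metric// tE.
  have -> : (\sum_i a 0 i * t z i) ^+ 2 = \sum_i \sum_j a 0 i * a 0 j * (t z i * t z j).
    by rewrite expr2 big_distrlr /=; do 2![apply: eq_bigr => ? _]; rewrite mulrACA.
  rewrite /quadf mulr_sumr -sumrB; apply: eq_bigr => i _.
  rewrite mulr_sumr -sumrB; apply: eq_bigr => j _.
  by rewrite mxE; ring.
have psic : continuous psi by exact: linear_rV_continuous.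
have tc i : t z i @[z --> y] --> t y i.
  exact: (cvg_comp _ _ (smooth_field_continuous oV Vy (sX i) ac cy) (psic _)).
have [m m0 Hm] : exists2 m, 0 < m & \forall z \near y, forall a, m * `|a| ^+ 2 <= quadf (P z) a.
  apply: (@posdef_near _ _ _ _ _ _ (P y)).
    move=> a a0; rewrite PE// subr_gt0; apply: Hy.
      by apply: memv_suml => i _; apply/memvZ/frame_mem.
    by apply: contra_neq a0; exact: frame_free.
  move=> i j; rewrite mxE; under eq_fun do rewrite mxE.
  apply: cvgB; first by apply: cvgMl_tmp; exact: frame_gram_continuous.
  by apply: cvgM; exact: tc.
have nV : nbhs y V by exact: open_nbhs_nbhs.
apply: filterS2 nV Hm => z Vz Hz; split=> // v vE.
rewrite (frame_coordE Vz vE).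
rewrite -subr_ge0 -PE//; apply: le_trans (Hz _).
by rewrite mulr_ge0 ?(ltW m0)// exprn_ge0.
Qed.

End OneFrame.
End Frames.

(** * Continuity of the speed of a horizontal arc *)

Section Speed.
Context {R : realType} {n : nat} {N : subRiemannian R n}.
Local Notation E := (@hor R n N).
Implicit Types (g : R -> N) (c : chart R n N).

Definition speed g (s : R) : R := Num.sqrt (sr_metric (g s) (velocity g s) (velocity g s)).

Lemma cvg_quadf (T : Type) (F : set_system T) (FF : Filter F) k (P : T -> 'M[R]_k) (P0 : 'M[R]_k)
    (a : T -> 'rV[R]_k) (a0 : 'rV[R]_k) :
  (forall i j, P x i j @[x --> F] --> P0 i j) -> (forall i, a x 0 i @[x --> F] --> a0 0 i) ->
  quadf (P x) (a x) @[x --> F] --> quadf P0 a0.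
Proof.
move=> cP ca; rewrite /quadf; apply: cvg_big => [|i _]; first exact: add_continuous.
apply: cvg_big => [|j _]; first exact: add_continuous.
by apply: cvgM => //; apply: cvgM.
Qed.

Lemma tvec_inj c y v : atlas c -> cdom c y -> tvec c y v = 0 -> v = 0.
Proof.
move=> ac cy v0; apply: etrans (esym (tvec_inv v ac cy)) _.
exact: etrans (congr1 ('d (chart_at y \o cinv c) (c y)) v0) (linear0 _).
Qed.

Lemma horizontal_C1 g s c : horizontal g -> 0 <= s <= 1 -> atlas c -> cdom c (g s) ->
  [/\ {for s, continuous g}, derivable (c \o g) s 1, {for s, continuous (derive1 (c \o g))} &
     tvec c (g s) (velocity g s) = derive1 (c \o g) s].
Proof.
move=> [C1 _] s01 ac cgs; have [cg H] := C1 s s01.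
have [/nbhs_singleton d1 cd] := H c ac cgs.
have [/nbhs_singleton d2 _] := H _ (chart_at_atlas _) (chart_at_dom (g s)).
by have [_ ?] := velocity_in_chart cg ac cgs d2; split.
Qed.

(** The chart velocity is continuous, but the metric is accessible through a frame only. The point
    is therefore continuity of the frame coordinates [A] of the velocity, which comes from uniform
    linear independence of the frame near [g s0]. *)
Lemma speed_continuous g : horizontal g -> {within `[0, 1], continuous (speed g)}.
Proof.
move=> hg; apply/subspace_continuousP => s0; rewrite /= in_itv /= => s01.
have [V [k [X [Vq fX]]]] := frame_exists (g s0).
have ac := chart_at_atlas (g s0); have cq := chart_at_dom (g s0).
set c := chart_at (g s0) in ac cq.
have [cg _ cdg vE0] := horizontal_C1 hg s01 ac cq.
have [oV sX _] := fX.
pose Xh s i := tvec c (g s) (X i (g s)).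
pose A s := frame_coord X (g s) (velocity g s).
have cXh i : Xh s i @[s --> s0] --> Xh s0 i.
  exact: (cvg_comp _ _ cg (smooth_field_continuous oV Vq (sX i) ac cq)).
have XhE s (b : 'rV[R]_k) : tvec c (g s) (\sum_i b 0 i *: X i (g s)) = \sum_i b 0 i *: Xh s i.
  by rewrite /tvec linear_sum; apply: eq_bigr => i _; exact: linearZ.
pose P s : 'M[R]_k := \matrix_(i, j) \sum_l Xh s i 0 l * Xh s j 0 l.
have PE s (b : 'rV[R]_k) : quadf (P s) b = \sum_l ((\sum_i b 0 i *: Xh s i) 0 l) ^+ 2.
  rewrite /quadf; under eq_bigr do under eq_bigr do rewrite mxE mulr_sumr.
  under eq_bigr do rewrite exchange_big.
  rewrite exchange_big; apply: eq_bigr => l _.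
  rewrite summxE expr2 big_distrlr /=; do 2![apply: eq_bigr => ? _]; rewrite !mxE.
  by rewrite mulrACA.
have [m m0 Hm] : exists2 m, 0 < m & \forall s \near s0, forall b, m * `|b| ^+ 2 <= quadf (P s) b.
  apply: (@posdef_near R k R (nbhs s0) (nbhs_filter s0) P (P s0)).
    move=> b b0; rewrite PE lt0r sumr_ge0 ?andbT; last by move=> *; exact: sqr_ge0.
    apply: contra_neq b0 => S0; apply: (frame_free fX Vq); apply: (tvec_inj ac cq).
    rewrite XhE; apply/rowP => l; rewrite [RHS]mxE; apply/eqP.
    move/eqP: S0; rewrite psumr_eq0; last by move=> *; exact: sqr_ge0.
    by move=> /allP/(_ l (mem_index_enum _)); rewrite sqrf_eq0.
  move=> i j; rewrite mxE; under eq_fun do rewrite mxE.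
  apply: cvg_big => [|l _]; first exact: add_continuous.
  by apply: cvgM; exact: (cvg_comp _ _ (cXh _) (@coord_continuous _ _ _ _ _ _)).
(* Chart velocity minus the frame combination with coordinates frozen at [s0]: it tends to 0 and
   controls [A s - A s0]. *)
pose z s := derive1 (c \o g) s - \sum_i A s0 0 i *: Xh s i.
have z0 : z s @[s --> s0] --> (0 : 'rV[R]_n).
  have -> : 0 = z s0.
    apply/esym/eqP; rewrite subr_eq0 -XhE -(frame_coordE fX Vq) ?vE0//.
    exact: hg.2.
  apply: cvgB => //; apply: cvg_big => [|i _]; first exact: add_continuous.
  exact: cvgZl_tmp.
(* Restriction to [0, 1], where the velocity is horizontal and equals its frame expansion. *)
set F := within _ _.
have FF : Filter F by exact: within_filter.
have toF (Q : set R) : nbhs s0 Q -> F Q.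
  by move=> HQ; rewrite /F /within /=; apply: filterS HQ => s.
have inF : F (fun s => 0 <= s <= 1).
  by rewrite /F /within /=; apply: nearW => s; rewrite in_itv.
have nV : F (fun s => V (g s)) by apply: toF; apply: cg; exact: open_nbhs_nbhs.
have nc : F (fun s => cdom c (g s)).
  by apply: toF; apply: cg; apply: open_nbhs_nbhs; split=> //; exact: open_cdom.
have vE s : 0 <= s <= 1 -> V (g s) -> velocity g s = \sum_i A s 0 i *: X i (g s).
  by move=> hs Vs; apply: (frame_coordE fX Vs); exact: hg.2.
(* A sum of [n] squares of entries is at most [n] times the square of the sup norm. *)
pose C := Num.sqrt (n%:R / m).
have Az : F (fun s => `|A s - A s0| <= C * `|z s|).
  apply: filterS2 (filterI (toF _ Hm) nc) (filterI inF nV) => s [H cs] [hs Vs].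
  have zE : \sum_i (A s - A s0) 0 i *: Xh s i = z s.
    have [_ _ _ ws] := horizontal_C1 hg hs ac cs.
    rewrite /z -ws (vE s hs Vs) XhE -sumrB; apply: eq_bigr => i _.
    by rewrite !mxE scalerBl.
  have := H (A s - A s0); rewrite PE zE => H2.
  rewrite -(ler_pXn2r (n := 2)) ?nnegrE ?mulr_ge0 ?sqrtr_ge0//.
  rewrite exprMn sqr_sqrtr ?divr_ge0 ?(ltW m0)// mulrAC ler_pdivlMr// mulrC.
  apply: le_trans H2 _.
  have -> : n%:R * `|z s| ^+ 2 = \sum_(l < n) `|z s| ^+ 2.
    by rewrite sumr_const card_ord mulr_natl.
  apply: ler_sum => l _; rewrite -[leLHS]real_normK ?num_real// ler_pXn2r ?nnegrE//.
  exact: coord_le_norm.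
have cA i : A s 0 i @[s --> F] --> A s0 0 i.
  apply/cvgrPdist_le => e e0.
  have C1 : 0 < C + 1 by rewrite ltr_wpDl ?sqrtr_ge0.
  have z1 : F (fun s => `|0 - z s| <= e / (C + 1)).
    by apply: toF; move/cvgrPdist_le : z0; apply; rewrite divr_gt0.
  apply: filterS2 Az z1 => s H1; rewrite sub0r normrN => H2.
  have -> : A s0 0 i - A s 0 i = - ((A s - A s0) 0 i) by rewrite !mxE opprB.
  rewrite normrN; apply: le_trans (coord_le_norm _ _) _; apply: le_trans H1 _.
  apply: le_trans (ler_wpM2l _ H2) _; first exact: sqrtr_ge0.
  by rewrite mulrCA ler_piMr ?(ltW e0)// ler_pdivrMr// mul1r lerDl.
have cG : (fun s => quadf (frame_gram X (g s)) (A s)) s @[s --> F] --> quadf (frame_gram X (g s0)) (A s0).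
  apply: cvg_quadf => [i j|//].
  have := cvg_comp _ _ cg (frame_gram_continuous fX (i := i) (j := j) Vq).
  by move=> H Q /H; exact: toF.
have := cvg_comp _ _ cG (@sqrt_continuous R _).
have -> : Num.sqrt (quadf (frame_gram X (g s0)) (A s0)) = speed g s0.
  by rewrite /speed -(frame_metric fX _ Vq) -vE.
apply: cvg_trans; apply: near_eq_cvg.
apply: filterS2 inF nV => s hs Vs.
by rewrite /speed /= -(frame_metric fX _ Vs) -vE.
Qed.

End Speed.

(** * Coordinate bounds along horizontal curves *)

Section CoordinateBalls.
Context {R : realType} {n : nat} {N : subRiemannian R n}.
Local Notation E := (@hor R n N).
Implicit Types (g : R -> N) (y z : N).

Lemma linear_pack (h : 'rV[R]_n -> R) : (forall a u v, h (a *: u + v) = a * h u + h v) ->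
  exists psi : {linear 'rV[R]_n -> R}, psi =1 h.
Proof.
move=> lh; have lin : linear h by move=> a u v; rewrite lh.
pose C : {linear 'rV[R]_n -> R} := HB.pack h (GRing.isLinear.Build _ _ _ _ _ lin).
by exists C.
Qed.

Lemma compact_chart_ball (x : 'rV[R]_n) (r : R) : compact [set u : 'rV[R]_n | `|u - x| <= r].
Proof.
apply: bounded_closed_compact.
  exists (`|x| + r); split; first exact: num_real.
  move=> M MM u /= hu; rewrite -(subrK x u) addrC (le_trans (ler_normD _ _))//.
  by apply: ltW; apply: le_lt_trans MM; rewrite lerD2l.
rewrite (_ : [set u | _] = (fun u => `|u - x|) @^-1` [set y | y <= r]) //.
have cf : continuous (fun u : 'rV[R]_n => `|u - x|).
  by move=> u; exact: (cvg_norm (cvgB cvg_id (cvg_cst _))).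
by apply: preimage_closed => [u _|]; [exact: cf|exact: closed_le].
Qed.

Lemma chart_ball c p (Q : set N) : atlas c -> cdom c p -> nbhs p Q ->
  exists2 rho, 0 < rho & forall u, `|u - c p| <= rho -> (c @` cdom c) u /\ Q (cinv c u).
Proof.
move=> ac cp nQ; have [_ _ _ _ ci] := atlas_chart ac.
have cpd : (c @` cdom c) (c p) by exists p.
have H1 : nbhs (c p) (c @` cdom c) by apply: open_nbhs_nbhs; split=> //; exact: chart_open_cod (atlas_chart ac).
have H2 : nbhs (c p) (cinv c @^-1` Q) by apply: (ci _ cpd); rewrite chartK.
have H : \forall u \near c p, (c @` cdom c) u /\ Q (cinv c u) by exact: filterI H1 H2.
exact: nbhs_closed_ball.
Qed.

Variables (p : N) (c : chart R n N) (rho K : R).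
Hypotheses (ac : atlas c) (cp : cdom c p) (rho0 : 0 < rho) (K0 : 0 <= K).
Hypothesis ball_cod : forall u, `|u - c p| <= rho -> (c @` cdom c) u.

(* Along a horizontal curve in the ball, [psi] grows at most [k] times as fast as length. *)
Definition calibrated (psi : {linear 'rV[R]_n -> R}) (k : R) :=
  forall y, cdom c y -> `|c y - c p| <= rho -> forall v, v \in E y ->
    (psi (tvec c y v)) ^+ 2 <= k ^+ 2 * sr_metric y v v.

Lemma calibrated_segment psi k g (T l : R) : 0 <= k -> calibrated psi k -> horizontal g ->
  0 <= T <= 1 -> (arc_length g <= l%:E)%E ->
  (forall s, 0 <= s <= T -> cdom c (g s) /\ `|c (g s) - c p| <= rho) ->
  psi (c (g T) - c (g 0)) <= k * l.
Proof.
move=> k0 cal hg /andP[T0 T1] gl gball.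
have arc0 : (0 <= arc_length g)%E.
  by apply: integral_ge0 => s _; rewrite lee_fin sqrtr_ge0.
have l0 : 0 <= l by rewrite -lee_fin; exact: le_trans gl.
move: T0; rewrite le_eqVlt => /predU1P[<-|T0]; first by rewrite subrr linear0 mulr_ge0.
have s1 s : 0 <= s <= T -> 0 <= s <= 1 by move=> /andP[-> /le_trans]; apply.
pose h (s : R) : R := psi ((c \o g) s).
have dh s : 0 <= s <= T -> derivable h s 1 /\ derive1 h s = psi (derive1 (c \o g) s).
  move=> hs; have [cgs _] := gball s hs.
  have [_ /derivable1_diffP d1 _ _] := horizontal_C1 hg (s1 s hs) ac cgs.
  have cpsi := @linear_rV_continuous _ _ _ psi.
  have d2 : differentiable psi ((c \o g) s) by exact: linear_differentiable.
  have d3 : differentiable (psi \o (c \o g)) s by exact: differentiable_comp.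
  split; first exact/derivable1_diffP.
  rewrite (derive1E' d3) (derive1E' d1).
  apply: etrans (congr1 (fun h => h (1 : R)) (diff_comp d1 d2)) _.
  by rewrite /= diff_lin.
have main : ((h T - h 0)%:E <= k%:E * \int[lebesgue_measure]_(s in `[0%R, 1%R]) (speed g s)%:E)%E.
  apply: deriv_le_integral => //.
  - by rewrite T0.
  - by move=> s /dh[].
  - apply/subspace_continuousP => s0; rewrite /= in_itv /= => s0T.
    have [cgs _] := gball s0 s0T.
    have [_ _ cd _] := horizontal_C1 hg (s1 s0 s0T) ac cgs.
    have H := cvg_comp _ _ cd (@linear_rV_continuous _ _ _ psi _).
    have {}H : (psi \o derive1 (c \o g)) x @[x --> within `[0, T] (nbhs s0)] --> derive1 h s0.
      by rewrite (dh s0 s0T).2; apply: cvg_within_filter; exact: H.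
    apply: cvg_trans H; apply: near_eq_cvg; rewrite near_withinE.
    by apply: nearW => s; rewrite /= in_itv /= => /dh[_ hE]; exact: esym hE.
  - exact: speed_continuous.
  - by move=> s _; exact: sqrtr_ge0.
  - move=> s hs; rewrite (dh s hs).2; have [cgs bs] := gball s hs.
    have [_ _ _ <-] := horizontal_C1 hg (s1 s hs) ac cgs.
    have vE : velocity g s \in E (g s) by apply: hg.2; exact: s1.
    apply: le_trans (ler_norm _) _.
    rewrite -(ler_pXn2r (n := 2)) ?nnegrE ?mulr_ge0 ?sqrtr_ge0//.
    by rewrite exprMn sqr_sqrtr ?metric_ge0// real_normK ?num_real//; exact: cal.
rewrite linearB -/(h T) -/(h 0) -lee_fin; apply: le_trans main _.
by rewrite EFinM lee_wpmul2l// lee_fin.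
Qed.

Hypothesis cal_coord : forall psi : {linear 'rV[R]_n -> R},
  (forall w, `|psi w| <= `|w|) -> calibrated psi K.

Lemma coordinate_segment g (T l : R) : horizontal g ->
  0 <= T <= 1 -> (arc_length g <= l%:E)%E ->
  (forall s, 0 <= s <= T -> cdom c (g s) /\ `|c (g s) - c p| <= rho) ->
  `|c (g T) - c (g 0)| <= K * l.
Proof.
move=> hg T01 gl gball.
have l0 : 0 <= l.
  by rewrite -lee_fin; apply: le_trans gl; apply: integral_ge0 => s _; rewrite lee_fin sqrtr_ge0.
apply: norm_le_coord; first exact: mulr_ge0.
move=> j; rewrite ler_norml; apply/andP; split.
  have [|psi E1] := @linear_pack (fun w => - w 0 j).
    by move=> a u v; rewrite !mxE; ring.
  rewrite lerNl -E1; apply: calibrated_segment hg T01 gl gball => //.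
  by apply: cal_coord => w; rewrite E1 normrN coord_le_norm.
have [|psi E1] := @linear_pack (fun w => w 0 j).
  by move=> a u v; rewrite !mxE.
rewrite -E1; apply: calibrated_segment hg T01 gl gball => //.
by apply: cal_coord => w; rewrite E1 coord_le_norm.
Qed.

(** First exit argument. Coordinates mean nothing outside the chart, so continuity of [c \o g]
    cannot be invoked at the exit time [t]. Before [t] the arc lies in [D], the image of a smaller
    closed ball, which is compact and hence closed in the Hausdorff space [N]; so [g t] is still in
    [D], inside the ball. *)
Lemma arc_stays g (a l : R) : horizontal g -> (arc_length g <= l%:E)%E ->
  cdom c (g 0) -> `|c (g 0) - c p| <= a -> a + K * l < rho ->
  forall s, 0 <= s <= 1 -> cdom c (g s) /\ `|c (g s) - c p| <= rho.
Proof.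
move=> hg gl cg0 ga alr.
have l0 : 0 <= l.
  by rewrite -lee_fin; apply: le_trans gl; apply: integral_ge0 => s _; rewrite lee_fin sqrtr_ge0.
pose B := [set y | cdom c y /\ `|c y - c p| < rho].
have oB : open B.
  rewrite openE => y [cy yr]; apply: filterI.
    by apply: open_nbhs_nbhs; split=> //; exact: open_cdom.
  have cc := chart_cont (atlas_chart ac) cy.
  have cn : {for y, continuous (fun z => `|c z - c p|)}.
    by apply: cvg_norm; apply: cvgB => //; exact: cvg_cst.
  by have := cvgr_lt _ cn _ yr; apply; exact: nbhs_filter.
have gc s : 0 <= s <= 1 -> {for s, continuous g} by move=> hs; exact: (hg.1 s hs).1.
suff H s : 0 <= s <= 1 -> B (g s) by move=> s /H[? /ltW].
move=> s01; apply: contrapT => nB.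
pose S := [set s : R | 0 <= s <= 1 /\ ~ B (g s)].
have S0 : S !=set0 by exists s.
have Slb : lbound S 0 by move=> t [/andP[]].
have hS : has_inf S by split=> //; exists 0.
pose t := inf S.
have t0 : 0 <= t by exact: lb_le_inf.
have t1 : t <= 1 by apply: le_trans (ge_inf (ex_intro _ 0 Slb) (conj s01 nB)) _; case/andP: s01.
have before u : 0 <= u < t -> B (g u).
  move=> /andP[u0 ut]; apply: contrapT => nBu.
  have u01 : 0 <= u <= 1 by rewrite u0 (le_trans (ltW ut)).
  move: ut; rewrite ltNge => /negP; apply.
  exact: (ge_inf (ex_intro _ 0 Slb) (conj u01 nBu)).
have t01 : 0 <= t <= 1 by rewrite t0 t1.
have nBt : ~ B (g t).
  move=> Bt; have : nbhs t (g @^-1` B) by apply: gc => //; exact: open_nbhs_nbhs.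
  move=> /nbhs_normP[e /= e0 He].
  have [u Su ut] := inf_adherent e0 hS.
  have {}ut : u < t + e := ut.
  have tu : t <= u := ge_inf (ex_intro _ 0 Slb) Su.
  by apply: Su.2; apply: He; rewrite /= ltr_norml; clearbody t; apply/andP; split; lra.
have al : a < rho by apply: le_lt_trans alr; rewrite lerDl mulr_ge0.
have B0 : B (g 0) by split=> //; exact: le_lt_trans al.
have tp : 0 < t by rewrite lt0r t0 andbT; apply/eqP => te; apply: nBt; rewrite te.
(* The radius is what [coordinate_segment] guarantees before the exit, and it is less than [rho]. *)
pose D := cinv c @` [set u | `|u - c p| <= a + K * l].
have cD : closed D.
  apply: compact_closed; first exact: hausdorff_manifold.
  apply: continuous_compact; last exact: compact_chart_ball.
  apply/subspace_continuousP => u /= hu; apply: cvg_within_filter.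
  apply: (chart_inv_cont (atlas_chart ac)); apply: ball_cod.
  by apply: le_trans hu _; exact: ltW.
have Du u : 0 <= u < t -> D (g u).
  move=> /andP[u0 ut]; have Bu := before u; rewrite u0 ut in Bu.
  exists (c (g u)); last by apply: chartK => //; exact: (Bu isT).1.
  rewrite /= (_ : c (g u) - c p = (c (g u) - c (g 0)) + (c (g 0) - c p)); last first.
    by rewrite addrA subrK.
  rewrite (le_trans (ler_normD _ _))// addrC lerD//.
  apply: (coordinate_segment hg) => //; first by rewrite u0 (le_trans (ltW ut)).
  move=> v /andP[v0 vu]; have Bv : B (g v) by apply: before; rewrite v0 (le_lt_trans vu).
  by split; [exact: Bv.1|exact: ltW Bv.2].
have Dt : D (g t).
  apply: contrapT => nDt.
  have : nbhs t (g @^-1` (~` D)).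
    by apply: gc => //; apply: open_nbhs_nbhs; split=> //; exact: closed_openC.
  move=> /nbhs_normP[e /= e0 He].
  pose u := Num.max 0 (t - e / 2).
  have ut : 0 <= u < t by rewrite /u le_max lexx gt_max tp ltrBlDr ltrDl divr_gt0.
  apply: (He u) (Du u ut); rewrite /= ger0_norm ?subr_ge0; last by apply: ltW; case/andP: ut.
  rewrite ltrBlDr -ltrBlDl /u lt_max; apply/orP; right.
  by rewrite ltrD2l ltrN2 ltr_pdivrMr// mulr2n mulrDr mulr1 ltrDl.
apply: nBt; case: Dt => w /= hw <-.
have [y cy yE] : (c @` cdom c) w by apply: ball_cod; apply: le_trans hw _; exact: ltW.
by rewrite -yE chartK//; split=> //; rewrite yE; exact: le_lt_trans alr.
Qed.

End CoordinateBalls.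

Section JoinedBound.
Context {R : realType} {n : nat} {N : subRiemannian R n}.
Local Notation E := (@hor R n N).
Implicit Types (g : R -> N) (x y z : N).

Lemma arc_length_ge0 g : (0 <= arc_length g)%E.
Proof. by apply: integral_ge0 => s _; rewrite lee_fin sqrtr_ge0. Qed.

Lemma joined_ge0 x y l : joined x y l -> (0 <= l)%E.
Proof.
by elim=> // z l' g _ IH _ _; apply: adde_ge0 => //; exact: arc_length_ge0.
Qed.

Lemma joined_trans x y z l l' : joined x y l -> joined y z l' -> joined x z (l + l')%E.
Proof.
move=> xy; elim=> [|w l'' g yw IH hg gw]; first by rewrite adde0.
by rewrite addeA; exact: (joined_arc IH hg gw).
Qed.

Lemma cc_dist_ltP x y (a : R) : (cc_dist x y < a%:E)%E <-> exists2 l : R, l < a & joined x y l%:E.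
Proof.
split=> [/ereal_inf_lt[l xy]|[l la xy]].
  have := joined_ge0 xy; case: l xy => [l|//|//] xy _; rewrite lte_fin => la.
  by exists l.
by apply: le_lt_trans (_ : (_ <= l%:E)%E) _; [exact: ereal_inf_lbound|rewrite lte_fin].
Qed.

Lemma cc_dist_trans x y z (a b : R) : (cc_dist x y < a%:E)%E -> (cc_dist y z < b%:E)%E ->
  (cc_dist x z < (a + b)%:E)%E.
Proof.
move=> /cc_dist_ltP[l la xy] /cc_dist_ltP[l' lb yz]; apply/cc_dist_ltP.
exists (l + l'); first exact: ltrD.
by rewrite EFinD; exact: joined_trans yz.
Qed.

Lemma cc_dist_refl x (a : R) : 0 < a -> (cc_dist x x < a%:E)%E.
Proof. by move=> a0; apply/cc_dist_ltP; exists 0 => //; exact: joined_refl. Qed.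

Section Ball.
Variables (p : N) (c : chart R n N) (rho K : R).
Hypotheses (ac : atlas c) (cp : cdom c p) (rho0 : 0 < rho) (K0 : 0 <= K).
Hypothesis ball_cod : forall u, `|u - c p| <= rho -> (c @` cdom c) u.
Hypothesis cal_coord : forall psi : {linear 'rV[R]_n -> R},
  (forall w, `|psi w| <= `|w|) -> calibrated p c rho psi K.

(** The budget [l] is shared between the earlier arcs and the last one; the bound obtained on the
    former makes the last arc start well inside the ball. *)
Lemma joined_bound (psi : {linear 'rV[R]_n -> R}) (k : R) y z L : 0 <= k -> calibrated p c rho psi k ->
  joined y z L -> forall l a : R, (L <= l%:E)%E -> cdom c y -> `|c y - c p| <= a ->
  a + K * l < rho ->
  [/\ cdom c z, `|c z - c y| <= K * l & psi (c z - c y) <= k * l].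
Proof.
move=> k0 cal; elim=> [|w L' g yw IH hg gw] l a Ll cy ya alr.
  have l0 : 0 <= l by rewrite -lee_fin.
  by rewrite subrr normr0 linear0; split=> //; exact: mulr_ge0.
have L'0 := joined_ge0 yw; have g0 := arc_length_ge0 g.
have gfin : arc_length g \is a fin_num.
  rewrite ge0_fin_numE//; apply: le_lt_trans (ltry l); apply: le_trans Ll.
  by rewrite leeDr.
have L'fin : L' \is a fin_num.
  rewrite ge0_fin_numE//; apply: le_lt_trans (ltry l); apply: le_trans Ll.
  by rewrite leeDl.
pose l1 := fine L'; pose l2 := fine (arc_length g).
have e1 : L' = l1%:E by rewrite fineK.
have e2 : arc_length g = l2%:E by rewrite fineK.
have l10 : 0 <= l1 by rewrite -lee_fin -e1.
have l20 : 0 <= l2 by rewrite -lee_fin -e2.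
have ll : l1 + l2 <= l by rewrite -lee_fin EFinD -e1 -e2.
have Kll : K * l1 + K * l2 <= K * l by rewrite -mulrDr ler_wpM2l.
have Kl2 : 0 <= K * l2 by exact: mulr_ge0.
have [||cw wy psiw] := IH l1 a _ cy ya; [by rewrite e1|by lra|].
have cg0 : cdom c (g 0) by rewrite gw.
have ag0 : `|c (g 0) - c p| <= a + K * l1.
  rewrite gw (_ : c w - c p = (c w - c y) + (c y - c p)); last by rewrite addrA subrK.
  by rewrite (le_trans (ler_normD _ _))// addrC lerD.
have gl2 : (arc_length g <= l2%:E)%E by rewrite e2.
have ar2 : a + K * l1 + K * l2 < rho by lra.
have st := arc_stays ac K0 ball_cod cal_coord hg gl2 cg0 ag0 ar2.
have one : 0 <= (1 : R) <= 1 by rewrite ler01 lexx.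
have b1 := coordinate_segment ac K0 cal_coord hg one gl2 st.
have b2 := calibrated_segment ac k0 cal hg one gl2 st.
rewrite gw in b1 b2.
have dE : c (g 1) - c y = (c (g 1) - c w) + (c w - c y) by rewrite addrA subrK.
have kll : k * l1 + k * l2 <= k * l by rewrite -mulrDr ler_wpM2l.
split; first exact: (st 1 one).1.
  by rewrite dE (le_trans (ler_normD _ _))//; lra.
by rewrite dE linearD /=; lra.
Qed.

Lemma cc_dist_bound (psi : {linear 'rV[R]_n -> R}) (k : R) y z (l : R) :
  0 <= k -> calibrated p c rho psi k -> (cc_dist y z < l%:E)%E -> cdom c y ->
  `|c y - c p| + K * l < rho ->
  [/\ cdom c z, `|c z - c y| <= K * l & psi (c z - c y) <= k * l].
Proof.
move=> k0 cal /cc_dist_ltP[l' /ltW ll yz] cy H.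
by apply: (joined_bound k0 cal yz) (lexx _) H; rewrite ?lee_fin.
Qed.

End Ball.
End JoinedBound.

(** * Affine reparametrization and symmetry of the distance *)

Section Reparametrization.
Context {R : realType} {n : nat} {N : subRiemannian R n}.
Local Notation E := (@hor R n N).
Implicit Types (g : R -> N).

Definition affine (a b s : R) := a * s + b.

Lemma continuous_affine a b : continuous (affine a b).
Proof.
move=> s; apply: cvgD; last exact: cvg_cst.
by apply: cvgMl_tmp; exact: cvg_id.
Qed.

Lemma derive1_affine (V : normedModType R) (f : R -> V) (a b s : R) :
  derivable f (affine a b s) 1 ->
  derivable (f \o affine a b) s 1 /\ derive1 (f \o affine a b) s = a *: derive1 f (affine a b s).
Proof.
move=> /derivable1_diffP df.
have E1 : (fun t : R => f (t *: (a : R) + b)) = f \o affine a b.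
  by apply/funext => t; rewrite /affine /= mulrC.
have df' : differentiable f (s *: (a : R) + b) by rewrite /GRing.scale /= mulrC.
have := is_derive_line df'; rewrite E1 => -[d1 d2]; split=> //.
rewrite derive1E d2 (derive1E' df) /affine mulrC.
have -> : 'd f (s *: (a : R) + b) a = a *: 'd f (s *: (a : R) + b) 1.
  by rewrite -[in RHS]linearZ /GRing.scale /= mulr1.
by [].
Qed.

Lemma velocity_affine g a b s : derivable (chart_at (g (affine a b s)) \o g) (affine a b s) 1 ->
  velocity (g \o affine a b) s = a *: velocity g (affine a b s).
Proof. by move=> /derive1_affine[_]. Qed.

Definition C1_at g (s : R) := {for s, continuous g} /\
  forall c, atlas c -> cdom c (g s) ->
    (\forall u \near s, derivable (c \o g) u 1) /\ {for s, continuous (derive1 (c \o g))}.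

Lemma C1_affine_chart (V : normedModType R) (f : R -> V) (a b s : R) :
  (\forall u \near affine a b s, derivable f u 1) ->
  {for affine a b s, continuous (derive1 f)} ->
  (\forall u \near s, derivable (f \o affine a b) u 1) /\
  {for s, continuous (derive1 (f \o affine a b))}.
Proof.
move=> df cdf; have ca : affine a b x @[x --> s] --> affine a b s by exact: continuous_affine.
have nd := ca _ df.
split; first by apply: (@filterS _ (nbhs s) _ _ _ _ nd) => t dt; exact: (derive1_affine dt).1.
have e : derive1 (f \o affine a b) s = a *: derive1 f (affine a b s).
  exact: (derive1_affine (nbhs_singleton df)).2.
rewrite /prop_for /continuous_at e.
have C : (fun t => a *: derive1 f (affine a b t)) t @[t --> s] --> a *: derive1 f (affine a b s).
  exact: (cvgZl_tmp (cvg_comp _ _ ca cdf)).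
apply: cvg_trans C; apply: near_eq_cvg; apply: (@filterS _ (nbhs s) _ _ _ _ nd) => t dt.
exact: esym (derive1_affine dt).2.
Qed.

Lemma C1_affine g a b s : C1_at g (affine a b s) -> C1_at (g \o affine a b) s.
Proof.
move=> [cg H]; split; first by apply: continuous_comp => //; exact: continuous_affine.
move=> c ac cgs; have [d1 d2] := H c ac cgs.
exact: (C1_affine_chart d1 d2).
Qed.

(** Serves to run an arc backwards and to keep only an initial piece of it. *)
Lemma horizontal_affine g a b : (forall s, 0 <= s <= 1 -> 0 <= affine a b s <= 1) ->
  horizontal g -> horizontal (g \o affine a b) /\
  forall s, 0 <= s <= 1 -> speed (g \o affine a b) s = `|a| * speed g (affine a b s).
Proof.
move=> ab hg.
have vel s : 0 <= s <= 1 -> velocity (g \o affine a b) s = a *: velocity g (affine a b s).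
  move=> hs; apply: velocity_affine.
  by have [_ ? _ _] := horizontal_C1 hg (ab s hs) (chart_at_atlas _) (chart_at_dom _).
have velE s : 0 <= s <= 1 -> velocity g (affine a b s) \in E (g (affine a b s)).
  by move=> hs; apply: hg.2; exact: ab.
split.
  split=> s hs; first by apply: C1_affine; apply: hg.1; exact: ab.
  by rewrite vel// memvZ// velE.
move=> s hs; rewrite /speed vel// sr_metricZ; last exact: velE.
by rewrite sqrtrM ?sqr_ge0// sqrtr_sqr.
Qed.

Lemma arc_lengthE g :
  arc_length g = (\int[lebesgue_measure]_(s in `[0%R, 1%R]) (speed g s)%:E)%E.
Proof. by []. Qed.

Lemma arc_length_rev g : horizontal g ->
  horizontal (g \o affine (-1) 1) /\ arc_length (g \o affine (-1) 1) = arc_length g.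
Proof.
move=> hg.
have [|hr sr] := @horizontal_affine g (-1) 1 _ hg.
  by move=> s /andP[s0 s1]; rewrite /affine; apply/andP; split; lra.
split; first exact: hr.
rewrite !arc_lengthE.
have one : 0 <= (1 : R) <= 1 by rewrite ler01 lexx.
apply: etrans _ (esym (integration_by_substitution_onem one (speed_continuous hg))).
rewrite onem1.
apply: eq_integral => s; rewrite inE /= in_itv /= => hs.
rewrite sr// normrN normr1 mul1r; congr ((speed g _)%:E).
by rewrite /affine /onem mulN1r addrC.
Qed.

Lemma joined_sym (x y : N) l : joined x y l -> joined y x l.
Proof.
elim=> [|z l' g _ IH hg gz]; first exact: joined_refl.
have [hr rE] := arc_length_rev hg.
rewrite addeC; apply: joined_trans IH; rewrite -rE -[arc_length _]add0e.
have -> : z = (g \o affine (-1) 1) 1 by rewrite /= /affine mulr1 addNr gz.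
apply: joined_arc hr _; first exact: joined_refl.
by rewrite /= /affine mulr0 add0r.
Qed.

Lemma cc_dist_sym (x y : N) : cc_dist x y = cc_dist y x.
Proof.
by rewrite /cc_dist; congr ereal_inf; apply/seteqP; split=> l; exact: joined_sym.
Qed.

End Reparametrization.

(** * Estimates of the distance near a point *)

Section LocalEstimates.
Context {R : realType} {n : nat} {N : subRiemannian R n}.
Local Notation E := (@hor R n N).
Variable p : N.
Local Notation c := (chart_at p).

Lemma calibrated_sub rho rho' (psi : {linear 'rV[R]_n -> R}) k : rho' <= rho ->
  calibrated p c rho psi k -> calibrated p c rho' psi k.
Proof. by move=> rr cal y cy yr; apply: cal => //; exact: le_trans rr. Qed.

Lemma near_calibrated (psi : {linear 'rV[R]_n -> R}) k :
  (\forall y \near p, forall v, v \in E y -> (psi (tvec c y v)) ^+ 2 <= k ^+ 2 * sr_metric y v v) ->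
  exists2 rho, 0 < rho & calibrated p c rho psi k.
Proof.
move=> nQ; have [rho rho0 H] := chart_ball (chart_at_atlas p) (chart_at_dom p) nQ.
exists rho => // y cy yr v vE; have [_] := H _ yr.
by rewrite chartK; [apply|exact: chart_at_atlas|].
Qed.

Lemma calibrated_exists (psi : {linear 'rV[R]_n -> R}) k :
  (forall v, v \in E p -> v != 0 -> (psi v) ^+ 2 < k ^+ 2 * sr_metric p v v) ->
  exists2 rho, 0 < rho & calibrated p c rho psi k.
Proof.
move=> H; have [V [d [X [Vp fX]]]] := frame_exists p.
apply: near_calibrated => //.
have H' : forall v, v \in E p -> v != 0 -> (psi (tvec c p v)) ^+ 2 < k ^+ 2 * sr_metric p v v.
  by move=> v vE v0; rewrite tvec_chart_at; exact: H.
by apply: filterS (metric_compare fX Vp (chart_at_atlas p) (chart_at_dom p) H') => y [].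
Qed.

Lemma norm_le_metric : exists2 K, 0 < K & forall v, v \in E p -> `|v| ^+ 2 <= K * sr_metric p v v.
Proof.
have [K HK] := @B_bound R n (fun=> E p) (sr_metric p) (@sr_metric_lin _ _ N p)
  (@sr_metric_sym _ _ N p) (@sr_metric_pos _ _ N p).
exists (Num.max K 0 + 1); first by rewrite ltr_wpDl// le_max lexx orbT.
move=> v vE; apply: le_trans (HK v vE) _; apply: ler_wpM2r; first exact: metric_ge0.
by rewrite -[leLHS]addr0 lerD// le_max lexx.
Qed.

(** The radius has to be uniform over all functionals of norm at most 1. It is the minimum of the
    radii of the finitely many coordinate functionals, which together bound the sup norm of a
    tangent vector. *)
Lemma coordinate_calibrated : exists rho K, [/\ 0 < rho, 0 < K &
  forall psi : {linear 'rV[R]_n -> R}, (forall w, `|psi w| <= `|w|) -> calibrated p c rho psi K].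
Proof.
(* Since [K >= 1], [K ^+ 2 >= K > K0], the strict inequality asked by [calibrated_exists]. *)
have [K0 K00 HK0] := norm_le_metric; pose K := K0 + 1.
have K1 : 1 <= K by rewrite lerDr ltW.
have Kp : 0 < K by exact: lt_le_trans K1.
have cal j : exists2 rho, 0 < rho & forall psi : {linear 'rV[R]_n -> R},
    psi =1 (fun w => w 0 j) -> calibrated p c rho psi K.
  have [|psi E1] := @linear_pack R n (fun w => w 0 j); first by move=> a u v; rewrite !mxE.
  have [v vE v0|rho rho0 H] := @calibrated_exists psi K.
    rewrite E1; apply: (@le_lt_trans _ _ (K0 * sr_metric p v v)).
      apply: le_trans (HK0 v vE); rewrite -real_normK ?num_real// ler_pXn2r ?nnegrE//.
      exact: coord_le_norm.
    rewrite ltr_pM2r; last exact: sr_metric_pos.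
    by apply: (@lt_le_trans _ _ K); rewrite ?ltrDl// expr2 ler_peMr// ltW.
  exists rho => // psi' E2 y cy yr v vE; have := H y cy yr v vE.
  by rewrite E1 E2.
pose r j := sval (cid2 (cal j)).
have rP j : 0 < r j /\ forall psi : {linear 'rV[R]_n -> R},
    psi =1 (fun w => w 0 j) -> calibrated p c (r j) psi K.
  by rewrite /r; case: cid2.
pose rho := \big[Num.min/1]_j r j.
have rho_le j : rho <= r j by exact: bigmin_le_cond.
exists rho, K; split=> //.
  by apply: lt_bigmin => // j _; exact: (rP j).1.
move=> psi Hpsi y cy yr v vE.
have mE := metric_ge0 vE.
have : `|tvec c y v| <= K * Num.sqrt (sr_metric y v v).
  apply: norm_le_coord; first by rewrite mulr_ge0 ?sqrtr_ge0 ?(ltW Kp).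
  move=> j; have [|phi E1] := @linear_pack R n (fun w => w 0 j); first by move=> a u w; rewrite !mxE.
  have := (rP j).2 phi E1 y cy (le_trans yr (rho_le j)) v vE.
  rewrite E1 => H; rewrite -(ler_pXn2r (n := 2)) ?nnegrE ?mulr_ge0 ?sqrtr_ge0 ?(ltW Kp)//.
  by rewrite exprMn sqr_sqrtr// real_normK ?num_real.
move=> H; rewrite -[leLHS]real_normK ?num_real//.
rewrite -[X in _ <= _ * X]sqr_sqrtr// -exprMn ler_pXn2r ?nnegrE ?mulr_ge0 ?sqrtr_ge0 ?(ltW Kp)//.
exact: le_trans (Hpsi _) H.
Qed.

(* In such a ball coordinates move at most [K] times as fast as length. *)
Definition coordinate_ball (rho K : R) := [/\ 0 < rho, 0 < K,
  forall u, `|u - c p| <= rho -> (c @` cdom c) u &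
  forall psi : {linear 'rV[R]_n -> R}, (forall w, `|psi w| <= `|w|) -> calibrated p c rho psi K].

Lemma coordinate_ball_exists : exists rho K, coordinate_ball rho K.
Proof.
have [rho [K [rho0 K0 cal]]] := coordinate_calibrated.
have [rho' rho'0 H] := @chart_ball _ _ _ c p setT (chart_at_atlas p) (chart_at_dom p) filterT.
exists (Num.min rho rho'), K; split=> //.
- by rewrite lt_min rho0.
- by move=> u; rewrite le_min => /andP[_ /H[]].
- move=> psi Hpsi; apply: calibrated_sub (cal _ Hpsi).
  by rewrite ge_min lexx.
Qed.

Lemma coordinate_ball_sub rho rho' K : 0 < rho' <= rho -> coordinate_ball rho K -> coordinate_ball rho' K.
Proof.
move=> /andP[r0 rr] [h1 h2 h3 h4]; split=> //.
- by move=> u /le_trans /(_ rr); exact: h3.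
- by move=> psi /h4; exact: calibrated_sub.
Qed.

(** A dummy argument for [cc_dist_bound] when only the coordinate bound is wanted. *)
Lemma zero_calibrated rho : exists psi : {linear 'rV[R]_n -> R}, calibrated p c rho psi 0.
Proof.
have [|psi E1] := @linear_pack R n (fun=> 0); first by move=> *; rewrite mulr0 addr0.
by exists psi => y cy yr v vE; rewrite E1 expr0n mul0r.
Qed.

Lemma cc_dist_coordinate rho K y z l : coordinate_ball rho K -> (cc_dist y z < l%:E)%E ->
  cdom c y -> `|c y - c p| + K * l < rho -> cdom c z /\ `|c z - c y| <= K * l.
Proof.
move=> [rho0 K0 cod cal] yz cy H; have [psi psi0] := zero_calibrated rho.
by have [] := cc_dist_bound (chart_at_atlas p) (ltW K0) cod cal (lexx 0) psi0 yz cy H.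
Qed.

Lemma cc_dist_functional (psi : {linear 'rV[R]_n -> R}) (k : R) : 0 <= k ->
  (forall v, v \in E p -> v != 0 -> (psi v) ^+ 2 < k ^+ 2 * sr_metric p v v) ->
  exists2 delta, 0 < delta & forall z l, (cc_dist p z < l%:E)%E -> l < delta ->
    psi (c z - c p) <= k * l.
Proof.
move=> k0 H; have [r1 r10 cal1] := calibrated_exists H.
have [r2 [K B2]] := coordinate_ball_exists; have [r20 K0 _ _] := B2.
pose rho := Num.min r1 r2; have rho0 : 0 < rho by rewrite lt_min r10.
have B : coordinate_ball rho K.
  by apply: coordinate_ball_sub B2; rewrite rho0 ge_min lexx orbT.
have cal : calibrated p c rho psi k by apply: calibrated_sub cal1; rewrite ge_min lexx.
exists (rho / K); first exact: divr_gt0.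
move=> z l pz lr; have [_ _ cod calc] := B.
have H1 : `|c p - c p| + K * l < rho by rewrite subrr normr0 add0r mulrC -ltr_pdivlMr.
by have [] := cc_dist_bound (chart_at_atlas p) (ltW K0) cod calc k0 cal pz (chart_at_dom p) H1.
Qed.

(** [carnot_derivative] speaks of compact sets; applied to the cone, this puts a small ball of it
    inside one. *)
Lemma cc_ball_compact : exists2 delta, 0 < delta &
  exists2 D : set N, compact D & forall z, (cc_dist p z < delta%:E)%E -> D z.
Proof.
have [rho [K B]] := coordinate_ball_exists; have [rho0 K0 cod _] := B.
exists (rho / 2 / K); first by rewrite !divr_gt0.
exists (cinv c @` [set u | `|u - c p| <= rho / 2]).
  apply: continuous_compact; last exact: compact_chart_ball.
  apply/subspace_continuousP => u /= hu; apply: cvg_within_filter.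
  apply: (chart_inv_cont (atlas_chart (chart_at_atlas p))); apply: cod.
  by apply: le_trans hu _; rewrite ler_pdivrMr// ler_peMr ?ler1n// ltW.
move=> z pz.
have KE : K * (rho / 2 / K) = rho / 2 by rewrite mulrC divfK// gt_eqF.
have H1 : `|c p - c p| + K * (rho / 2 / K) < rho.
  by rewrite subrr normr0 add0r KE ltr_pdivrMr// ltr_pMr// ltr1n.
have [cz zE] := cc_dist_coordinate B pz (chart_at_dom p) H1.
by exists (c z); [rewrite /= -KE|rewrite chartK//; exact: chart_at_atlas].
Qed.

End LocalEstimates.

(** * Horizontal curves with prescribed initial velocity *)

Section Picard.
Context {R : realType}.
Notation mu := (@lebesgue_measure R).

(** The radius [2 * A * 2^-1 ^+ k] is the sum of the remaining increments, so the intervals around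
    the [a k] are nested; the limit is the supremum of their lower ends. *)
Lemma geometric_limit (a : nat -> R) (A : R) : (forall k, `|a k.+1 - a k| <= A * 2^-1 ^+ k) ->
  exists l, forall k, `|a k - l| <= 2 * A * 2^-1 ^+ k.
Proof.
move=> H; pose lo k := a k - 2 * A * 2^-1 ^+ k; pose up k := a k + 2 * A * 2^-1 ^+ k.
have step k : lo k <= lo k.+1 /\ up k.+1 <= up k.
  have := H k; rewrite /lo /up ler_norml exprS; set q := 2^-1 ^+ k.
  by move=> /andP[h1 h2]; split; lra.
have A0 : 0 <= A by have := H 0%N; rewrite expr0 mulr1; exact: le_trans.
have lomono j k : (j <= k)%N -> lo j <= lo k.
  by move=> /subnK <-; elim: (k - j)%N => [|m IH] //=; rewrite addSn (le_trans IH)// (step _).1.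
have upmono j k : (j <= k)%N -> up k <= up j.
  by move=> /subnK <-; elim: (k - j)%N => [|m IH] //=; rewrite addSn (le_trans _ IH)// (step _).2.
have loup j k : lo j <= up k.
  apply: le_trans (lomono _ _ (leq_maxl j k)) _; apply: le_trans (upmono _ _ (leq_maxr j k)).
  have : 0 <= 2 * A * 2^-1 ^+ (maxn j k) by rewrite mulr_ge0 ?exprn_ge0 ?invr_ge0 ?mulr_ge0.
  by rewrite /lo /up => ?; lra.
pose S := [set lo k | k in [set: nat]].
have hS : has_sup S.
  by split; [exists (lo 0%N); exists 0%N|exists (up 0%N) => _ [k _ <-]].
exists (sup S) => k.
have h1 : lo k <= sup S by apply: ub_le_sup; [exact: hS.2|exists k].
have h2 : sup S <= up k by apply: ge_sup; [exact: hS.1|move=> _ [j _ <-]].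
by rewrite ler_norml; move: h1 h2; rewrite /lo /up => ? ?; apply/andP; split; lra.
Qed.

Lemma continuous_integrable (f : R -> R) (a b : R) : continuous f ->
  mu.-integrable `[a, b] (EFin \o f).
Proof.
move=> cf; apply: continuous_compact_integrable; first exact: segment_compact.
exact: continuous_subspaceT.
Qed.

(** The factor 3 is the length of [-1, 2]. *)
Lemma Rintegral_close (f g : R -> R) (s D : R) : continuous f -> continuous g -> 0 <= s <= 2 ->
  (forall t, `|f t - g t| <= D) ->
  `|\int[mu]_(t in `[-1, s]) f t - \int[mu]_(t in `[-1, s]) g t| <= 3 * D.
Proof.
move=> cf cg /andP[s0 s2] H.
have D0 : 0 <= D by exact: le_trans (H 0).
have cfg : continuous (fun t => f t - g t) by move=> t; apply: cvgB; [exact: cf|exact: cg].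
have cn : continuous (fun t => `|f t - g t|) by move=> t; apply: cvg_norm; exact: cfg.
rewrite -RintegralB//; [|exact: continuous_integrable|exact: continuous_integrable].
apply: le_trans (le_normr_Rintegral _ _) _ => //; first exact: continuous_integrable.
apply: (@le_trans _ _ (\int[mu]_(t in `[-1, s]) (cst D) t)).
  by apply: le_Rintegral => //; [exact: continuous_integrable|apply: continuous_integrable => t; exact: cvg_cst].
rewrite Rintegral_cst//= lebesgue_measure_itv /= lte_fin.
have -> : -1 < s by lra.
by rewrite mulrC ler_wpM2r//= opprK; lra.
Qed.

Lemma primitive_derive (f : R -> R) (s : R) : continuous f -> -1 < s ->
  derivable (fun s : R => \int[mu]_(t in `[-1, s]) f t) s 1 /\
  derive1 (fun s : R => \int[mu]_(t in `[-1, s]) f t) s = f s.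
Proof.
move=> cf s1; apply: (@continuous_FTC1_closed _ f (-1) s (s + 1)) => //.
- by rewrite ltrDl.
- exact: continuous_integrable.
- exact: cf.
Qed.

Definition clamp (a b t : R) := Num.min (Num.max t a) b.

Lemma clamp_lip (a b s t : R) : `|clamp a b s - clamp a b t| <= `|s - t|.
Proof.
have h1 := ler_norm (s - t); have h2 : t - s <= `|s - t| by rewrite distrC; exact: ler_norm.
rewrite /clamp /Order.min /Order.max ler_norml; move: `|s - t| h1 h2 => D h1 h2.
have [?|?] := ltP s a; have [?|?] := ltP t a; repeat
  match goal with |- context [if ?b then _ else _] => have [?|?] := boolP b end;
  apply/andP; split; lra.
Qed.

Lemma continuous_clamp a b : continuous (clamp a b).
Proof.
move=> s; apply/cvgrPdist_le => e e0.
have /cvgrPdist_le/(_ _ e0) : t @[t --> s] --> s by exact: cvg_id.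
by apply: filterS => t; apply: le_trans; exact: clamp_lip.
Qed.

Lemma clamp_id a b t : a <= t <= b -> clamp a b t = t.
Proof. by move=> /andP[h1 h2]; rewrite /clamp max_l// min_l. Qed.

Lemma clamp_bounds a b t : a <= b -> a <= clamp a b t <= b.
Proof. by move=> ab; rewrite /clamp le_min ge_min lexx orbT le_max lexx orbT ab. Qed.

Context {n : nat}.
Local Notation V := 'rV[R]_n.

(* Composing with [vclamp] makes a locally Lipschitz vector field globally Lipschitz. *)
Definition vclamp (y0 : V) (rho : R) (x : V) : V :=
  \row_i clamp (y0 0 i - rho) (y0 0 i + rho) (x 0 i).

Lemma vclamp_lip y0 rho x y : `|vclamp y0 rho x - vclamp y0 rho y| <= `|x - y|.
Proof.
apply: norm_le_coord => // j; rewrite !mxE; apply: le_trans (clamp_lip _ _ _ _) _.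
by have := coord_le_norm (x - y) j; rewrite !mxE.
Qed.

Lemma vclamp_ball y0 rho x : 0 <= rho -> `|vclamp y0 rho x - y0| <= rho.
Proof.
move=> r0; apply: norm_le_coord => // j; rewrite !mxE ler_distl.
by apply: clamp_bounds; lra.
Qed.

Lemma vclamp_id y0 rho x : `|x - y0| <= rho -> vclamp y0 rho x = x.
Proof.
move=> xr; apply/rowP => j; rewrite mxE clamp_id// -ler_distl.
by have := coord_le_norm (x - y0) j; rewrite !mxE => /le_trans; apply.
Qed.

Definition vprimitive (f : R -> V) (s : R) : V := \row_i \int[mu]_(t in `[-1, s]) f t 0 i.

Lemma continuous_entry (f : R -> V) (i : 'I_n) : continuous f -> continuous (fun t => f t 0 i).
Proof. by move=> cf t; exact: (cvg_comp _ _ (cf t) (@coord_continuous _ _ _ _ _ _)). Qed.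

Lemma vprimitive_derive (f : R -> V) (s : R) : continuous f -> -1 < s ->
  derivable (vprimitive f) s 1 /\ derive1 (vprimitive f) s = f s.
Proof.
move=> cf s1; have cfi i := continuous_entry (i := i) cf.
have d i := primitive_derive (cfi i) s1.
have E1 i : (fun t => vprimitive f t 0 i) = (fun s : R => \int[mu]_(t in `[-1, s]) f t 0 i).
  by apply/funext => t; rewrite mxE.
have dv : derivable (vprimitive f) s 1.
  apply/derivable_mxP => i j; rewrite (ord1 i) E1; exact: (d j).1.
split=> //; rewrite derive1E derive_mx//; apply/rowP => j; rewrite mxE E1 -derive1E.
exact: (d j).2.
Qed.

Lemma vprimitive_close (f g : R -> V) s D : continuous f -> continuous g -> 0 <= s <= 2 ->
  (forall t, `|f t - g t| <= D) -> `|vprimitive f s - vprimitive g s| <= 3 * D.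
Proof.
move=> cf cg hs H; have D0 : 0 <= D by exact: le_trans (H 0).
apply: norm_le_coord; first by rewrite mulr_ge0.
move=> j; rewrite !mxE; apply: Rintegral_close => //.
- exact: continuous_entry.
- exact: continuous_entry.
- by move=> t; have := coord_le_norm (f t - g t) j; rewrite !mxE => /le_trans; apply.
Qed.

Lemma uniform_limit_continuous (x : nat -> R -> V) (y : R -> V) (A : R) :
  (forall k, continuous (x k)) -> (forall k s, `|x k s - y s| <= A * 2^-1 ^+ k) -> continuous y.
Proof.
move=> cx H s; apply/cvgrPdist_le => e e0.
have A0 : 0 <= A by have := H 0%N 0; rewrite expr0 mulr1; exact: le_trans.
have [k Hk] : exists k, A * 2^-1 ^+ k <= e / 4.
  have h1 : `|2^-1 : R| < 1 by rewrite ger0_norm ?invr_ge0// invf_lt1// ltr1n.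
  have := cvg_geometric A h1; rewrite /geometric /= => /cvgrPdist_le /(_ (e / 4)).
  move=> /(_ ltac:(by rewrite divr_gt0)) [k _ /(_ k (leqnn k))]; rewrite sub0r normrN => Hk.
  by exists k; apply: le_trans Hk; exact: ler_norm.
have e2 : 0 < e / 2 by rewrite divr_gt0.
have /cvgrPdist_le/(_ _ e2) := cx k s; apply: filterS => t Ht.
have -> : y s - y t = (y s - x k s) + (x k s - x k t) + (x k t - y t).
  by rewrite !addrA !subrK.
have h1 := H k s; have h2 := H k t; rewrite distrC in h1.
rewrite (le_trans (ler_normD _ _))// (le_trans (lerD (ler_normD _ _) (lexx _)))//.
by lra.
Qed.

Section Solution.
Variables (G : V -> V) (y0 : V) (L d : R).
Hypotheses (L0 : 0 <= L) (lipG : forall x y, `|G x - G y| <= L * `|x - y|)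
  (d0 : 0 <= d) (dL : d * L * 6 <= 1).

(* The primitive [vprimitive] starts at -1, so that solutions are differentiable at 0 from
   both sides; the curves being constant on [-1, 0] thanks to [clamp], it takes the value
   [G y0] at 0, which accounts for the correction [- d *: G y0]. *)
Definition picard (x : R -> V) (s : R) : V :=
  y0 - d *: G y0 + d *: vprimitive (G \o x) (clamp 0 2 s).

Lemma continuous_lip (x : R -> V) : continuous x -> continuous (G \o x).
Proof.
move=> cx s; apply/cvgrPdist_le => e e0.
have L1 : 0 < L + 1 by rewrite ltr_wpDl.
have eL : 0 < e / (L + 1) by rewrite divr_gt0.
have /cvgrPdist_le/(_ _ eL) := cx s; apply: filterS => t Ht.
apply: le_trans (lipG _ _) _; apply: le_trans (ler_wpM2l L0 Ht) _.
by rewrite mulrCA ler_piMr ?(ltW e0)// ler_pdivrMr// mul1r lerDl.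
Qed.

Lemma continuous_picard x : continuous x -> continuous (picard x).
Proof.
move=> cx s; apply: cvgD; first exact: cvg_cst.
apply: cvgZl_tmp; apply: (@continuous_comp _ _ _ (clamp 0 2) (vprimitive (G \o x))).
  exact: continuous_clamp.
have /andP[h0 _] : 0 <= clamp 0 2 s <= 2 by exact: clamp_bounds.
have h1 : -1 < clamp 0 2 s by lra.
have [/derivable1_diffP + _] := vprimitive_derive (continuous_lip cx) h1.
exact: differentiable_continuous.
Qed.

(** The integration interval has length at most 3, so the contraction factor is [d * 3 * L]; the 6
    in [dL] makes it at most 1/2. *)
Lemma picard_close x y D : continuous x -> continuous y -> (forall s, `|x s - y s| <= D) ->
  forall s, `|picard x s - picard y s| <= D / 2.
Proof.
move=> cx cy H s; rewrite /picard opprD addrACA subrr add0r -scalerBr normrZ ger0_norm//.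
have D0 : 0 <= D by exact: le_trans (H 0).
have := @vprimitive_close (G \o x) (G \o y) (clamp 0 2 s) (L * D) (continuous_lip cx) (continuous_lip cy).
move=> /(_ ltac:(exact: clamp_bounds)) /(_ ltac:(move=> t; apply: le_trans (lipG _ _) _; exact: ler_wpM2l)).
move=> h; apply: le_trans (ler_wpM2l d0 h) _.
have -> : d * (3 * (L * D)) = (d * L * 6) * (D / 2) by field.
by rewrite ler_piMl// divr_ge0.
Qed.

Lemma picard_fixpoint : exists2 x : R -> V, continuous x & forall s, x s = picard x s.
Proof.
pose X := fix X k := if k is k'.+1 then picard (X k') else (fun=> y0).
have cX k : continuous (X k).
  by elim: k => [|k IH]; [move=> s; exact: cvg_cst|exact: continuous_picard].
have [A HA] : exists A, forall s, `|X 1%N s - X 0%N s| <= A.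
  pose D := `|G y0|; exists (d * D + d * (3 * D)) => s.
  have -> : X 1%N s - X 0%N s = - (d *: G y0) + d *: vprimitive (fun=> G y0) (clamp 0 2 s).
      by rewrite /= /picard addrAC (addrAC y0) subrr add0r.
  rewrite (le_trans (ler_normD _ _))// normrN !normrZ ger0_norm// lerD// ler_wpM2l//.
  have z0 : vprimitive (fun=> 0) (clamp 0 2 s) = 0.
    apply/rowP => j; rewrite !mxE.
    rewrite (_ : \int[mu]_(t in _) _ = \int[mu]_(t in `[-1, clamp 0 2 s]) (cst 0 t)).
      by rewrite Rintegral_cst// mul0r.
    by apply: eq_Rintegral => t _; rewrite /= ?mxE.
  rewrite -[X in `|X|]subr0 -[X in _ - X]z0; apply: vprimitive_close.
  - by move=> t; exact: cvg_cst.
  - by move=> t; exact: cvg_cst.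
  - exact: clamp_bounds.
  - by move=> t; rewrite subr0.
have step k s : `|X k.+1 s - X k s| <= A * 2^-1 ^+ k.
  elim: k s => [|k IH] s; first by rewrite expr0 mulr1.
  have := @picard_close (X k.+1) (X k) _ (cX _) (cX _) IH s.
  by rewrite exprSr mulrA.
have lim s : exists l : V, forall k, `|X k s - l| <= 2 * A * 2^-1 ^+ k.
  have H j : exists l, forall k, `|X k s 0 j - l| <= 2 * A * 2^-1 ^+ k.
    apply: geometric_limit => k; apply: le_trans (step k s).
    by have := coord_le_norm (X k.+1 s - X k s) j; rewrite !mxE.
  exists (\row_j sval (cid (H j))) => k; apply: norm_le_coord.
    have A0 : 0 <= A by exact: le_trans (HA 0).
    by rewrite mulr_ge0 ?exprn_ge0 ?invr_ge0 ?mulr_ge0.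
  by move=> j; rewrite !mxE; case: cid.
pose x s := sval (cid (lim s)).
have Hx k s : `|X k s - x s| <= 2 * A * 2^-1 ^+ k by rewrite /x; case: cid.
have cx : continuous x by exact: uniform_limit_continuous cX Hx.
exists x => // s; apply/eqP; rewrite -subr_eq0 -normr_le0.
apply: (@le_trans _ _ (0 * 1)); last by rewrite mul0r.
have A0 : 0 <= A by exact: le_trans (HA 0).
rewrite mul0r; apply/ler_addgt0Pl => e e0; rewrite addr0.
have h1 : `|2^-1 : R| < 1 by rewrite ger0_norm ?invr_ge0// invf_lt1// ltr1n.
have := cvg_geometric (2 * A) h1; rewrite /geometric /= => /cvgrPdist_le /(_ (e / 2)).
move=> /(_ ltac:(by rewrite divr_gt0)) [k _ /(_ k (leqnn k))]; rewrite sub0r normrN => Hk.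
have {}Hk := le_trans (ler_norm _) Hk.
have -> : x s - picard x s = (x s - X k.+1 s) + (picard (X k) s - picard x s).
  by rewrite /= addrA subrK.
have h2 : `|x s - X k.+1 s| <= 2 * A * 2^-1 ^+ k / 2 by rewrite distrC -mulrA -exprSr; exact: Hx.
have h3 := picard_close (cX k) cx (Hx k) s.
apply: le_trans (ler_normD _ _) _; apply: le_trans (lerD h2 h3) _.
by rewrite -splitr; apply: le_trans Hk _; rewrite ler_pdivrMr// ler_peMr ?ler1n// ltW.
Qed.

(** [x] is the fixed point, continuous on the whole line but constant outside [0, 2] because time is
    clamped. [y] is the same primitive without clamping: it agrees with [x] on [0, 2] and is
    differentiable beyond both ends of [0, 1]. *)
Lemma ode_solution : exists (x y : R -> V), [/\ continuous x, y 0 = y0,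
  forall s, 0 <= s <= 2 -> y s = x s &
  forall s, -1 < s -> derivable y s 1 /\ derive1 y s = d *: G (x s)].
Proof.
have [x cx xE] := picard_fixpoint.
pose y s := y0 - d *: G y0 + d *: vprimitive (G \o x) s.
have dy s : -1 < s -> derivable y s 1 /\ derive1 y s = d *: G (x s).
  move=> s1; have [dp pE] := vprimitive_derive (continuous_lip cx) s1.
  have dZ : derivable (d *: vprimitive (G \o x)) s 1 by exact: derivableZ.
  have dC : derivable (cst (y0 - d *: G y0)) s (1 : R) by exact: derivable_cst.
  have yE : y = cst (y0 - d *: G y0) + d *: vprimitive (G \o x) by [].
  rewrite yE; split; first exact: derivableD.
  rewrite derive1E; apply: etrans (deriveD dC dZ) _.
  apply: etrans (congr1 (fun u => u + _) (derive_cst _ _ _)) _.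
  apply: etrans (add0r _) _; apply: etrans (deriveZ _ dp) _.
  by rewrite -derive1E pE.
have yx s : 0 <= s <= 2 -> y s = x s by move=> hs; rewrite xE /picard clamp_id.
exists x, y; split=> //.
have x0 s : s <= 0 -> x s = x 0.
  move=> s0; rewrite xE [RHS]xE /picard /clamp (max_r s0) maxxx.
  by [].
(* The initial value is not immediate: the correction in [picard] used [G y0], whereas the integral
   over [-1, 0] gives [G (x 0)]. Contraction then forces [y 0 = y0]. *)
have yv : y 0 = y0 + d *: (G (x 0) - G y0).
  rewrite /y; have -> : vprimitive (G \o x) 0 = G (x 0).
    apply/rowP => j; rewrite mxE.
    rewrite (_ : \int[mu]_(t in `[-1, 0]) _ = \int[mu]_(t in `[-1, 0]) (cst (G (x 0) 0 j)) t); last first.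
      by apply: eq_Rintegral => t; rewrite inE /= in_itv /= => /andP[_ t0]; rewrite x0.
    rewrite Rintegral_cst//= lebesgue_measure_itv /= lte_fin ltrN10.
    by rewrite /= opprK add0r mulr1.
  by rewrite scalerBr addrA addrAC.
have xy0 : x 0 = y 0 by rewrite yx// lexx ler0n.
rewrite xy0 in yv.
apply/eqP; rewrite -subr_eq0 -normr_le0.
have h1 : `|y 0 - y0| <= d * (L * `|y 0 - y0|).
  have e : y 0 - y0 = d *: (G (y 0) - G y0).
    by apply/eqP; rewrite subr_eq addrC; apply/eqP.
  by rewrite {1}e normrZ ger0_norm//; exact: ler_wpM2l.
have h2 : d * (L * `|y 0 - y0|) <= 1 / 6 * `|y 0 - y0|.
  by rewrite mulrA ler_wpM2r// ler_pdivlMr.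
have := normr_ge0 (y 0 - y0); move: h1 h2; set q := `|_| => *; lra.
Qed.

End Solution.

End Picard.

Section MeanValue.
Context {R : realType}.

Lemma mean_value_le m (f : R -> 'rV[R]_m) (a b K : R) : a <= b -> 0 <= K ->
  (forall t, a <= t <= b -> derivable f t 1 /\ `|derive1 f t| <= K) ->
  `|f b - f a| <= K * (b - a).
Proof.
move=> ab K0 H; apply: norm_le_coord; first by rewrite mulr_ge0// subr_ge0.
move=> j; rewrite !mxE.
have df t : a <= t <= b -> derivable (fun t => f t 0 j) t 1.
  by move=> /H[/derivable_mxP d _]; exact: d.
have [||t tab ->] := @MVT_segment R (fun t => f t 0 j) (fun t => derive1 f t 0 j) a b ab.
- move=> t; rewrite in_itv /= => /andP[at_ tb].
  have ht : a <= t <= b by rewrite !ltW.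
  by apply: DeriveDef (df t ht) _; rewrite derive1E derive_mx ?mxE//; exact: (H t ht).1.
- by apply: derivable_within_continuous => t; rewrite in_itv /=; exact: df.
rewrite normrM (ger0_norm (_ : 0 <= b - a)) ?subr_ge0// ler_wpM2r ?subr_ge0//.
by apply: le_trans (coord_le_norm _ _) _; apply: (H t _).2; move: tab; rewrite in_itv.
Qed.

Lemma C1_lipschitz n m (U : set 'rV[R]_n) (F : 'rV[R]_n -> 'rV[R]_m) y0 : open U -> U y0 ->
  Ck 1 U F -> exists rho L, [/\ 0 < rho, 0 <= L, forall x, `|x - y0| <= rho -> U x &
    forall x y, `|x - y0| <= rho -> `|y - y0| <= rho -> `|F x - F y| <= L * `|x - y|].
Proof.
move=> oU Uy [dF cF].
pose e j : 'rV[R]_n := delta_mx 0 j.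
pose b j := `|'d F y0 (e j)| + 1.
have near_b : nbhs y0 (fun x => U x /\ forall j, `|'d F x (e j)| <= b j).
  apply: filterI; first exact: open_nbhs_nbhs.
  apply: (@filter_forall _ _ (fun j x => `|'d F x (e j)| <= b j) (nbhs y0)) => j.
  have /cvgrPdist_le/(_ 1 ltr01) := cF (e j) y0 Uy.
  apply: filterS => x hx; rewrite -(subrK ('d F y0 (e j)) ('d F x (e j))) addrC.
  by apply: le_trans (ler_normD _ _) _; rewrite lerD2l distrC.
have [rho rho0 Hrho] := nbhs_closed_ball near_b.
pose L := \sum_j b j.
have b0 j : 0 <= b j by rewrite addr_ge0.
exists rho, L; split=> //; first by apply: sumr_ge0 => j _; exact: b0.
  by move=> x /Hrho[].
have bd x v : `|x - y0| <= rho -> `|'d F x v| <= L * `|v|.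
  move=> /Hrho[_ hb].
  have -> : 'd F x v = \sum_j v 0 j *: 'd F x (e j).
    exact: etrans (congr1 ('d F x) (row_delta v)) (diff_sumE _ _ _ _).
  apply: le_trans (ler_norm_sum _ _ _) _; rewrite mulr_suml; apply: ler_sum => j _.
  by rewrite normrZ mulrC ler_pM// coord_le_norm.
move=> x y hx hy.
pose f t := F (t *: (x - y) + y).
have ft t : 0 <= t <= 1 -> `|t *: (x - y) + y - y0| <= rho.
  move=> /andP[t0 t1].
  have -> : t *: (x - y) + y - y0 = t *: (x - y0) + (1 - t) *: (y - y0).
    by apply/rowP => i; rewrite !mxE; ring.
  apply: le_trans (ler_normD _ _) _; rewrite !normrZ !ger0_norm ?subr_ge0//.
  have -> : rho = t * rho + (1 - t) * rho by ring.
  by rewrite lerD// ler_wpM2l// subr_ge0.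
have -> : F x - F y = f 1 - f 0 by rewrite /f scale1r scale0r add0r subrK.
apply: le_trans (@mean_value_le _ f 0 1 (L * `|x - y|) ler01 _ _) _.
- by rewrite mulr_ge0// sumr_ge0.
- move=> t ht; have [Ut _] := Hrho _ (ft t ht).
  have [d1 d2] := is_derive_line (dF _ Ut).
  by split=> //; rewrite derive1E d2; apply: bd; exact: ft.
by rewrite subr0 mulr1.
Qed.

End MeanValue.

(** * Horizontal curves issued from a point *)

Section HorizontalFlow.
Context {R : realType} {n : nat} {N : subRiemannian R n}.
Local Notation E := (@hor R n N).
Variable p : N.
Local Notation c := (chart_at p).

Lemma diff_curve (m : nat) (H : 'rV[R]_n -> 'rV[R]_m) (y : R -> 'rV[R]_n) t :
  differentiable H (y t) -> derivable y t 1 ->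
  derivable (H \o y) t 1 /\
  derive1 (H \o y) t = \sum_j derive1 y t 0 j *: 'd H (y t) (delta_mx 0 j).
Proof.
move=> dH /derivable1_diffP dy.
have dc : differentiable (H \o y) t by exact: differentiable_comp.
split; first exact/derivable1_diffP.
rewrite (derive1E' dc); apply: etrans (congr1 (fun h => h (1 : R)) (diff_comp dy dH)) _.
rewrite (derive1E' dy).
exact: etrans (congr1 ('d H (y t)) (row_delta _)) (diff_sumE _ _ _ _).
Qed.

(** Integral curve of the horizontal field with constant frame coefficients, those of [u] at [p];
    time is slowed down by [d] so that [0, 1] is covered. *)
Lemma horizontal_flow u : u \in E p -> exists d (g : R -> N),
  [/\ 0 < d, horizontal g, g 0 = p & velocity g 0 = d *: u].
Proof.
move=> uE; have ac := chart_at_atlas p; have cp := chart_at_dom p.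
have [V [k [X [Vp fX]]]] := frame_exists p; have [oV sX _] := fX.
pose a := frame_coord X p u.
have ua : u = \sum_i a 0 i *: X i p by exact: (frame_coordE fX Vp uE).
pose F x := \sum_i a 0 i *: field_in_chart c (X i) x.
pose W := c @` (cdom c `&` V).
have oW : open W by exact: open_chart_image.
have Wp : W (c p) by exists p.
have F1 : Ck 1 W F.
  apply: (@Ck_sum R _ _ 1 W k (fun i x => a 0 i *: field_in_chart c (X i) x)) => // i.
  apply: CkZ => //; exact: (sX i c ac 1%N).
have [rho [L [rho0 L0 ballW lipF]]] := C1_lipschitz oW Wp F1.
pose G x := F (vclamp (c p) rho x).
have lipG x y : `|G x - G y| <= L * `|x - y|.
  apply: le_trans (lipF _ _ _ _) _; try exact: vclamp_ball (ltW rho0).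
  by apply: ler_wpM2l => //; exact: vclamp_lip.
pose M := `|F (c p)| + L * rho.
have GM x : `|G x| <= M.
  rewrite /G -(subrK (F (c p)) (F _)) addrC; apply: le_trans (ler_normD _ _) _.
  rewrite lerD2l; apply: le_trans (lipF _ _ _ _) _.
  - exact: vclamp_ball (ltW rho0).
  - by rewrite subrr normr0 ltW.
  - by apply: ler_wpM2l => //; exact: vclamp_ball (ltW rho0).
have M0 : 0 <= M by rewrite addr_ge0// mulr_ge0// ltW.
(* [d] will be the inverse of [D]: the first term makes the Picard map contract, the second keeps
   the solution within [rho] of [c p] up to time 1. *)
pose D := L * 6 + M / rho + 1.
have LD : L * 6 <= D by rewrite /D -addrA lerDl addr_ge0// divr_ge0// ltW.
have MD : M / rho <= D by rewrite /D addrAC lerDr addr_ge0// mulr_ge0.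
have D0 : 0 < D by rewrite /D ltr_wpDl// addr_ge0 ?mulr_ge0// invr_ge0 ltW.
pose d := D^-1.
have d0 : 0 < d by rewrite invr_gt0.
have dL : d * L * 6 <= 1 by rewrite -mulrA /d mulrC ler_pdivrMr// mul1r.
have dM : d * M <= rho.
  by rewrite /d mulrC ler_pdivrMr// mulrC -ler_pdivrMr.
have [x [y [cx y0 yx dy]]] := ode_solution (c p) L0 lipG (ltW d0) dL.
have cy s : -1 < s -> {for s, continuous y}.
  by move=> /dy[/derivable1_diffP + _]; exact: differentiable_continuous.
have s1 (s : R) : 0 <= s -> -1 < s by move=> s0; apply: lt_le_trans s0; rewrite oppr_lt0.
have yball s : 0 <= s <= 1 -> `|y s - c p| <= rho.
  move=> /andP[s0 s1']; rewrite -y0; apply: le_trans (@mean_value_le _ _ y 0 s (d * M) s0 _ _) _.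
  - by rewrite mulr_ge0// ltW.
  - move=> t /andP[/s1/dy[h1 h2] _]; split=> //; rewrite h2 normrZ gtr0_norm//.
    by rewrite ler_pM2l.
  - by rewrite subr0; apply: le_trans _ dM; rewrite ler_piMr// mulr_ge0// ltW.
pose g := cinv c \o y.
have gW s : 0 <= s <= 1 -> [/\ cdom c (g s), V (g s) & c (g s) = y s].
  by move=> /yball/ballW; exact: chart_preim.
have cg s : 0 <= s <= 1 -> {for s, continuous g}.
  move=> hs; have /andP[s0 _] := hs.
  apply: continuous_comp; first by apply: cy; exact: s1.
  have [h1 _ h2] := gW s hs.
  by apply: (chart_inv_cont (atlas_chart ac)); exists (g s).
have cGx j : continuous (fun s => G (x s) 0 j).
  apply: continuous_entry; exact: (continuous_lip L0 lipG cx).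
have gC1 s c' : 0 <= s <= 1 -> atlas c' -> cdom c' (g s) ->
    (\forall t \near s, derivable (c' \o g) t 1) /\ {for s, continuous (derive1 (c' \o g))}.
  move=> hs ac' cgs; have /andP[s0 _] := hs; have [h1 h2 h3] := gW s hs.
  pose H := c' \o cinv c; pose O := c @` (cdom c `&` cdom c').
  have oO : open O by apply: open_chart_image => //; exact: open_cdom.
  have [dH cH] : Ck 1 O H by exact: Ck_transition.
  have Os : O (y s) by exists (g s).
  have nO : nbhs s (fun t => O (y t) /\ -1 < t).
    apply: filterI; first by apply: (cy s (s1 s s0)); exact: open_nbhs_nbhs.
    by apply: open_nbhs_nbhs; split; [exact: open_gt|exact: s1].
  have nd : \forall t \near s, derivable (c' \o g) t 1 /\ derive1 (c' \o g) t =
      \sum_j (d * G (x t) 0 j) *: 'd H (y t) (delta_mx 0 j).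
    apply: filterS nO => t [Ot t1]; have [d1 d2] := dy t t1.
    have [e1 e2] := diff_curve (dH _ Ot) d1; split; first exact: e1.
    by apply: etrans e2 _; apply: eq_bigr => j _; rewrite d2 mxE.
  split; first by apply: filterS nd => t [].
  have [_ e] := nbhs_singleton nd; rewrite /prop_for /continuous_at e.
  have C : (fun t => \sum_j (d * G (x t) 0 j) *: 'd H (y t) (delta_mx 0 j)) t @[t --> s] -->
      \sum_j (d * G (x s) 0 j) *: 'd H (y s) (delta_mx 0 j).
    apply: cvg_big => [|j _]; first exact: add_continuous.
    apply: cvgZ; first by apply: cvgM; [exact: cvg_cst|exact: cGx].
    exact: (cvg_comp _ _ (cy s (s1 s s0)) (cH _ _ Os)).
  apply: cvg_trans C; apply: near_eq_cvg; apply: filterS nd => t [_ h].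
  exact: (esym h).
have vg s : 0 <= s <= 1 -> velocity g s = d *: (\sum_i a 0 i *: X i (g s)).
  move=> hs; have /andP[s0 s1'] := hs; have [h1 h2 h3] := gW s hs.
  have [/nbhs_singleton dg _] := gC1 s _ hs (chart_at_atlas (g s)) (chart_at_dom (g s)).
  have [_ tv] := velocity_in_chart (cg s hs) ac h1 dg.
  apply/eqP; rewrite -subr_eq0; apply/eqP; apply: (tvec_inj ac h1).
  apply: etrans (linearB _ _ _) _.
  apply/eqP; rewrite subr_eq0; apply/eqP; apply: etrans tv _.
  have E1 : derive1 (c \o g) s = derive1 y s.
    rewrite !derive1E; apply: near_eq_derive.
    have Ws : W (y s) by exact: ballW (yball s hs).
    have : nbhs s (fun t => W (y t)) by apply: (cy s (s1 s s0)); exact: open_nbhs_nbhs.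
    by apply: filterS => t /chart_preim[].
  apply: etrans E1 _; rewrite (dy s (s1 s s0)).2.
  apply: etrans _ (esym (linearZ _ _)); congr (_ *: _).
  (* Up to time 1 the solution stays in the ball where the truncation is the identity. *)
  have -> : G (x s) = F (y s).
    rewrite /G -yx; first by rewrite vclamp_id// yball.
    by rewrite s0 (le_trans s1')// ler1n.
  rewrite -h3 /F; apply: etrans _ (esym (linear_sum _ _ _ _)); apply: eq_bigr => i _.
  by apply: etrans _ (esym (linearZ _ _)); rewrite field_in_chartE.
have g0 : g 0 = p by rewrite /g /= y0 chartK.
have h01 : 0 <= (0 : R) <= 1 by rewrite lexx ler01.
exists d, g; split=> //.
  split; first by move=> s hs; split; [exact: cg|move=> c'; exact: gC1].
  move=> s hs; rewrite vg// memvZ// memv_suml// => i _; rewrite memvZ//.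
  by apply: (frame_mem fX); have [] := gW s hs.
by rewrite vg// g0 -ua.
Qed.

(** Take the point of the flow at time [sigma / d]: it has moved by [sigma *: u] to first order, and
    continuity of the speed bounds the length of the initial piece. *)
Lemma horizontal_curve u (eps : R) : u \in E p -> 0 < eps -> exists2 delta, 0 < delta &
  forall sigma, 0 < sigma < delta -> exists z,
    [/\ (cc_dist p z < (sigma * (Num.sqrt (sr_metric p u u) + eps))%:E)%E, cdom c z &
        `|c z - c p - sigma *: u| <= eps * sigma].
Proof.
move=> uE eps0; have [d [g [d0 hg g0 vg]]] := horizontal_flow uE.
have ac := chart_at_atlas p; have cp := chart_at_dom p.
have h01 : 0 <= (0 : R) <= 1 by rewrite lexx ler01.
have cg0 : cdom c (g 0) by rewrite g0.
have [cg /derivable1_diffP dg _ tv] := horizontal_C1 hg h01 ac cg0.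
have dE : derive1 (c \o g) 0 = d *: u by rewrite -tv g0 tvec_chart_at vg.
have ed : 0 < eps * d by rewrite mulr_gt0.
have n1 : \forall s \near (0 : R), `|c (g s) - c p - s *: (d *: u)| <= eps * d * `|s|.
  have := diff_eps dg ed; apply: filterS => s; rewrite subr0 /= g0.
  have -> : 'd (c \o g) 0 s = s *: (d *: u).
    by rewrite -dE (derive1E' dg) -[in RHS]linearZ /GRing.scale /= mulr1.
  by [].
have n2 : \forall s \near (0 : R), cdom c (g s).
  by apply: cg; apply: open_nbhs_nbhs; split=> //; exact: open_cdom.
have sp0 : speed g 0 = d * Num.sqrt (sr_metric p u u).
  by rewrite /speed vg g0 sr_metricZ// sqrtrM ?sqr_ge0// sqrtr_sqr gtr0_norm.
(* Only half of the margin is used here, so that the final distance bound is strict. *)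
have n3 : \forall s \near (0 : R), 0 <= s <= 1 ->
    speed g s <= d * Num.sqrt (sr_metric p u u) + eps * d / 2.
  have e2 : 0 < eps * d / 2 by rewrite divr_gt0.
  have /subspace_continuousP/(_ 0) := speed_continuous hg.
  rewrite /= in_itv /= => /(_ h01)/cvgrPdist_le/(_ _ e2).
  rewrite near_withinE; apply: filterS => s + hs.
  rewrite /= in_itv /= => /(_ hs).
  rewrite /from_subspace sp0.
  by rewrite ler_distlC addrC => /andP[_]; rewrite addrC.
have [r r0 Hr] := nbhs_closed_ball (filterI n1 (filterI n2 n3)).
exists (d * Num.min r 1); first by rewrite mulr_gt0// lt_min r0 ltr01.
move=> sigma /andP[sig0 sigr]; pose s' := sigma / d.
have s'0 : 0 < s' by rewrite divr_gt0.
have : s' < Num.min r 1 by rewrite ltr_pdivrMr// mulrC.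
rewrite lt_min => /andP[s'r s'1].
have sE : sigma = s' * d by rewrite divfK// gt_eqF.
have [m1 [m2 _]] : (`|c (g s') - c p - s' *: (d *: u)| <= eps * d * `|s'|) /\
    cdom c (g s') /\ (0 <= s' <= 1 -> speed g s' <= d * Num.sqrt (sr_metric p u u) + eps * d / 2).
  by apply: Hr; rewrite subr0 gtr0_norm// ltW.
exists (g s'); split=> //; last first.
  by move: m1; rewrite scalerA -sE gtr0_norm// -mulrA (mulrC d) -sE.
have ab t : 0 <= t <= 1 -> 0 <= affine s' 0 t <= 1.
  move=> /andP[t0 t1]; rewrite /affine addr0 mulr_ge0 ?(ltW s'0)//=.
  by rewrite mulr_ile1 ?(ltW s'0)// ltW.
have [ha sa] := horizontal_affine ab hg.
have J : joined p (g s') (arc_length (g \o affine s' 0)).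
  rewrite -[arc_length _]add0e.
  have -> : g s' = (g \o affine s' 0) 1 by rewrite /= /affine mulr1 addr0.
  apply: joined_arc ha _; first exact: joined_refl.
  by rewrite /= /affine mulr0 addr0.
apply: le_lt_trans (ereal_inf_lbound J) _.
have mI : measurable ([set` `[0%R, 1%R]] : set R) by [].
apply: (@le_lt_trans _ _ (\int[lebesgue_measure]_(s in `[0%R, 1%R])
    cst (s' * (d * Num.sqrt (sr_metric p u u) + eps * d / 2))%:E s)%E).
  rewrite arc_lengthE; apply: ge0_le_integral => //.
  - by move=> t _; rewrite lee_fin sqrtr_ge0.
  - have := continuous_compact_integrable (@segment_compact R 0 1) (speed_continuous ha).
    exact: measurable_int.
  - move=> t /=; rewrite in_itv /= => ht; rewrite lee_fin sa// gtr0_norm// ler_pM2l//.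
    have /andP[t0 t1] := ab t ht.
    have [_ [_]] : (`|c (g (affine s' 0 t)) - c p - affine s' 0 t *: (d *: u)| <=
       eps * d * `|affine s' 0 t|) /\ cdom c (g (affine s' 0 t)) /\ (0 <= affine s' 0 t <= 1 ->
       speed g (affine s' 0 t) <= d * Num.sqrt (sr_metric p u u) + eps * d / 2).
      apply: Hr; rewrite subr0 ger0_norm//; apply: le_trans (ltW s'r).
      by rewrite /affine addr0 ler_piMr ?(ltW s'0)//; case/andP: ht.
    by apply; rewrite t0 t1.
rewrite integral_cst//= lebesgue_measure_itv /= lte_fin ltr01 /= oppr0 adde0 mule1 lte_fin.
rewrite sE -(mulrA s') ltr_pM2l// mulrDr ltrD2l (mulrC d eps).
by rewrite ltr_pdivrMr// ltr_pMr ?mulr_gt0// ltr1n.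
Qed.

End HorizontalFlow.

(** * Comparison with the tangent cone *)

Section MetricBounds.
Context {R : realType} {n : nat} {N : subRiemannian R n}.
Local Notation E := (@hor R n N).
Variable p : N.
Local Notation c := (chart_at p).

(* Test on the functional dual to [w]. *)
Lemma metric_le_of_escape w (m : R) : w \in E p -> 0 <= m ->
  (forall eps t0 : R, 0 < eps -> exists t y, [/\ t0 <= t, 0 < t,
     (cc_dist p y < ((m + eps) / t)%:E)%E & `|t *: (c y - c p) - w| <= eps]) ->
  Num.sqrt (sr_metric p w w) <= m.
Proof.
move=> wE m0 H; have [-> |w0] := eqVneq w 0.
  by have := sr_metricZ 0 (mem0v (E p)); rewrite scaler0 expr0n mul0r => ->; rewrite sqrtr0.
set W := Num.sqrt _; have W2 := sr_metric_pos wE w0.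
have W0 : 0 < W by rewrite sqrtr_gt0.
have WW : W ^+ 2 = sr_metric p w w by rewrite sqr_sqrtr// ltW.
(* [projv] extends the functional beyond E_p, where the metric has no meaning. By Cauchy-Schwarz it
   is at most the norm on E_p, with equality at [w]. *)
have [|psi psiE] := @linear_pack R n (fun v => sr_metric p (projv (E p) v) w / W).
  move=> a u v; rewrite linearP.
  by rewrite sr_metric_lin ?memv_proj// mulrDl mulrA.
have psiw : psi w = W by rewrite psiE projv_id// -WW expr2 mulfK// gt_eqF.
have [B B0 psiB] := linear_bound psi.
rewrite leNgt; apply/negP => mW; pose gap := W - m.
have gap0 : 0 < gap by rewrite subr_gt0.
(* [k > 1] provides the strict inequality asked by [cc_dist_functional], at a final cost of
   [gap / 4]. *)
pose k := 1 + gap / (4 * (m + 1)).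
have m1 : 0 < m + 1 by rewrite ltr_wpDl.
have k1 : 1 < k by rewrite ltrDl divr_gt0// mulr_gt0.
have k0 : 0 <= k by rewrite ltW// (lt_trans _ k1).
have psik v : v \in E p -> v != 0 -> (psi v) ^+ 2 < k ^+ 2 * sr_metric p v v.
  move=> vE v0; have V0 := sr_metric_pos vE v0.
  apply: (@le_lt_trans _ _ (sr_metric p v v)); last first.
    by rewrite ltr_pMl// -[X in X < _](expr1n R 2) ltr_pXn2r// ?nnegrE.
  rewrite psiE projv_id// expr_div_n WW ler_pdivrMr//; exact: sr_metric_cauchy.
have [delta delta0 Hdelta] := cc_dist_functional k0 psik.
(* The errors [eps] and [B * eps] together cost another [gap / 4]; hence [W <= m + gap / 2], a
   contradiction. *)
pose eps := Num.min 1 (gap / (4 * (B + 1))).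
have B1 : 0 < B + 1 by rewrite ltr_wpDl.
have eps0 : 0 < eps by rewrite lt_min ltr01 divr_gt0// mulr_gt0.
have eps1 : eps <= 1 by rewrite ge_min lexx.
have epsB : eps * (4 * (B + 1)) <= gap.
  by rewrite -ler_pdivlMr ?mulr_gt0// ge_min lexx orbT.
have [t [y [t0 tpos py yw]]] := H eps ((m + 2) / delta) eps0.
have ld : (m + eps) / t < delta.
  rewrite ltr_pdivrMr//; apply: (@lt_le_trans _ _ (m + 2)); first by lra.
  by rewrite mulrC -ler_pdivrMr.
have h1 := Hdelta y _ py ld.
have h2 : t * psi (c y - c p) <= k * (m + eps).
  by rewrite -(ler_pM2l tpos) in h1; move: h1; rewrite mulrCA [t * (_ / t)]mulrC divfK// gt_eqF.
have h3 : W - B * eps <= t * psi (c y - c p).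
  have E1 : t * psi (c y - c p) = W + psi (t *: (c y - c p) - w).
    by rewrite (linearB psi (t *: _)) linearZ psiw /= [W + _]addrC subrK.
  rewrite E1 lerD2l.
  have := le_trans (psiB (t *: (c y - c p) - w)) (ler_wpM2l B0 yw).
  by rewrite ler_norml => /andP[].
have h4 : k * (m + eps) <= m + eps + gap / 4.
  have -> : k * (m + eps) = m + eps + gap / 4 * ((m + eps) / (m + 1)).
    by rewrite /k; field; rewrite gt_eqF.
  rewrite lerD2l ler_piMr ?divr_ge0 ?(ltW gap0)// ler_pdivrMr// mul1r; lra.
have := le_trans h3 (le_trans h2 h4).
have EB : eps * (4 * (B + 1)) = 4 * (B * eps) + 4 * eps by ring.
move: epsB; rewrite EB; move: (B * eps) => q; rewrite /gap in gap0 *.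
by move=> ? ?; lra.
Qed.

End MetricBounds.

Section ChartEstimates.
Context {R : realType} {n : nat} {N : subRiemannian R n}.
Variables (f : N -> N) (p : N).
Hypotheses (f_diffeo : local_diffeo f) (fp : f p = p).
Local Notation c := (chart_at p).
Local Notation L := (tangent_map f p).

Lemma chart_estimate : exists2 K : R, 0 < K & forall A eps : R, 0 < A -> 0 < eps ->
  exists2 t1, 0 < t1 & forall t, t1 <= t -> forall y z,
    (cc_dist p y < (A / t)%:E)%E -> (cc_dist y z < (eps / t)%:E)%E ->
    `|t *: (c y - c p)| <= K * A /\ `|t *: (c z - c y)| <= K * eps.
Proof.
have [rho [K B]] := coordinate_ball_exists p; have [rho0 K0 _ _] := B.
(* Past this threshold [K * (A + eps) / t < rho], so both displacements remain in the coordinate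
   ball. *)
exists K => // A eps A0 eps0; exists ((K * (A + eps) + 1) / rho).
  by rewrite divr_gt0// ltr_wpDl// mulr_ge0 ?ltW// addr_gt0.
move=> t tt y z py yz.
have t0 : 0 < t.
  by apply: lt_le_trans tt; rewrite divr_gt0// ltr_wpDl// mulr_ge0 ?ltW// addr_gt0.
have small : K * (A / t) + K * (eps / t) < rho.
  rewrite -mulrDr -mulrDl mulrA ltr_pdivrMr// [_ * t]mulrC -ltr_pdivrMr//.
  by apply: lt_le_trans tt; rewrite ltr_pM2r ?invr_gt0// ltrDl.
have e0 : 0 <= K * (eps / t) by rewrite mulr_ge0 ?divr_ge0// ltW.
have [cy yp] : cdom c y /\ `|c y - c p| <= K * (A / t).
  apply: cc_dist_coordinate B py (chart_at_dom p) _.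
  by rewrite subrr normr0 add0r; apply: le_lt_trans small; rewrite lerDl.
have [_ zy] : cdom c z /\ `|c z - c y| <= K * (eps / t).
  by apply: cc_dist_coordinate B yz cy _; apply: le_lt_trans small; rewrite lerD2r.
have sc v a : `|v| <= K * (a / t) -> `|t *: v : 'rV[R]_n| <= K * a.
  by rewrite normrZ gtr0_norm// mulrA ler_pdivlMr// mulrC.
by split; exact: sc.
Qed.

Lemma tangent_map_chart v : L v = 'd (c \o f \o cinv c) (c p) v.
Proof.
have [U [[oU Up] [_ [sf _]]]] := f_diffeo p.
have ac := chart_at_atlas p; have cp := chart_at_dom p.
have cfp : cdom c (f p) by rewrite fp.
have H := tvec_tangent_map oU sf v ac ac Up cp cfp.
apply: etrans (esym (tvec_chart_at p (L v))) _.
apply: etrans (congr1 (fun q => tvec c q (L v)) (esym fp)) _.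
apply: etrans H _; exact: congr1 (tvec_chart_at p v).
Qed.

Lemma chart_map_differentiable : differentiable (c \o f \o cinv c) (c p).
Proof.
have [U [[oU Up] [_ [[_ sf] _]]]] := f_diffeo p.
have ac := chart_at_atlas p; have cp := chart_at_dom p.
have [d _] := sf c c ac ac 1%N; apply: d.
by exists p => //; split; [split|rewrite /= fp].
Qed.

(** After rescaling by [t], replacing [f a] by [b] costs [K * eps], and linearizing [f] at distance
    at most [A / t] from [p] costs [eps * (K * A)]. *)
Lemma map_estimate : exists2 K : R, 0 < K & forall A eps : R, 0 < A -> 0 < eps ->
  exists2 t1, 0 < t1 & forall t, t1 <= t -> forall a b,
    (cc_dist p a < (A / t)%:E)%E -> (cc_dist (f a) b < (eps / t)%:E)%E ->
    `|t *: (c b - c p) - L (t *: (c a - c p))| <= K * (1 + A) * eps.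
Proof.
have [rho [K B]] := coordinate_ball_exists p; have [rho0 K0 cod _] := B.
have ac := chart_at_atlas p; have cp := chart_at_dom p.
have [U [[oU Up] [_ [sf _]]]] := f_diffeo p.
exists K => // A eps A0 eps0; pose fc := c \o f \o cinv c.
have fcp : fc (c p) = c p by rewrite /fc /= chartK// fp.
have dfc : differentiable fc (c p) := chart_map_differentiable.
have rho2 : 0 < rho / 2 by rewrite divr_gt0.
have near1 : nbhs (c p) (fun u => cdom c (f (cinv c u)) /\
    (`|fc u - c p| <= rho / 2 /\ `|fc u - c p - L (u - c p)| <= eps * `|u - c p|)).
  apply: filterI; [|apply: filterI].
  - have oW : open (U `&` f @^-1` cdom c) by apply: open_smooth_preimage => //; exact: open_cdom.
    have Wp : (U `&` f @^-1` cdom c) p by split=> //=; rewrite fp.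
    by apply: filterS (near_chart ac oW Wp cp) => u [_ []].
  - have /cvgrPdist_le/(_ _ rho2) := differentiable_continuous dfc.
    by apply: filterS => u; rewrite fcp distrC.
  - apply: filterS (diff_eps dfc eps0) => u; rewrite fcp => h.
    by apply: le_trans h; rewrite le_eqVlt tangent_map_chart eqxx.
have [r r0 Hr] := nbhs_closed_ball near1.
pose s := Num.min r (rho / 2); have s0 : 0 < s by rewrite lt_min r0 rho2.
exists ((K * (A + eps) + 1) / s).
  by rewrite divr_gt0// ltr_wpDl// mulr_ge0 ?ltW// addr_gt0.
move=> t tt a b pa fab.
have t0 : 0 < t.
  by apply: lt_le_trans tt; rewrite divr_gt0// ltr_wpDl// mulr_ge0 ?ltW// addr_gt0.
have small : K * (A / t) + K * (eps / t) < s.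
  rewrite -mulrDr -mulrDl mulrA ltr_pdivrMr// [_ * t]mulrC -ltr_pdivrMr//.
  by apply: lt_le_trans tt; rewrite ltr_pM2r ?invr_gt0// ltrDl.
have [sr srho] : s <= r /\ s <= rho / 2 by rewrite !ge_min !lexx orbT.
have e0 : 0 < K * (eps / t) by rewrite mulr_gt0 ?divr_gt0.
have A1 : 0 < K * (A / t) by rewrite mulr_gt0 ?divr_gt0.
have [ca ap] : cdom c a /\ `|c a - c p| <= K * (A / t).
  apply: cc_dist_coordinate B pa cp _.
  by rewrite subrr normr0 add0r; lra.
have [cfa [fap fal]] := Hr (c a) ltac:(lra).
rewrite chartK// in cfa.
have fcE : fc (c a) = c (f a) by rewrite /fc /= chartK.
rewrite fcE in fap fal.
have [_ bf] : cdom c b /\ `|c b - c (f a)| <= K * (eps / t).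
  by apply: cc_dist_coordinate B fab cfa _; lra.
have -> : t *: (c b - c p) - L (t *: (c a - c p)) =
    t *: ((c b - c (f a)) + (c (f a) - c p - L (c a - c p))).
  rewrite linearZ -scalerBr; congr (_ *: _).
  by rewrite addrA addrA subrK.
rewrite normrZ gtr0_norm// mulrC -ler_pdivlMr//.
apply: le_trans (ler_normD _ _) _.
apply: le_trans (lerD bf (le_trans fal (ler_wpM2l (ltW eps0) ap))) _.
by rewrite le_eqVlt; apply/orP; left; apply/eqP; ring.
Qed.

End ChartEstimates.

(** * Passing through the cone and back *)

Section ConeTransfer.
Context {R : realType}.

Lemma lte_scale (t l : R) (d : \bar R) : 0 < t -> (t%:E * d < l%:E)%E = (d < (l / t)%:E)%E.
Proof.
move=> t0; case: d => [r| |].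
- by rewrite -EFinM !lte_fin ltr_pdivlMr// mulrC.
- by rewrite mulry gtr0_sg// mul1e !ltNge !leey.
- by rewrite mulrNy gtr0_sg// mul1e !ltNye.
Qed.

Lemma lte_of_le_add (d d' : \bar R) (e l : R) :
  (d <= d' + e%:E)%E -> (d' < l%:E)%E -> (d < (l + e)%:E)%E.
Proof. by move=> h1 h2; apply: le_lt_trans h1 _; rewrite EFinD lteD2rE. Qed.

Context {n r : nat} {N : subRiemannian R n} {p : N} (TC : tangent_cone r p).
Variables (f : N -> N) (fs : TC -> TC) (C : R).
Hypotheses (fs_lim : carnot_derivative f fs) (fs_mul : {morph fs : x y / gmul x y})
  (fs_homothety : homothety C fs).
Local Notation o := (gone TC).
Local Notation approx := (@tc_approx R n r N p TC).

Lemma automorphism_one : fs o = o.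
Proof.
have sq : gmul (fs o) (fs o) = fs o by rewrite -fs_mul gmul1.
by have := gmulA (ginv (fs o)) (fs o) (fs o); rewrite sq gmulV gmul1 => <-.
Qed.

Lemma homothety_one x : cc_dist o (fs x) = (C%:E * cc_dist o x)%E.
Proof. by have [_ [_ H]] := fs_homothety; rewrite -{1}automorphism_one H. Qed.

(** All that is retained of the cone, stated on [N] alone. In the first part [a] and [b] approximate
    [x] and [fs x], with [a] near [z]; in the second [b] is near [z] and [a] approximates a preimage
    under [fs]. *)
Lemma cone_transfer : exists2 rho0 : R, 0 < rho0 & forall eps : R, 0 < eps ->
  exists2 t0, 0 < t0 & forall t, t0 <= t -> forall z, (cc_dist p z < (rho0 / t)%:E)%E ->
  (exists a b, [/\ (cc_dist z a < (eps / t)%:E)%E, (cc_dist (f a) b < (eps / t)%:E)%E &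
     forall l, (cc_dist p a < (l / t)%:E)%E -> (cc_dist p b < ((C * l + eps) / t)%:E)%E]) /\
  (exists a b, [/\ (cc_dist z b < (eps / t)%:E)%E, (cc_dist (f a) b < (eps / t)%:E)%E &
     forall l, (cc_dist p b < (l / t)%:E)%E -> (cc_dist p a < ((l / C + eps) / t)%:E)%E]).
Proof.
have [C0 [fs_surj _]] := fs_homothety.
have [rho rho_gt0 [D cD ballD]] := cc_ball_compact o.
(* A point of the cone within [rho'] of the unit, its image and its preimages under [fs] all stay
   within [rho], where the approximations are controlled. *)
pose rho' := Num.min rho (Num.min (rho / C) (C * rho)).
have rho'0 : 0 < rho' by rewrite !lt_min rho_gt0 divr_gt0//= mulr_gt0.
have [r1 r2 r3] : [/\ rho' <= rho, rho' <= rho / C & rho' <= C * rho].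
  by rewrite !ge_min !lexx !orbT.
have h2 : 0 < rho' / 2 by rewrite divr_gt0.
exists (rho' / 2) => // eps eps0.
have k0 : 0 < C + C^-1 + 1 by rewrite !addr_gt0 ?invr_gt0.
(* An error [e] on entering the cone is multiplied by [C] or [C^-1], and leaving it adds another
   [e]. *)
pose e := Num.min (rho' / 2) (eps / (C + C^-1 + 1)).
have e0 : 0 < e by rewrite lt_min h2 divr_gt0.
have e1 : e <= rho' / 2 by rewrite ge_min lexx.
have e2 : e * (C + C^-1 + 1) <= eps by rewrite -ler_pdivlMr// ge_min lexx orbT.
have e3 : C * e + e <= eps.
  apply: le_trans e2; rewrite !mulrDr mulr1 lerD2r [e * C]mulrC lerDl mulr_ge0 ?invr_ge0 ?ltW//.
have e4 : e / C + e <= eps.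
  apply: le_trans e2; rewrite !mulrDr mulr1 lerD2r lerDr mulr_ge0 ?ltW//.
have e5 : e <= eps by apply: le_trans e3; rewrite lerDr mulr_ge0 ?ltW.
have erho : e < rho' by apply: le_lt_trans e1 _; rewrite ltr_pdivrMr// ltr_pMr// ltr1n.
have eps2 : 0 < eps / 2 by rewrite divr_gt0.
have [t1 H1] := fs_lim cD eps2.
have [t2 H2] := tc_approx_isom TC rho_gt0 e0.
have [t3 H3] := tc_approx_onto TC e0 erho.
exists (Num.max 1 (Num.max t1 (Num.max t2 t3))); first by rewrite lt_max ltr01.
move=> t; rewrite !ge_max => /andP[t_1 /andP[tt1 /andP[tt2 tt3]]] z pz.
have t0 : 0 < t by apply: lt_le_trans t_1.
have oo : (cc_dist o o < rho%:E)%E by exact: cc_dist_refl.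
have map_close x : (cc_dist o x < rho%:E)%E ->
    (cc_dist (f (approx t x)) (approx t (fs x)) < (eps / t)%:E)%E.
  move=> /ballD/(H1 t tt1) h; rewrite -lte_scale//; apply: le_lt_trans h _.
  by rewrite lte_fin ltr_pdivrMr// ltr_pMr// ltr1n.
have to_cone x l : (cc_dist o x < rho%:E)%E ->
    (cc_dist p (approx t x) < (l / t)%:E)%E -> (cc_dist o x < (l + e)%:E)%E.
  move=> ox; rewrite -lte_scale// => h.
  have [_ h'] := H2 t tt2 o x oo ox; apply: lte_of_le_add h' _.
  by rewrite tc_approx_one.
have from_cone x l : (cc_dist o x < rho%:E)%E -> (cc_dist o x < l%:E)%E ->
    (cc_dist p (approx t x) < ((l + e) / t)%:E)%E.
  move=> ox xl; rewrite -lte_scale//.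
  have [h' _] := H2 t tt2 o x oo ox; rewrite tc_approx_one in h'.
  exact: lte_of_le_add h' xl.
have weaken y l l' : l <= l' -> (cc_dist p y < (l / t)%:E)%E -> (cc_dist p y < (l' / t)%:E)%E.
  by move=> ll h; apply: lt_le_trans h _; rewrite lee_fin ler_pM2r ?invr_gt0.
have mulC x l : (cc_dist o x < l%:E)%E -> (cc_dist o (fs x) < (C * l)%:E)%E.
  by move=> h; rewrite homothety_one lte_scale// mulrC mulKf// gt_eqF.
have divC x l : (cc_dist o (fs x) < l%:E)%E -> (cc_dist o x < (l / C)%:E)%E.
  by rewrite homothety_one lte_scale.
have [x [ox xz]] : exists x : TC, (cc_dist o x < rho'%:E)%E /\
    (t%:E * cc_dist (approx t x) z < e%:E)%E.
  apply: (H3 t tt3); rewrite lte_scale//; apply: lt_le_trans pz _.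
  by rewrite lee_fin ler_pM2r ?invr_gt0//; lra.
have {xz}zx : (cc_dist z (approx t x) < (eps / t)%:E)%E.
  rewrite cc_dist_sym -lte_scale//; apply: lt_le_trans xz _; by rewrite lee_fin.
split.
  have oxr : (cc_dist o x < rho%:E)%E by apply: lt_le_trans ox _; rewrite lee_fin.
  have ofx : (cc_dist o (fs x) < rho%:E)%E.
    have xC : (cc_dist o x < (rho / C)%:E)%E by apply: lt_le_trans ox _; rewrite lee_fin.
    by have := mulC _ _ xC; rewrite mulrC divfK// gt_eqF.
  exists (approx t x), (approx t (fs x)); split=> //; first exact: map_close.
  move=> l /(to_cone x l oxr)/mulC/(from_cone _ _ ofx); apply: weaken.
  by rewrite mulrDr -addrA lerD2l.
have [x' xE] := fs_surj x.
have ox' : (cc_dist o x' < rho%:E)%E.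
  have : (cc_dist o (fs x') < (C * rho)%:E)%E by rewrite xE; apply: lt_le_trans ox _; rewrite lee_fin.
  by move=> /divC; rewrite mulrC mulKf// gt_eqF.
have oxr : (cc_dist o x < rho%:E)%E by apply: lt_le_trans ox _; rewrite lee_fin.
exists (approx t x'), (approx t x); split=> //.
  by have := map_close x' ox'; rewrite xE.
move=> l /(to_cone x l oxr); rewrite -{1}xE => /divC/(from_cone _ _ ox'); apply: weaken.
by rewrite mulrDl -addrA lerD2l.
Qed.

End ConeTransfer.

Section HorizontalIsometry.
Context {R : realType} {n r : nat} {N : subRiemannian R n} {p : N} (TC : tangent_cone r p).
Variables (f : N -> N) (fs : TC -> TC) (C : R).
Hypotheses (f_diffeo : local_diffeo f) (f_hor : preserves_hor f) (fp : f p = p).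
Hypotheses (fs_lim : carnot_derivative f fs) (fs_mul : {morph fs : x y / gmul x y})
  (fs_homothety : homothety C fs).
Local Notation E := (@hor R n N).
Local Notation c := (chart_at p).
Local Notation L := (tangent_map f p).
Local Notation nrm v := (Num.sqrt (sr_metric p v v)).

Lemma tangent_map_hor u : u \in E p -> L u \in E p.
Proof. by move=> uE; have := memv_img L uE; rewrite f_hor fp. Qed.

Lemma tangent_map_lower : exists2 K : R, 0 < K & forall v, `|v| <= K * `|L v|.
Proof.
have [U [[oU Up] [ofU [sf [g [sg gf]]]]]] := f_diffeo p.
have k0 : lker L == 0%VS by apply/eqP; exact: (tangent_map_inj oU sf sg gf Up).
have [K K0 HK] := @linear_bound R n 'rV[R]_n (fun_of_lfun (L^-1)%VF).
exists (K + 1); first by rewrite ltr_wpDl.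
move=> v; have h : `|(L^-1)%VF (L v)| <= K * `|L v| by exact: HK.
have e : (L^-1)%VF (L v) = v by exact: lker0_lfunK.
rewrite e in h; apply: le_trans h _; by rewrite ler_wpM2r// lerDl.
Qed.

(** The restriction to small vectors reflects that [cone_transfer] reaches points at rescaled
    distance less than [rho0]; homogeneity removes it afterwards. *)
Lemma horizontal_upper_lower : exists2 rho : R, 0 < rho & forall u, u \in E p ->
  (nrm u < rho -> nrm (L u) <= C * nrm u) /\ (nrm (L u) < rho -> nrm u <= nrm (L u) / C).
Proof.
have [C0 _] := fs_homothety.
have [rho rho0 transfer] := cone_transfer fs_lim fs_mul fs_homothety.
have [K1 K10 est1] := chart_estimate p.
have [K2 K20 est2] := map_estimate f_diffeo fp.
have [K3 K30 Linv] := tangent_map_lower.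
have [KL KL0 Lbd] := @linear_bound R n 'rV[R]_n (fun_of_lfun L).
exists (rho / 2); first by rewrite divr_gt0.
move=> u uE; have LuE := tangent_map_hor uE.
have cvr z a b (t l m : R) : 0 < t -> (cc_dist p z < (l / t)%:E)%E -> (cc_dist z a < (m / t)%:E)%E ->
    l + m <= b -> (cc_dist p a < (b / t)%:E)%E.
  move=> t0 h1 h2 lm; apply: lt_le_trans (cc_dist_trans h1 h2) _.
  by rewrite lee_fin -mulrDl ler_pM2r ?invr_gt0.
(* The curve is followed for time [1 / t], and all errors will be multiples of [e / t]. *)
have start w : w \in E p -> nrm w < rho / 2 -> forall e T : R, 0 < e -> e <= 1 -> e <= rho / 2 ->
    exists t z, [/\ T <= t, 0 < t, (cc_dist p z < ((nrm w + e) / t)%:E)%E,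
      (cc_dist p z < (rho / t)%:E)%E & `|t *: (c z - c p) - w| <= e].
  move=> wE wr e T e0 e1 er.
  have [delta delta0 Hd] := horizontal_curve wE e0.
  pose t := Num.max T (delta^-1 + 1).
  have td : delta^-1 < t by rewrite lt_max ltrDl ltr01 orbT.
  have t0 : 0 < t by apply: lt_trans td; rewrite invr_gt0.
  have [|z [pz cz zw]] := Hd t^-1.
    by rewrite invr_gt0 t0 /= -[delta]invrK ltf_pV2 ?posrE ?invr_gt0.
  exists t, z; split=> //; first by rewrite le_max lexx.
  - by rewrite mulrC.
  - apply: lt_le_trans pz _; rewrite lee_fin mulrC ler_pM2r ?invr_gt0//; lra.
  - have -> : t *: (c z - c p) - w = t *: (c z - c p - t^-1 *: w).
      by rewrite [RHS]scalerBr scalerA divff ?gt_eqF// scale1r.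
    by rewrite normrZ gtr0_norm// mulrC -ler_pdivlMr.
split=> small.
  apply: metric_le_of_escape LuE _ _; first by rewrite mulr_ge0 ?sqrtr_ge0// ltW.
  move=> eps T eps0.
  (* [A / t] bounds the distances of [z] and [a] to [p], as [e] is at most 1. [Q] sums all
     coefficients with which [e] occurs in the two final estimates. *)
  pose A := nrm u + 2; have A0 : 0 < A by rewrite ltr_wpDl ?sqrtr_ge0.
  pose Q := K2 * (1 + A) + KL * (1 + K1) + (2 * C + 1).
  have Q1 : 0 < K2 * (1 + A) by rewrite mulr_gt0// addr_gt0.
  have Q2 : 0 <= KL * (1 + K1) by rewrite mulr_ge0// addr_ge0// ltW.
  have Q3 : 0 < 2 * C + 1 by rewrite addr_gt0// mulr_gt0.
  have Q0 : 0 < Q by rewrite /Q ltr_wpDl// addr_ge0// ltW.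
  pose e := Num.min (Num.min 1 (rho / 2)) (eps / Q).
  have e0 : 0 < e by rewrite !lt_min ltr01 !divr_gt0.
  have e1 : e <= 1 by rewrite !ge_min lexx.
  have er : e <= rho / 2 by rewrite !ge_min lexx orbT.
  have eQ : Q * e <= eps by rewrite mulrC -ler_pdivlMr// ge_min lexx orbT.
  have [T1 T10 H1] := est1 A e A0 e0.
  have [T2 T20 H2] := est2 A e A0 e0.
  have [T3 T30 H3] := transfer e e0.
  have [t [z [tT t0 pz1 pz2 zu]]] :=
    start u uE small e (Num.max T (Num.max T1 (Num.max T2 T3))) e0 e1 er.
  move: tT; rewrite !ge_max => /andP[tT /andP[tT1 /andP[tT2 tT3]]].
  have [[a [b [za fab pab]]] _] := H3 t tT3 z pz2.
  have pa : (cc_dist p a < ((nrm u + 2 * e) / t)%:E)%E.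
    by apply: cvr t0 pz1 za _; lra.
  have pa' : (cc_dist p a < (A / t)%:E)%E.
    by apply: lt_le_trans pa _; rewrite lee_fin ler_pM2r ?invr_gt0// /A; lra.
  have pz' : (cc_dist p z < (A / t)%:E)%E.
    by apply: lt_le_trans pz1 _; rewrite lee_fin ler_pM2r ?invr_gt0// /A; lra.
  have [_ az] := H1 t tT1 z a pz' za.
  have ba := H2 t tT2 a b pa' fab.
  exists t, b; split=> //.
    apply: lt_le_trans (pab _ pa) _; rewrite lee_fin ler_pM2r ?invr_gt0//.
    have QE : Q * e = K2 * (1 + A) * e + KL * (1 + K1) * e + (2 * C + 1) * e by rewrite /Q; ring.
    have q1 : 0 <= K2 * (1 + A) * e by rewrite mulr_ge0// ltW.
    have q2 : 0 <= KL * (1 + K1) * e by rewrite mulr_ge0// ltW.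
    have -> : C * (nrm u + 2 * e) + e = C * nrm u + (2 * C + 1) * e by ring.
    rewrite lerD2l; apply: le_trans eQ; rewrite QE; lra.
  have -> : t *: (c b - c p) - L u = (t *: (c b - c p) - L (t *: (c a - c p))) +
      L (t *: (c a - c z) + (t *: (c z - c p) - u)).
    rewrite addrA -scalerDr addrA subrK (linearB _ (t *: (c a - c p))) /=.
    by rewrite addrA subrK.
  apply: le_trans (ler_normD _ _) _.
  have l1 : `|L (t *: (c a - c z) + (t *: (c z - c p) - u))| <= KL * (K1 * e + e).
    apply: le_trans (Lbd _) _; apply: ler_wpM2l => //.
    by apply: le_trans (ler_normD _ _) _; exact: lerD.
  apply: le_trans (lerD ba l1) _; apply: le_trans eQ.
  have -> : K2 * (1 + A) * e + KL * (K1 * e + e) = Q * e - (2 * C + 1) * e by rewrite /Q; ring.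
  by rewrite lerBlDr lerDl mulr_ge0// ltW.
(* Converse bound: the curve starts in the direction [L u], and the point tested is [a], whose image
   is near [z]. The lower bound on [L] turns closeness of images into closeness of
   [t *: (c a - c p)] to [u]. *)
apply: metric_le_of_escape uE _ _; first by rewrite divr_ge0 ?sqrtr_ge0// ltW.
move=> eps T eps0; set w := L u in LuE small *.
pose A := (nrm w + 2) / C + 1.
have w2 : 0 < nrm w + 2 by rewrite ltr_wpDl ?sqrtr_ge0.
have A0 : 0 < A by rewrite addr_gt0// divr_gt0.
pose Q := K3 * (1 + K1 + K2 * (1 + A)) + (2 / C + 1).
have Q1 : 0 < K2 * (1 + A) by rewrite mulr_gt0// addr_gt0.
have Q2 : 0 < K3 * (1 + K1 + K2 * (1 + A)) by rewrite mulr_gt0// !addr_gt0.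
have Q3 : 0 < 2 / C + 1 by rewrite addr_gt0// divr_gt0.
have Q0 : 0 < Q by rewrite addr_gt0.
pose e := Num.min (Num.min 1 (rho / 2)) (eps / Q).
have e0 : 0 < e by rewrite !lt_min ltr01 !divr_gt0.
have e1 : e <= 1 by rewrite !ge_min lexx.
have er : e <= rho / 2 by rewrite !ge_min lexx orbT.
have eQ : Q * e <= eps by rewrite mulrC -ler_pdivlMr// ge_min lexx orbT.
have [T1 T10 H1] := est1 (nrm w + 2) e w2 e0.
have [T2 T20 H2] := est2 A e A0 e0.
have [T3 T30 H3] := transfer e e0.
have [t [z [tT t0 pz1 pz2 zw]]] :=
  start w LuE small e (Num.max T (Num.max T1 (Num.max T2 T3))) e0 e1 er.
move: tT; rewrite !ge_max => /andP[tT /andP[tT1 /andP[tT2 tT3]]].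
have [_ [a [b [zb fab pba]]]] := H3 t tT3 z pz2.
have pb : (cc_dist p b < ((nrm w + 2 * e) / t)%:E)%E.
  by apply: cvr t0 pz1 zb _; lra.
have pa := pba _ pb.
have QE : Q * e = K3 * (1 + K1 + K2 * (1 + A)) * e + (2 / C + 1) * e by rewrite /Q mulrDl.
have pE : (nrm w + 2 * e) / C + e = nrm w / C + (2 / C + 1) * e.
  by field; rewrite gt_eqF.
have pa' : (cc_dist p a < (A / t)%:E)%E.
  apply: lt_le_trans pa _; rewrite lee_fin ler_pM2r ?invr_gt0// /A.
  by apply: lerD => //; rewrite ler_pM2r ?invr_gt0//; lra.
have pz' : (cc_dist p z < ((nrm w + 2) / t)%:E)%E.
  by apply: lt_le_trans pz1 _; rewrite lee_fin ler_pM2r ?invr_gt0//; lra.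
have [_ bz] := H1 t tT1 z b pz' zb.
have ba := H2 t tT2 a b pa' fab.
exists t, a; split=> //.
  apply: lt_le_trans pa _; rewrite lee_fin ler_pM2r ?invr_gt0// pE lerD2l.
  by apply: le_trans eQ; rewrite QE lerDr mulr_ge0// ltW.
apply: le_trans (Linv _) _.
have -> : L (t *: (c a - c p) - u) = (t *: (c z - c p) - w) + t *: (c b - c z) -
    (t *: (c b - c p) - L (t *: (c a - c p))).
  have group (X W P B : 'rV[R]_n) : X - W = (P - W) + B - (P + B - X).
    by apply/rowP => j; rewrite !mxE; ring.
  have -> : t *: (c b - c p) = t *: (c z - c p) + t *: (c b - c z).
    by rewrite -scalerDr [_ + (c b - _)]addrC addrA subrK.
  by rewrite (linearB _ (t *: (c a - c p))) /= -/w; exact: group.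
apply: (@le_trans _ _ (K3 * (e + K1 * e + K2 * (1 + A) * e))).
  apply: ler_wpM2l; first exact: ltW.
  apply: le_trans (ler_normB _ _) _; apply: lerD => //.
  by apply: le_trans (ler_normD _ _) _; apply: lerD.
apply: le_trans eQ; rewrite QE.
have -> : K3 * (e + K1 * e + K2 * (1 + A) * e) = K3 * (1 + K1 + K2 * (1 + A)) * e by ring.
by rewrite lerDl mulr_ge0// ltW.
Qed.

Lemma horizontal_similarity u : u \in E p -> sr_metric p (L u) (L u) = C ^+ 2 * sr_metric p u u.
Proof.
move=> uE; have [C0 _] := fs_homothety; have LuE := tangent_map_hor uE.
have [rho rho0 H] := horizontal_upper_lower.
(* Scales both [u] and [L u] below [rho], so that the two bounds apply to the same vector. *)
pose s := rho / (nrm u + nrm (L u) + 1).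
have d0 : 0 < nrm u + nrm (L u) + 1 by rewrite ltr_wpDl// addr_ge0 ?sqrtr_ge0.
have s0 : 0 < s by rewrite divr_gt0.
have nrmZ v : v \in E p -> nrm (s *: v) = s * nrm v.
  by move=> vE; rewrite sr_metricZ// sqrtrM ?sqr_ge0// sqrtr_sqr gtr0_norm.
have [|up lo] := H (s *: u); first exact: memvZ.
rewrite linearZ /= !nrmZ// in up lo.
have lt v : 0 <= v -> v < nrm u + nrm (L u) + 1 -> s * v < rho.
  by move=> v0 vl; rewrite mulrAC ltr_pdivrMr// ltr_pM2l.
have u0 : 0 <= nrm u := sqrtr_ge0 _; have Lu0 : 0 <= nrm (L u) := sqrtr_ge0 _.
have {}up : nrm (L u) <= C * nrm u.
  by have := up (lt _ u0 ltac:(lra)); rewrite mulrCA ler_pM2l.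
have {}lo : C * nrm u <= nrm (L u).
  by have := lo (lt _ Lu0 ltac:(lra)); rewrite -(mulrA s) ler_pM2l// ler_pdivlMr// mulrC.
have eq : nrm (L u) = C * nrm u by apply: le_anti; rewrite up lo.
have := congr1 (fun x => x ^+ 2) eq.
by rewrite exprMn !sqr_sqrtr// metric_ge0.
Qed.

End HorizontalIsometry.

(* The multiset of exponents over E^i_p consists of (j+1) log lambda repeated
   dim n^j times, for j = 0, ..., i.  A homothety may also contract or be an
   isometry (f = id), so lambda > 1 is asserted for expanding ones, i.e. 1 < C. *)
Theorem theorem1p4 (R : realType) (n r : nat) (N : subRiemannian R n) (f : N -> N) (p : N)
    (f_diffeo : local_diffeo f) (f_hor : preserves_hor f)
    (E_generic : generic_at (@hor R n N) r p) (fp : f p = p)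
    (TC : @tangent_cone R n r N p) (fs : TC -> TC)
    (fs_lim : carnot_derivative f fs) (fs_aut : graded_automorphism fs)
    (C : R) (fs_homothety : homothety C fs) :
  exists lambda : R, 0 < lambda /\ (1 < C -> 1 < lambda) /\
    forall i : nat, (i <= r)%N ->
      lyapunov_exponents_on (tangent_map f p) (flag (@hor R n N) i p)
        (flatten [seq nseq (\dim (grad TC j)) (j.+1%:R * ln lambda) | j <- iota 0 i.+1]).
Proof.
have [C0 _] := fs_homothety; have [fs_mul _ _ _] := fs_aut.
exists C; split=> //; split=> // i _; apply: tangent_lyapunov => //.
by move=> u; exact: (horizontal_similarity f_diffeo f_hor fp fs_lim fs_mul fs_homothety).
Qed.
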